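(* Let $G$ be a topological group with property (T), let $\Omega$ be a standard Borel space, $\mu$ a finite measure on $\Omega$, and let $p\in[1,\infty)$, $p\neq2$. Suppose that $\pi:G\curvearrowright L_p(\Omega,\mu)$ is a linear isometric action such that its associated Banach--Lamperti (BL) action $G\curvearrowright(\Omega,\mu)$ is ergodic and measure preserving, so that $\pi_\gamma(h)(\omega)=\chi^{(\gamma)}(\omega)h(\gamma^{-1}\omega)$ with $|\chi^{(\gamma)}|=1$ a.e. Then for any $\pi$-cocycle $b:G\to L_p(\Omega,\mu)$ there is $f\in L_{p,w}(\Omega,\mu)$ such that $b_\gamma=\pi_\gamma f-f$ for all $\gamma\in G$, where $\pi_\gamma f$ is defined for $f\in L_{p,w}(\Omega,\mu)$ by the same formula $\pi_\gamma f(\omega)=\chi^{(\gamma)}(\omega)f(\gamma^{-1}\omega)$.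
   Context: A linear isometric action $\pi:G\curvearrowright X$ on a Banach space $X$ is a strongly continuous group homomorphism $\gamma\mapsto\pi_\gamma$ from $G$ to the group of all invertible linear isometries of $X$. It almost has invariant vectors if $\inf_{\|x\|=1}\mathrm{diam}(\pi(K)x)=0$ for all compact $K\subset G$. $G$ has property (T) if for every Hilbert space $H$ and every linear isometric action $\pi:G\curvearrowright H$, the quotient action of $G$ on $H/H^{\pi}$ does not almost have invariant vectors, where $H^\pi$ is the subspace of $\pi(G)$-invariant vectors. BL action: by the Banach--Lamperti theorem, for $1\le p<\infty$, $p\ne2$, every linear isometric action $\pi$ of $G$ on $L_p(\Omega,\mu)$ induces a measure-class preserving action of $G$ on $(\Omega,\mu)$ (understood up to null sets), called the BL action, and measurable functions $\chi^{(\gamma)}$ on $\Omega$ with $|\chi^{(\gamma)}|=1$ a.e. ($\gamma\in G$), such that for all $h\in L_p(\Omega,\mu)$ and $\gamma\in G$, $\pi_\gamma(h)(\omega)=\chi^{(\gamma)}(\omega)h(\gamma^{-1}\omega)\big[\frac{d\gamma\mu}{d\mu}(\omega)\big]^{1/p}$ for a.e. $\omega$. If the BL action is measure preserving, the Radon--Nikodym factor is $1$. The action is ergodic if every measurable $A\subset\Omega$ with $\mu(\gamma A\,\triangle\,A)=0$ for all $\gamma\in G$ satisfies $\mu(A)=0$ or $\mu(\Omega\setminus A)=0$. A $\pi$-cocycle is a continuous map $b:G\to L_p(\Omega,\mu)$, $\gamma\mapsto b_\gamma$, with $b_{\gamma\gamma'}=b_\gamma+\pi_\gamma b_{\gamma'}$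 for all $\gamma,\gamma'\in G$. Weak $L_p$ space: for a measurable function $f$ on $\Omega$ let $\lambda_f(x)=\mu(\{\omega\in\Omega:|f(\omega)|>x\})$ and $\|f\|_{p,w}=\sup_{x>0}x\,\lambda_f(x)^{1/p}$. Then $L_{p,w}(\Omega,\mu)=\{f:\|f\|_{p,w}<\infty\}$. *)

(* Defs.v *)
From HB Require Import structures.
From mathcomp Require Import all_boot all_order all_algebra.
From mathcomp Require Import complex ring_quotient.
From mathcomp Require Import all_classical all_reals all_analysis.
From mathcomp Require Import measurable_realfun.

Set Implicit Arguments.
Unset Strict Implicit.
Unset Printing Implicit Defensive.

Import Order.TTheory GRing.Theory Num.Theory.
Import numFieldNormedType.Exports.

Local Open Scope classical_set_scope.
Local Open Scope ring_scope.
Local Open Scope quotient_scope.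

HB.mixin Record isTopologicalGroup G & Group G & Topological G := {
  mulg_continuous : continuous (fun x : G * G => (x.1 * x.2)%g);
  invg_continuous : continuous (fun x : G => (x^-1)%g)
}.

#[short(type="topologicalGroupType")]
HB.structure Definition TopologicalGroup :=
  {G of Group G & Topological G & isTopologicalGroup G}.

(* Banach spaces are either real or complex: everything below is parametrized
   by the kind of scalars, so that both cases are covered. *)
Variant scalar_kind := RealScalars | ComplexScalars.

Section scalars.
Variable R : realType.

Definition scalars (s : scalar_kind) : numFieldType :=
  match s with RealScalars => R | ComplexScalars => R[i] end.

Definition sRe (s : scalar_kind) : scalars s -> R :=
  match s return scalars s -> R with
  | RealScalars => fun a : R => a
  | ComplexScalars => fun a : R[i] => complex.Re a
  end.

Definition sIm (s : scalar_kind) : scalars s -> R :=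
  match s return scalars s -> R with
  | RealScalars => fun=> 0
  | ComplexScalars => fun a : R[i] => complex.Im a
  end.

Definition sconj (s : scalar_kind) : scalars s -> scalars s :=
  match s return scalars s -> scalars s with
  | RealScalars => fun a : R => a
  | ComplexScalars => fun a : R[i] => conjc a
  end.

Definition of_real (s : scalar_kind) : R -> scalars s :=
  match s return R -> scalars s with
  | RealScalars => fun a => a
  | ComplexScalars => fun a => (a%:C)%C
  end.

(* Norms in MathComp are valued in the scalar field, even when it is complex;
   [rnorm] is the same norm as an element of [R]. *)
Definition rnorm (s : scalar_kind) (V : normedZmodType (scalars s)) (x : V) : R :=
  sRe `|x|.

End scalars.
Arguments of_real {R} s _.

Section scalars_theory.
Context (R : realType) (s : scalar_kind).
Local Notation K := (scalars R s).
Implicit Types (a b : K) (x y : R).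

Lemma sReD : {morph @sRe R s : a b / a + b}.
Proof. by case: s => // -[? ?] [? ?]. Qed.

Lemma sImD : {morph @sIm R s : a b / a + b}.
Proof. by case: s => [? ?|[? ?] [? ?]] //=; rewrite addr0. Qed.

Lemma sReM a b : sRe (a * b) = sRe a * sRe b - sIm a * sIm b.
Proof. by case: s a b => [? ?|[? ?] [? ?]] //=; rewrite mul0r subr0. Qed.

Lemma sImM a b : sIm (a * b) = sRe a * sIm b + sIm a * sRe b.
Proof. by case: s a b => [? ?|[? ?] [? ?]] //=; rewrite mulr0 mul0r addr0. Qed.

Lemma sRe0 : sRe (0 : K) = 0. Proof. by case: s. Qed.
Lemma sIm0 : sIm (0 : K) = 0. Proof. by case: s. Qed.

Lemma of_realD : {morph @of_real R s : x y / x + y}.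
Proof. by case: s => //= x y; rewrite rmorphD. Qed.

Lemma of_realM : {morph @of_real R s : x y / x * y}.
Proof. by case: s => //= x y; rewrite rmorphM. Qed.

Lemma of_realK : cancel (@of_real R s) (@sRe R s).
Proof. by case: s. Qed.

Lemma ler_of_real : {mono @of_real R s : x y / x <= y}.
Proof. by case: s => // x y; rewrite /= lecR. Qed.

Lemma ler_sRe a b : a <= b -> sRe a <= sRe b.
Proof. by case: s a b => //= -[? ?] [? ?] /=; rewrite lecE /= => /andP[]. Qed.

Lemma rnormK (V : normedZmodType K) (v : V) : of_real s (rnorm v) = `|v|.
Proof.
rewrite /rnorm; have : 0 <= `|v| by [].
by move: `|v|; case: s => //= -[a b]; rewrite lecE /= => /andP[/eqP -> _].
Qed.

Lemma rnormM a b : rnorm (a * b) = rnorm a * rnorm b.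
Proof. by apply: (can_inj of_realK); rewrite of_realM !rnormK normrM. Qed.

Lemma rnorm_ge0 (V : normedZmodType K) (v : V) : 0 <= rnorm v.
Proof. by rewrite /rnorm -sRe0 ler_sRe. Qed.

Lemma ler_rnormD (V : normedZmodType K) (u v : V) :
  rnorm (u + v) <= rnorm u + rnorm v.
Proof. by rewrite /rnorm -sReD ler_sRe ?ler_normD. Qed.

Lemma rnormE a : rnorm a = Num.sqrt (sRe a ^+ 2 + sIm a ^+ 2).
Proof.
rewrite /rnorm; case: s a => [a|[a b]] //=.
by rewrite expr0n addr0 sqrtr_sqr.
Qed.

End scalars_theory.

Record seminorm (R : realType) (s : scalar_kind) (X : lmodType (scalars R s)) :=
  Seminorm {
    seminorm_fun :> X -> R;
    seminormD : forall x y, seminorm_fun (x + y) <= seminorm_fun x + seminorm_fun y;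
    seminormZ : forall a x, seminorm_fun (a *: x) = rnorm a * seminorm_fun x
  }.

Section seminorm_quotient.
Context (R : realType) (s : scalar_kind) (X : lmodType (scalars R s)).
Variable N : seminorm X.
Local Notation K := (scalars R s).

Definition null_vectors : {pred X} := [pred x | N x == 0].

Lemma seminorm0 : N 0 = 0.
Proof. by rewrite -(scale0r 0) seminormZ /rnorm normr0 sRe0 mul0r. Qed.

Lemma seminormN x : N (- x) = N x.
Proof.
rewrite -scaleN1r seminormZ /rnorm normrN normr1.
by rewrite (_ : sRe 1 = 1) ?mul1r//; case: (s).
Qed.

Lemma seminorm_ge0 x : 0 <= N x.
Proof.
have := seminormD N x (- x); rewrite subrr seminorm0 seminormN -mulr2n.
by rewrite pmulrn_lge0.
Qed.

Fact null_vectors_zmod_closed : zmod_closed null_vectors.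
Proof.
split=> [|x y]; rewrite !inE ?seminorm0// => /eqP x0 /eqP y0.
rewrite eq_le seminorm_ge0 andbT.
by rewrite (le_trans (seminormD _ _ _))// seminormN x0 y0 addr0.
Qed.

HB.instance Definition _ :=
  GRing.isZmodClosed.Build X null_vectors null_vectors_zmod_closed.

Definition seminorm_quotient : Type := Quotient.quot null_vectors.

HB.instance Definition _ := GRing.Zmodule.on seminorm_quotient.
HB.instance Definition _ := EqQuotient.on seminorm_quotient.

Local Notation Q := seminorm_quotient.

Lemma eq_seminorm_quotient x y :
  \pi_Q x = \pi_Q y <-> N (x - y) = 0.
Proof.
have := Quotient.idealrBE null_vectors x y; rewrite inE => NE.
by split=> [/eqP|/eqP]; [rewrite -NE => /eqP | rewrite NE => /eqP].
Qed.

Lemma seminorm_quotient_piD x y : \pi_Q (x + y) = \pi_Q x + \pi_Q y.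
Proof. exact: Quotient.pi_add. Qed.

Lemma seminorm_eq x y : \pi_Q x = \pi_Q y -> N x = N y.
Proof.
move=> /eq_seminorm_quotient xy; apply/eqP; rewrite eq_le.
have le u v : N (u - v) = 0 -> N u <= N v.
  by move=> uv; rewrite -[u](subrK v) (le_trans (seminormD _ _ _))// uv add0r.
by rewrite !le// -opprB seminormN.
Qed.

Definition quotient_scale (a : K) (u : Q) : Q := \pi_Q (a *: repr u).

Lemma quotient_scale_pi a x : quotient_scale a (\pi_Q x) = \pi_Q (a *: x).
Proof.
have xE := (eq_seminorm_quotient _ _).1 (reprK (\pi_Q x)).
apply/eq_seminorm_quotient.
by rewrite -scalerBr seminormZ xE mulr0.
Qed.

Fact quotient_scalerA a b u :
  quotient_scale a (quotient_scale b u) = quotient_scale (a * b) u.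
Proof.
rewrite -[u]reprK (quotient_scale_pi b) (quotient_scale_pi a).
by rewrite (quotient_scale_pi (a * b)) scalerA.
Qed.

Fact quotient_scale1r : left_id 1 quotient_scale.
Proof. by move=> u; rewrite -[u]reprK quotient_scale_pi scale1r. Qed.

Fact quotient_scalerDr : right_distributive quotient_scale +%R.
Proof.
move=> a u v; rewrite -[u]reprK -[v]reprK -seminorm_quotient_piD.
by rewrite !quotient_scale_pi scalerDr seminorm_quotient_piD.
Qed.

Fact quotient_scalerDl u : {morph quotient_scale^~ u : a b / a + b}.
Proof.
move=> a b; rewrite -[u]reprK !quotient_scale_pi scalerDl.
exact: seminorm_quotient_piD.
Qed.

HB.instance Definition _ := GRing.Zmodule_isLmodule.Build K Q
  quotient_scalerA quotient_scale1r quotient_scalerDr quotient_scalerDl.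

Definition quotient_norm (u : Q) : K := of_real s (N (repr u)).

Lemma quotient_norm_pi x : quotient_norm (\pi_Q x) = of_real s (N x).
Proof. by congr of_real; apply: seminorm_eq; rewrite reprK. Qed.

Fact ler_quotient_normD u v :
  quotient_norm (u + v) <= quotient_norm u + quotient_norm v.
Proof.
rewrite -[u]reprK -[v]reprK -seminorm_quotient_piD !quotient_norm_pi -of_realD.
by rewrite ler_of_real seminormD.
Qed.

Fact quotient_normZ a u : quotient_norm (a *: u) = `|a| * quotient_norm u.
Proof.
rewrite -[u]reprK [_ *: _]quotient_scale_pi !quotient_norm_pi seminormZ.
by rewrite of_realM rnormK.
Qed.

Fact quotient_norm_eq0 u : quotient_norm u = 0 -> u = 0.
Proof.
rewrite -[u]reprK quotient_norm_pi => /(congr1 (@sRe R s)).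
rewrite of_realK sRe0 => Nu.
have <- : \pi_Q 0 = 0 :> Q.
  by apply: (@addrI _ (\pi_Q 0)); rewrite -seminorm_quotient_piD !addr0.
by apply/eq_seminorm_quotient; rewrite subr0.
Qed.

HB.instance Definition _ := Lmodule_isNormed.Build K Q
  ler_quotient_normD quotient_normZ quotient_norm_eq0.

Lemma norm_pi x : `|\pi_Q x : Q| = of_real s (N x).
Proof. exact: quotient_norm_pi. Qed.

End seminorm_quotient.

Record linear_isometric_action (R : realType) (s : scalar_kind)
    (G : topologicalGroupType) (X : normedModType (scalars R s)) :=
  LinearIsometricAction {
    action_fun :> G -> {linear X -> X};
    action1 : forall x, action_fun 1%g x = x;
    actionM : forall g h x, action_fun (g * h)%g x = action_fun g (action_fun h x);
    action_isometry : forall g x, `|action_fun g x| = `|x|;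
    action_continuous : forall x, continuous (fun g => action_fun g x)
  }.

(* The supremum is taken in [0, +oo], so that the empty set has diameter 0. *)
Definition diameter (R : realType) (s : scalar_kind)
    (X : normedModType (scalars R s)) (A : set X) : \bar R :=
  ereal_sup ([set 0%E] `|` [set (rnorm (x - y))%:E | x in A & y in A]).

Definition almost_has_invariant_vectors (R : realType) (s : scalar_kind)
    (G : topologicalGroupType) (X : normedModType (scalars R s))
    (rho : G -> X -> X) : Prop :=
  forall C : set G, compact C ->
    ereal_inf [set diameter [set rho g x | g in C] | x in [set x : X | `|x| = 1]]
      = 0%E.

Section invariant_vectors.
Context (R : realType) (s : scalar_kind) (G : topologicalGroupType).
Context (X : normedModType (scalars R s)) (rho : linear_isometric_action G X).

Definition invariant_vectors : set X := [set v | forall g, rho g v = v].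

Definition dist_invariant_vectors (x : X) : R :=
  inf [set rnorm (x - v) | v in invariant_vectors].

Local Notation D x := [set rnorm (x - v) | v in invariant_vectors].

Fact invariant_vectors0 : invariant_vectors 0.
Proof. by move=> g; rewrite raddf0. Qed.

Fact invariant_vectorsD u v :
  invariant_vectors u -> invariant_vectors v -> invariant_vectors (u + v).
Proof. by move=> hu hv g; rewrite raddfD /= hu hv. Qed.

Fact invariant_vectorsZ a v : invariant_vectors v -> invariant_vectors (a *: v).
Proof. by move=> hv g; rewrite linearZ /= hv. Qed.

Fact dist_invariant_vectors_has_inf x : has_inf (D x).
Proof.
split; first by exists (rnorm (x - 0)), 0 => //; exact: invariant_vectors0.
by exists 0 => _ [v _ <-]; exact: rnorm_ge0.
Qed.

Fact dist_invariant_vectors_le x v :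
  invariant_vectors v -> dist_invariant_vectors x <= rnorm (x - v).
Proof.
move=> hv; apply: ge_inf; last by exists v.
exact: (dist_invariant_vectors_has_inf x).2.
Qed.

Fact dist_invariant_vectorsD x y : dist_invariant_vectors (x + y) <=
  dist_invariant_vectors x + dist_invariant_vectors y.
Proof.
rewrite -lerBlDr; apply: lb_le_inf.
  exact: (dist_invariant_vectors_has_inf x).1.
move=> _ [v hv <-]; rewrite lerBlDr -lerBlDl.
apply: lb_le_inf; first exact: (dist_invariant_vectors_has_inf y).1.
move=> _ [w hw <-]; rewrite lerBlDl.
apply: le_trans (dist_invariant_vectors_le (x + y) (invariant_vectorsD hv hw)) _.
by rewrite opprD addrACA ler_rnormD.
Qed.

Fact dist_invariant_vectors_leZ a x :
  dist_invariant_vectors (a *: x) <= rnorm a * dist_invariant_vectors x.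
Proof.
have rZ (b : scalars R s) (z : X) : rnorm (b *: z) = rnorm b * rnorm z.
  by apply: (can_inj (@of_realK R s)); rewrite of_realM !rnormK normrZ.
have [->|a0] := eqVneq a 0.
  rewrite scale0r (le_trans (dist_invariant_vectors_le _ invariant_vectors0))//.
  rewrite subr0 /rnorm !normr0 sRe0.
  by rewrite mul0r.
have a_gt0 : 0 < rnorm a.
  rewrite lt_neqAle rnorm_ge0 andbT eq_sym; apply/eqP => /(congr1 (@of_real R s)).
  rewrite rnormK (_ : of_real s 0 = 0); last by case: (s).
  by move/normr0_eq0/eqP; exact/negP.
rewrite mulrC -ler_pdivrMr//.
apply: lb_le_inf; first exact: (dist_invariant_vectors_has_inf x).1.
move=> _ [v hv <-]; rewrite ler_pdivrMr// mulrC -rZ scalerBr.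
exact/dist_invariant_vectors_le/invariant_vectorsZ.
Qed.

Fact dist_invariant_vectorsZ a x :
  dist_invariant_vectors (a *: x) = rnorm a * dist_invariant_vectors x.
Proof.
have [->|a0] := eqVneq a 0.
  apply/eqP; rewrite eq_le dist_invariant_vectors_leZ /= /rnorm normr0 sRe0 mul0r.
  apply: lb_le_inf; first exact: (dist_invariant_vectors_has_inf _).1.
  by move=> _ [v _ <-]; exact: rnorm_ge0.
apply/eqP; rewrite eq_le dist_invariant_vectors_leZ /=.
have {1}-> : x = a^-1 *: (a *: x) by rewrite scalerA mulVf// scale1r.
apply: (le_trans (ler_wpM2l (rnorm_ge0 _) (dist_invariant_vectors_leZ _ _))).
rewrite mulrA -rnormM mulfV// (_ : rnorm (1 : scalars R s) = 1) ?mul1r//.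
by rewrite /rnorm normr1; case: (s).
Qed.

Definition invariant_seminorm : seminorm X :=
  Seminorm dist_invariant_vectorsD dist_invariant_vectorsZ.

(* The invariant vectors form a closed subspace, hence they are exactly the
   vectors at distance 0 from it and this is X / X^rho with the quotient norm. *)
Definition invariant_quotient := seminorm_quotient invariant_seminorm.

HB.instance Definition _ := NormedModule.on invariant_quotient.

Definition quotient_action (g : G) (u : invariant_quotient) :
    invariant_quotient :=
  \pi_(seminorm_quotient invariant_seminorm) (rho g (repr u)).

End invariant_vectors.
Arguments quotient_action {R s G X} rho g u.

(* A Hilbert space is a complete normed module [H] together with an inner
   product [dot] inducing its norm. *)
Definition property_T (R : realType) (s : scalar_kind)
    (G : topologicalGroupType) : Prop :=
  forall (H : completeNormedModType (scalars R s))
      (dot : {dot H for @sconj R s}),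
    (forall x : H, `|x| ^+ 2 = dot x x) ->
  forall rho : linear_isometric_action G H,
    ~ almost_has_invariant_vectors (quotient_action rho).
Arguments property_T : clear implicits.

(* Borel subsets of Polish spaces, up to isomorphism *)
Definition standard_borel (R : realType) d (Omega : measurableType d) : Prop :=
  exists (P : completePseudoMetricType R) (i : Omega -> P),
    [/\ hausdorff_space P /\ @second_countable P,
        injective i,
        <<s [set U : set P | open U] >> (range i) &
        forall A : set Omega, measurable A <->
          exists2 B, <<s [set U : set P | open U] >> B & A = i @^-1` B].
Arguments standard_borel : clear implicits.

Section Lp_space.
Context (R : realType) (s : scalar_kind) d (Omega : measurableType d).
Context (mu : {finite_measure set Omega -> \bar R}).
Local Notation K := (scalars R s).

Definition scalar_measurable (f : Omega -> K) : Prop :=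
  measurable_fun setT (fun w => sRe (f w)) /\
  measurable_fun setT (fun w => sIm (f w)).

Lemma measurable_rnorm (f : Omega -> K) : scalar_measurable f ->
  measurable_fun setT (fun w => rnorm (f w)).
Proof.
move=> [mr mi]; under eq_fun do rewrite rnormE.
apply: (@measurableT_comp _ _ _ _ _ _ (@Num.sqrt R)) => //.
  by apply: continuous_measurable_fun; exact: sqrt_continuous.
by apply: measurable_funD; exact: measurable_funX.
Qed.

Context (p : R) (p1 : 1 <= p).

Definition norm_p (f : Omega -> K) : \bar R :=
  'N[mu]_p%:E[(fun w => (rnorm (f w))%:E)].

(* [p1] is recorded so that closure under addition can be a canonical instance. *)
Definition p_integrable : {pred Omega -> K} :=
  let _ := p1 in [pred f | `[< scalar_measurable f /\ (norm_p f < +oo)%E >]].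

Fact ge1_gt0 : 0 < p. Proof. exact: lt_le_trans p1. Qed.

Lemma scalar_measurableD (f g : Omega -> K) :
  scalar_measurable f -> scalar_measurable g -> scalar_measurable (f + g).
Proof.
move=> [mrf mif] [mrg mig]; split.
  under eq_fun do rewrite [X in sRe X]/(f _ + g _) sReD.
  exact: measurable_funD.
by under eq_fun do rewrite [X in sIm X]/(f _ + g _) sImD; exact: measurable_funD.
Qed.

Lemma scalar_measurableZ (a : K) (f : Omega -> K) :
  scalar_measurable f -> scalar_measurable (a *: f).
Proof.
move=> [mrf mif]; split.
- under eq_fun do rewrite /= sReM.
  by apply: measurable_funB; exact: measurable_funM.
- under eq_fun do rewrite /= sImM.
  by apply: measurable_funD; exact: measurable_funM.
Qed.

Lemma norm_pD (f g : Omega -> K) : scalar_measurable f -> scalar_measurable g ->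
  (norm_p (f + g)%R <= norm_p f + norm_p g)%E.
Proof.
have p_gt0 := ge1_gt0.
move=> mf mg; have mfg := scalar_measurableD mf mg.
have [nf ng] := (measurable_rnorm mf, measurable_rnorm mg).
have nfg := measurable_rnorm mfg.
apply: le_trans (eminkowski mu nf ng _) => //.
rewrite /norm_p unlock /Lnorm.
have mpow (h : Omega -> R) : measurable_fun setT h ->
    measurable_fun setT (fun w => `|(h w)%:E| `^ p)%E.
  move=> mh; apply: (measurableT_comp (measurable_poweR _)) => //.
  by apply: measurableT_comp => //; exact/measurable_EFinP.
apply: gt0_ler_poweR; rewrite ?invr_ge0 ?(ltW p_gt0)// ?in_itv/= ?leey ?andbT.
- by apply: integral_ge0 => w _; rewrite lee_fin powR_ge0.
- by apply: integral_ge0 => w _; rewrite lee_fin powR_ge0.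
apply: ge0_le_integral => //.
- exact: (mpow (fun w => rnorm ((f + g) w))).
- apply: (mpow (fun w => rnorm (f w) + rnorm (g w))); exact: measurable_funD.
move=> w _; rewrite lee_fin ge0_ler_powR ?nnegrE ?normr_ge0// ?(ltW p_gt0)//.
rewrite !ger0_norm ?addr_ge0 ?rnorm_ge0//; exact: ler_rnormD.
Qed.

Lemma norm_pZ (a : K) (f : Omega -> K) : scalar_measurable f ->
  norm_p (a *: f) = ((rnorm a)%:E * norm_p f)%E.
Proof.
have p_gt0 := ge1_gt0.
move=> /measurable_rnorm mf; rewrite /norm_p unlock /Lnorm.
under eq_integral do rewrite /= rnormM normrM powRM// EFinM.
rewrite ge0_integralZl//.
- rewrite poweRM ?lee_fin ?powR_ge0 ?integral_ge0//.
  rewrite poweR_EFin -powRrM mulfV ?gt_eqF// powRr1//.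
  by rewrite ger0_norm// rnorm_ge0.
- have : measurable_fun setT (fun w => (`|(rnorm (f w))%:E| `^ p)%E).
    apply: (measurableT_comp (measurable_poweR _)) => //.
    by apply: measurableT_comp => //; exact/measurable_EFinP.
  exact.
Qed.

Lemma p_integrableP (f : Omega -> K) :
  reflect (scalar_measurable f /\ (norm_p f < +oo)%E) (f \in p_integrable).
Proof. exact: asboolP. Qed.

Fact p_integrable_submod_closed : submod_closed p_integrable.
Proof.
have p_gt0 := ge1_gt0.
split=> [|a f g].
  apply/p_integrableP; split.
    by split; under eq_fun do rewrite /= ?(sRe0, sIm0); exact: measurable_cst.
  rewrite /norm_p (_ : (fun=> _) = cst 0%E) ?Lnorm0 ?ltry// ?eqe ?gt_eqF//.
  by apply/funext => w; rewrite /rnorm /= normr0 sRe0.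
move=> /p_integrableP[mf f_lty] /p_integrableP[mg g_lty]; apply/p_integrableP.
have maf := scalar_measurableZ a mf; split; first exact: scalar_measurableD.
apply: le_lt_trans (norm_pD maf mg) _.
by rewrite lte_add_pinfty// norm_pZ// lte_mul_pinfty// ?lee_fin ?rnorm_ge0.
Qed.

HB.instance Definition _ :=
  GRing.isSubmodClosed.Build K (Omega -> K) p_integrable p_integrable_submod_closed.

Record Lp_function := LpFunction {
  Lp_fun :> Omega -> K;
  _ : Lp_fun \in p_integrable
}.

HB.instance Definition _ := [isSub for Lp_fun].
HB.instance Definition _ := [Choice of Lp_function by <:].
HB.instance Definition _ := [SubChoice_isSubLmodule of Lp_function by <:].

Lemma Lp_function_measurable (f : Lp_function) : scalar_measurable f.
Proof. by case: f => f /= /p_integrableP[]. Qed.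

Lemma norm_p_fin_num (f : Lp_function) : norm_p f \is a fin_num.
Proof.
case: f => f /= /p_integrableP[_ f_lty].
by rewrite ge0_fin_numE ?Lnorm_ge0.
Qed.

Fact fine_norm_pD (f g : Lp_function) :
  fine (norm_p (f + g)) <= fine (norm_p f) + fine (norm_p g).
Proof.
rewrite -fineD ?norm_p_fin_num// fine_le ?fin_numD ?norm_p_fin_num//.
exact: norm_pD (Lp_function_measurable f) (Lp_function_measurable g).
Qed.

Fact fine_norm_pZ (a : K) (f : Lp_function) :
  fine (norm_p (a *: f)) = rnorm a * fine (norm_p f).
Proof.
by rewrite (norm_pZ _ (Lp_function_measurable f)) fineM ?norm_p_fin_num.
Qed.

Definition Lp_seminorm : seminorm Lp_function :=
  Seminorm fine_norm_pD fine_norm_pZ.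

Definition Lp := seminorm_quotient Lp_seminorm.

HB.instance Definition _ := NormedModule.on Lp.

Definition Lp_repr (h : Lp) : Omega -> K :=
  repr (h : seminorm_quotient Lp_seminorm).

Lemma Lp_eqP (f g : Lp_function) :
  \pi_(seminorm_quotient Lp_seminorm) f = \pi_(seminorm_quotient Lp_seminorm) g
  <-> (f : Omega -> K) = g %[ae mu].
Proof.
have p_gt0 := ge1_gt0.
have -> := eq_seminorm_quotient Lp_seminorm f g.
have mfg := measurable_rnorm (Lp_function_measurable (f - g)).
have mfgE : measurable_fun setT (fun w => (rnorm ((f - g : Omega -> K) w))%:E).
  exact: (measurable_EFinP _ _).2.
split=> fg.
  have /(Lnorm_eq0_eq0 mfgE) : norm_p (f - g) = 0%E.
    by rewrite -[norm_p _]fineK ?(norm_p_fin_num (f - g))//; congr EFin.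
  rewrite lte_fin => /(_ p_gt0); apply: filterS => w /(_ I)[] fg0 _.
  apply/eqP; rewrite -subr_eq0 -normr_eq0 -rnormK.
  rewrite [rnorm _]fg0.
  by case: (s).
apply: EFin_inj.
rewrite -(_ : norm_p (f - g) = (Lp_seminorm (f - g))%:E); last first.
  by rewrite -[LHS]fineK ?(norm_p_fin_num (f - g)).
rewrite /norm_p unlock /Lnorm (ae_eq_integral (cst 0)) => [|//||//|].
- by rewrite integral0 poweR0r// invr_neq0// gt_eqF.
- apply: (measurableT_comp (measurable_poweR _)) => //.
  by apply: measurableT_comp => //; exact: mfgE.
- apply: filterS fg => w /(_ I) fgw _ /=.
  have fg0 : ((f - g : Lp_function) : Omega -> K) w = 0.
    by transitivity (f w - g w); rewrite // fgw subrr.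
  by rewrite [X in rnorm X]fg0 /rnorm normr0 sRe0 normr0 powR0// gt_eqF.
Qed.

End Lp_space.

Section image_charge.
Context (R : realType) d (Omega : measurableType d).
Context (mu : {finite_measure set Omega -> \bar R}) (T : {mfun Omega >-> Omega}).

Definition image_charge := pushforward (charge_of_finite_measure mu) T.

Fact mfun_preimage_measurable A : measurable A -> measurable (T @^-1` A).
Proof. by move=> mA; rewrite -[X in measurable X]setTI; exact: measurable_funP. Qed.

Fact image_charge0 : image_charge set0 = 0%E.
Proof. by rewrite /image_charge /pushforward preimage_set0 charge0. Qed.

Fact image_charge_finite A : measurable A -> image_charge A \is a fin_num.
Proof. by move=> mA; rewrite fin_num_measure//; exact: mfun_preimage_measurable. Qed.

Fact image_charge_sigma_additive : semi_sigma_additive image_charge.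
Proof.
move=> F mF tF mUF; rewrite /image_charge /pushforward preimage_bigcup.
apply: charge_semi_sigma_additive.
- by move=> n; exact: mfun_preimage_measurable.
- by apply/trivIsetP => i j _ _ ij; rewrite -preimage_setI;
    move/trivIsetP : tF => /(_ _ _ I I ij) ->; rewrite preimage_set0.
- by rewrite -preimage_bigcup; exact: mfun_preimage_measurable.
Qed.

HB.instance Definition _ := isCharge.Build _ _ _ image_charge
  image_charge0 image_charge_finite image_charge_sigma_additive.

End image_charge.

Section Lp_actions.
Context (R : realType) (s : scalar_kind) (G : topologicalGroupType).
Context d (Omega : measurableType d).
Context (mu : {finite_measure set Omega -> \bar R}) (p : R).
Local Notation K := (scalars R s).

(* [T] and [chi] are the point maps and the unimodular functions provided by the
   Banach-Lamperti theorem, both being only determined up to null sets; the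
   action is [pi]. *)
Record is_BL_action (p1 : 1 <= p)
    (pi : linear_isometric_action G (Lp s mu p1))
    (T : G -> {mfun Omega >-> Omega}) (chi : G -> Omega -> K) : Prop :=
  IsBLAction {
    BL_action1 : (T 1%g : Omega -> Omega) = id %[ae mu];
    BL_actionM : forall g h,
      (T (g * h)%g : Omega -> Omega) = (T g \o T h) %[ae mu];
    BL_nonsingular : forall g A, measurable A ->
      (mu (T g @^-1` A) = 0%E <-> mu A = 0%E);
    BL_measurable : forall g, scalar_measurable (chi g);
    BL_unimodular : forall g, \forall w \ae mu, `|chi g w| = 1;
    BL_formula : forall g (h : Lp s mu p1),
      Lp_repr (pi g h) =
        (fun w => chi g w * Lp_repr h (T g^-1%g w) *
           of_real s
             (fine (Radon_Nikodym (image_charge mu (T g)) mu w) `^ p^-1))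
      %[ae mu]
  }.

Definition measure_preserving (T : G -> {mfun Omega >-> Omega}) : Prop :=
  forall g A, measurable A -> mu (T g @^-1` A) = mu A.

(* gamma A is rendered as the preimage of A by the map of gamma^-1, which
   is the same set up to a null set. *)
Definition ergodic (T : G -> {mfun Omega >-> Omega}) : Prop :=
  forall A, measurable A ->
    (forall g, mu ((T g^-1%g @^-1` A) `+` A) = 0%E) ->
    mu A = 0%E \/ mu (~` A) = 0%E.

Definition cocycle (X : normedModType K) (pi : linear_isometric_action G X)
    (b : G -> X) : Prop :=
  continuous b /\ forall g h, b (g * h)%g = b g + pi g (b h).

Definition twisted_translate (T : G -> {mfun Omega >-> Omega})
    (chi : G -> Omega -> K) (g : G) (f : Omega -> K) : Omega -> K :=
  fun w => chi g w * f (T g^-1%g w).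

Definition weak_norm (f : Omega -> K) : \bar R :=
  ereal_sup [set (x%:E * mu [set w | x < rnorm (f w)]%R `^ p^-1)%E
            | x in [set x : R | 0 < x]].

Definition weak_Lp (f : Omega -> K) : Prop :=
  scalar_measurable f /\ (weak_norm f < +oo)%E.

End Lp_actions.

(* Main.v *)
Require Import Defs.
From HB Require Import structures.
From mathcomp Require Import all_boot all_order all_algebra.
From mathcomp Require Import complex.
From mathcomp Require Import all_classical all_reals all_analysis.
From mathcomp Require Import measurable_realfun ring lra.

Set Implicit Arguments.
Unset Strict Implicit.
Unset Printing Implicit Defensive.

Import Order.TTheory GRing.Theory Num.Theory.
Import numFieldNormedType.Exports.

Local Open Scope classical_set_scope.
Local Open Scope ring_scope.
Local Open Scope quotient_scope.

(** The cocycle [b] is shown to be the coboundary of a function [f] which is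
    even in [L_p], hence in weak [L_p].  There are three ingredients.

    1. Property (T) gives an a priori L1 bound
       ([cocycle_uniform_bound]).  For a cocycle [b] over a measure preserving
       action twisted by a unimodular multiplier, the kernels
       [(g, h) |-> \int exp(- t |b_g - b_h|^2)] are positive semidefinite and
       left invariant, so they come from a unitary representation of [G].  The
       squared displacement of the cyclic vector by [g] is
       [2 \int (1 - exp(- t |b_g|^2))].  Adding the vectors for
       [t = 4^-n], [n < N], with squared weights [2^n], one gets a vector with
       squared displacement [2 \int \sum_(n < N) 2^n (1 - exp(- (|b_g| / 2^n)^2))],
       which is at most [8 \int |b_g|] and, up to an additive constant, at least
       [\int min(|b_g|, 2^N)].  By property (T) a displacement by all of [G] is controlled by the
       displacement by some compact set [C]; the set [C] and the constant are
       those of one big representation, hence may be chosen uniformly over any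
       family of cocycles.  The Hilbert space needed here is built by hand, as
       the completion of a space of formal combinations.

    2. A cocycle bounded in L1 is a coboundary ([coboundary_of_bounded]).  The
       map [z |-> sqrt (1 + |z|^2)] is strictly convex and grows linearly, so
       [phi |-> sup_g \int sqrt (1 + |phi - b_g|^2)] has a unique minimizer [f]
       up to null sets, the center of the orbit of [0] under the affine action
       [phi |-> pi_g phi + b_g].  Being unique, it is fixed by the affine action.
       Its L1 norm is bounded by the bound on the cocycle.  This replaces the
       center of a bounded set in a uniformly convex space, and is what
       makes [p = 1] work.

    3. The primitive [f] is in [L_p] ([truncated_power_mean_bounded]).  Let
       [h_N = min(|f|, N)^p].  The first two steps apply to the
       cocycles [g |-> h_N \o g^-1 - h_N], all at once.  The integral of
       [|h_N \o g^-1 - h_N|] is at most [2 delta \int h_N + C_delta \int |b_g|^p],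
       so for small [delta] the function [h_N] is at distance at most
       [\int h_N / 6 + C] in L1 from an invariant function, which is a constant
       by ergodicity.  As [f] is integrable, this
       constant is controlled on a set of measure at least half of the total
       one, and [\int h_N] is bounded independently of [N]. *)

(** * Scalars and semi-inner products *)

Section scalar_coordinates.
Context (R : realType) (s : scalar_kind).
Local Notation K := (scalars R s).
Implicit Types (a b : K) (x y : R).

Definition mkscalar x y : K :=
  match s return scalars R s with
  | RealScalars => x
  | ComplexScalars => (x +i* y)%C
  end.

Lemma sRe_mk x y : sRe (mkscalar x y) = x.
Proof. by rewrite /mkscalar; case: (s). Qed.

Lemma sIm_mk x y : (s = RealScalars -> y = 0) -> sIm (mkscalar x y) = y.
Proof. by rewrite /mkscalar; case: (s) => //= ->. Qed.

Lemma scalar_eq a b : sRe a = sRe b -> sIm a = sIm b -> a = b.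
Proof.
by rewrite /sRe /sIm; case: (s) a b => //= -[? ?] [? ?] /= -> ->.
Qed.

Lemma sRe_conj a : sRe (sconj a) = sRe a.
Proof. by case: (s) a => //= -[]. Qed.

Lemma sIm_conj a : sIm (sconj a) = - sIm a.
Proof. by case: (s) a => /= [a|[a b]] //=; rewrite oppr0. Qed.

Lemma sIm_of_real x : sIm (of_real s x) = 0.
Proof. by case: (s). Qed.

Lemma sReN a : sRe (- a) = - sRe a.
Proof. by case: (s) a => //= -[]. Qed.

Lemma sImN a : sIm (- a) = - sIm a.
Proof. by case: (s) a => /= [a|[a b]] //=; rewrite oppr0. Qed.

Lemma sReB a b : sRe (a - b) = sRe a - sRe b.
Proof. by rewrite sReD sReN. Qed.

Lemma sImB a b : sIm (a - b) = sIm a - sIm b.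
Proof. by rewrite sImD sImN. Qed.

Lemma sRe1 : sRe (1 : K) = 1. Proof. by case: (s). Qed.
Lemma sIm1 : sIm (1 : K) = 0. Proof. by case: (s). Qed.

Lemma rnorm_sqr a : rnorm a ^+ 2 = sRe a ^+ 2 + sIm a ^+ 2.
Proof. by rewrite rnormE sqr_sqrtr// addr_ge0// sqr_ge0. Qed.

Lemma rnorm0 (U : normedZmodType K) : rnorm (0 : U) = 0.
Proof. by rewrite /rnorm normr0 sRe0. Qed.

Lemma rnormN (U : normedZmodType K) (u : U) : rnorm (- u) = rnorm u.
Proof. by rewrite /rnorm normrN. Qed.

Lemma rnorm_eq0 (U : normedZmodType K) (u : U) : rnorm u = 0 -> u = 0.
Proof.
move=> h; apply/normr0_eq0; rewrite -rnormK h.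
by case: (s).
Qed.

Lemma rnorm_distC (U : normedZmodType K) (u v : U) : rnorm (u - v) = rnorm (v - u).
Proof. by rewrite -opprB rnormN. Qed.

Lemma rnorm_real x : rnorm (of_real s x) = `|x|.
Proof. by rewrite rnormE of_realK sIm_of_real expr0n addr0 sqrtr_sqr. Qed.

Lemma sRe_real x a : sRe (of_real s x * a) = x * sRe a.
Proof. by rewrite sReM of_realK sIm_of_real mul0r subr0. Qed.

Lemma sIm_real x a : sIm (of_real s x * a) = x * sIm a.
Proof. by rewrite sImM of_realK sIm_of_real mul0r addr0. Qed.

Lemma ler_norm_sRe a : `|sRe a| <= rnorm a.
Proof.
by rewrite rnormE -sqrtr_sqr ler_wsqrtr// lerDl sqr_ge0.
Qed.

Lemma ler_norm_sIm a : `|sIm a| <= rnorm a.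
Proof.
by rewrite rnormE -sqrtr_sqr ler_wsqrtr// lerDr sqr_ge0.
Qed.

End scalar_coordinates.

Lemma discriminant_le (R : realFieldType) (a b c : R) : 0 <= c ->
  (forall x, 0 <= a + 2 * x * b + x ^+ 2 * c) -> b ^+ 2 <= a * c.
Proof.
rewrite le_eqVlt => /predU1P[<-|cgt0] h; last first.
  have := h (- b / c); rewrite -(ler_pM2r cgt0) mul0r.
  rewrite (_ : (_ + _) * c = a * c - b ^+ 2) ?subr_ge0//; field.
  by rewrite gt_eqF.
rewrite mulr0 leNgt; apply/negP => b2.
have b0 : b != 0 by rewrite -sqrf_eq0 gt_eqF.
have := h (- (a + 1) / (2 * b)); rewrite mulr0 addr0.
rewrite (_ : a + _ = -1); first by rewrite oppr_ge0 ler10.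
by field.
Qed.

Record semi_inner_product (R : realType) (s : scalar_kind)
    (V : lmodType (scalars R s)) := SemiInnerProduct {
  sip :> V -> V -> scalars R s;
  sip_linear : forall a u v w, sip (a *: u + v) w = a * sip u w + sip v w;
  sip_conj : forall u v, sip u v = sconj (sip v u);
  sip_ge0 : forall u, 0 <= sRe (sip u u)
}.

Section semi_inner_product_theory.
Context (R : realType) (s : scalar_kind) (V : lmodType (scalars R s)).
Variable D : semi_inner_product V.
Local Notation K := (scalars R s).

Lemma sipDl u v w : D (u + v) w = D u w + D v w.
Proof. by have := sip_linear D 1 u v w; rewrite scale1r mul1r. Qed.

Lemma sip0l w : D 0 w = 0.
Proof. by apply: (addrI (D 0 w)); rewrite -sipDl !addr0. Qed.

Lemma sipZl a u w : D (a *: u) w = a * D u w.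
Proof. by have := sip_linear D a u 0 w; rewrite addr0 sip0l addr0. Qed.

Lemma sip_sRe_sym u v : sRe (D u v) = sRe (D v u).
Proof. by rewrite sip_conj sRe_conj. Qed.

Lemma sip_sReDr u v w : sRe (D u (v + w)) = sRe (D u v) + sRe (D u w).
Proof. by rewrite sip_sRe_sym sipDl sReD !(sip_sRe_sym u). Qed.

Lemma sip_sImDr u v w : sIm (D u (v + w)) = sIm (D u v) + sIm (D u w).
Proof.
by rewrite !(sip_conj D u) sipDl !sIm_conj sImD opprD.
Qed.

Lemma sip_sIm_diag u : sIm (D u u) = 0.
Proof.
have := congr1 (@sIm R s) (sip_conj D u u); rewrite sIm_conj => h.
by lra.
Qed.

Lemma sip_sReZ a u : sRe (D (a *: u) (a *: u)) = rnorm a ^+ 2 * sRe (D u u).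
Proof.
rewrite sipZl sReM sip_sRe_sym [in X in _ - X]sip_conj sIm_conj !sipZl.
rewrite sReM sImM sip_sIm_diag rnorm_sqr; ring.
Qed.

Lemma sip_sReD u v : sRe (D (u + v) (u + v)) =
  sRe (D u u) + 2 * sRe (D u v) + sRe (D v v).
Proof.
rewrite sip_sReDr (sip_sRe_sym _ u) (sip_sRe_sym _ v) !sip_sReDr.
by rewrite (sip_sRe_sym v u); ring.
Qed.

Definition pnorm u := Num.sqrt (sRe (D u u)).

Lemma pnorm_ge0 u : 0 <= pnorm u. Proof. exact: sqrtr_ge0. Qed.

Lemma pnorm_sqr u : pnorm u ^+ 2 = sRe (D u u).
Proof. by rewrite sqr_sqrtr// sip_ge0. Qed.

Lemma pnormZ a u : pnorm (a *: u) = rnorm a * pnorm u.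
Proof.
by rewrite /pnorm sip_sReZ sqrtrM ?sqr_ge0// sqrtr_sqr ger0_norm ?rnorm_ge0.
Qed.

Lemma sip_CauchySchwarz_sRe u v : `|sRe (D u v)| <= pnorm u * pnorm v.
Proof.
have key x : 0 <= sRe (D u u) + 2 * x * sRe (D u v) + x ^+ 2 * sRe (D v v).
  have := sip_ge0 D (u + of_real s x *: v).
  rewrite sip_sReD sip_sReZ rnorm_real real_normK ?num_real//.
  by rewrite (sip_sRe_sym u) sipZl sRe_real (sip_sRe_sym v u) mulrA.
rewrite -sqrtr_sqr /pnorm -sqrtrM ?sip_ge0// ler_wsqrtr//.
by apply: discriminant_le key; exact: sip_ge0.
Qed.

Lemma pnormD u v : pnorm (u + v) <= pnorm u + pnorm v.
Proof.
rewrite -(@ler_pXn2r _ 2)// ?nnegrE ?addr_ge0 ?pnorm_ge0//.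
rewrite pnorm_sqr sip_sReD sqrrD !pnorm_sqr lerD2r lerD2l mulr_natl lerMn2r /=.
exact: le_trans (ler_norm _) (sip_CauchySchwarz_sRe u v).
Qed.

(** The imaginary part is the real part after a rotation by [-i], up to sign. *)
Lemma sip_CauchySchwarz_sIm u v : `|sIm (D u v)| <= pnorm u * pnorm v.
Proof.
pose i := mkscalar s (0 : R) (if s is RealScalars then 0 else 1).
have sImE (a : K) : `|sIm a| = `|sRe (i * a)|.
  rewrite /i; case: (s) a => [a|[a b]] /=; first by rewrite mul0r normr0.
  by rewrite mul0r mul1r sub0r normrN.
rewrite sImE -sipZl; apply: le_trans (sip_CauchySchwarz_sRe _ _) _.
rewrite pnormZ -mulrA ler_piMl ?mulr_ge0 ?pnorm_ge0//.
rewrite rnormE sRe_mk sIm_mk; last by move=> ->.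
by rewrite expr0n add0r sqrtr_sqr; case: (s); rewrite ?normr0 ?normr1.
Qed.

Definition pnorm_seminorm : seminorm V := Seminorm pnormD pnormZ.

End semi_inner_product_theory.

(** * Completion of a semi-inner product space *)

Lemma real_cauchy_cvg (R : realType) (x : nat -> R) :
  (forall e, 0 < e -> exists n, forall i j, (n <= i)%N -> (n <= j)%N ->
     `|x i - x j| < e) -> cvgn x.
Proof.
move=> h; apply/cauchy_cvgP/cauchy_exP => e e0.
have [n hn] := h e e0; exists (x n), n => // i /= ni.
by rewrite /ball /= hn.
Qed.

Lemma exists_natSinv_lt (R : realType) (e : R) : 0 < e ->
  exists n : nat, n.+1%:R^-1 < e.
Proof.
by move=> e0; have [n _ hn] := near_infty_natSinv_lt (PosNum e0); exists n; exact: (hn n (leqnn n)).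
Qed.

Section completion.
Context (R : realType) (s : scalar_kind) (V : lmodType (scalars R s)).
Variable D : semi_inner_product V.
Local Notation K := (scalars R s).
Local Notation N := (pnorm_seminorm D).

Definition cauchy_seq (x : nat -> V) := forall e : R, 0 < e ->
  exists n, forall i j, (n <= i)%N -> (n <= j)%N -> N (x i - x j) < e.

(** The completion is the space of Cauchy sequences of [V], seminormed by the
    limit of the seminorms of the terms, modulo the sequences of seminorm 0. *)
Definition cauchy_pred : {pred nat -> V} := [pred x | `[< cauchy_seq x >]].

Lemma cauchy_predP x : reflect (cauchy_seq x) (x \in cauchy_pred).
Proof. exact: asboolP. Qed.

Fact cauchy_submod_closed : submod_closed cauchy_pred.
Proof.
split=> [|a x y].
  apply/cauchy_predP => e e0; exists 0%N => i j _ _.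
  by rewrite (_ : _ - _ = 0 :> V) ?seminorm0//; exact: (subrr (0 : V)).
move=> /cauchy_predP hx /cauchy_predP hy; apply/cauchy_predP => e e0.
have a1 : 0 < rnorm a + 1 by rewrite ltr_wpDl// rnorm_ge0.
have [n1 h1] := hx (e / 2 / (rnorm a + 1)) ltac:(by rewrite !divr_gt0).
have [n2 h2] := hy (e / 2) ltac:(by rewrite divr_gt0).
exists (maxn n1 n2) => i j; rewrite !geq_max => /andP[i1 i2] /andP[j1 j2].
have -> : (a *: x + y) i - (a *: x + y) j = a *: (x i - x j) + (y i - y j).
  by rewrite scalerBr opprD addrACA.
apply: le_lt_trans (seminormD N _ _) _; rewrite [ltRHS](splitr e).
rewrite ler_ltD ?h2// seminormZ.
have := h1 i j i1 j1; rewrite ltr_pdivlMr// => /ltW; apply: le_trans.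
by rewrite mulrC ler_wpM2l ?seminorm_ge0// lerDl.
Qed.

HB.instance Definition _ :=
  GRing.isSubmodClosed.Build K (nat -> V) cauchy_pred cauchy_submod_closed.

Record cauchy_sequence := CauchySequence {
  cauchy_fun :> nat -> V;
  _ : cauchy_fun \in cauchy_pred
}.

HB.instance Definition _ := [isSub for cauchy_fun].
HB.instance Definition _ := [Choice of cauchy_sequence by <:].
HB.instance Definition _ := [SubChoice_isSubLmodule of cauchy_sequence by <:].

Lemma cauchy_sequenceP (x : cauchy_sequence) : cauchy_seq x.
Proof. by case: x => x /= /cauchy_predP. Qed.

Lemma seminormB_dist (x y : V) : `|N x - N y| <= N (x - y).
Proof.
have le u v : N u - N v <= N (u - v).
  by rewrite lerBlDr -{1}(subrK v u) seminormD.
rewrite ler_norml le andbT lerNl opprB -(seminormN N (x - y)).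
by rewrite (opprB x y) le.
Qed.

Lemma cauchy_norm_cvg (x : cauchy_sequence) : cvgn (fun n => N (x n)).
Proof.
apply: real_cauchy_cvg => e e0; have [n hn] := cauchy_sequenceP x e0.
by exists n => i j ni nj; apply: le_lt_trans (seminormB_dist _ _) (hn _ _ ni nj).
Qed.

Definition limit_norm (x : cauchy_sequence) : R := limn (fun n => N (x n)).

Lemma limit_norm_cvg (x : cauchy_sequence) :
  (fun n => N (x n)) @ \oo --> limit_norm x.
Proof. exact: cauchy_norm_cvg. Qed.

Fact limit_normD (x y : cauchy_sequence) :
  limit_norm (x + y) <= limit_norm x + limit_norm y.
Proof.
have hxy : (fun n => N (x n) + N (y n)) @ \oo --> limit_norm x + limit_norm y.
  by apply: cvgD; exact: limit_norm_cvg.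
rewrite -(cvg_lim _ hxy)//; apply: ler_lim.
- exact: (@cauchy_norm_cvg (x + y)).
- by apply/cvg_ex; exists (limit_norm x + limit_norm y).
by near=> n; exact: (seminormD N).
Unshelve. all: by end_near. Qed.

Fact limit_normZ a (x : cauchy_sequence) :
  limit_norm (a *: x) = rnorm a * limit_norm x.
Proof.
apply: cvg_lim => //.
rewrite (_ : (fun n => _) = (fun n => rnorm a * N (x n))).
  by apply: cvgMr; exact: limit_norm_cvg.
by apply/funext => n; exact: (seminormZ N).
Qed.

Definition limit_seminorm : seminorm cauchy_sequence :=
  Seminorm limit_normD limit_normZ.

Definition completion := seminorm_quotient limit_seminorm.

HB.instance Definition _ := NormedModule.on completion.

Local Notation H := completion.
Definition cauchy_class (x : cauchy_sequence) : H :=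
  \pi_(seminorm_quotient limit_seminorm) x.

Lemma rnorm_class x : rnorm (cauchy_class x) = limit_norm x.
Proof. by rewrite /rnorm [X in sRe X]norm_pi of_realK. Qed.

Lemma classD x y : cauchy_class (x + y) = cauchy_class x + cauchy_class y.
Proof. exact: seminorm_quotient_piD. Qed.

Lemma classZ a x : cauchy_class (a *: x) = a *: cauchy_class x.
Proof. by rewrite [RHS]quotient_scale_pi. Qed.

Lemma classB x y : cauchy_class (x - y) = cauchy_class x - cauchy_class y.
Proof. by rewrite classD -scaleN1r classZ scaleN1r. Qed.

Lemma class_repr (u : H) : exists x, u = cauchy_class x.
Proof. by exists (repr (u : seminorm_quotient limit_seminorm)); rewrite /cauchy_class reprK. Qed.

Lemma class_eq x y : cauchy_class x = cauchy_class y <-> limit_norm (x - y) = 0.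
Proof. exact: eq_seminorm_quotient. Qed.

Fact const_cauchy (v : V) : (fun=> v) \in cauchy_pred.
Proof.
by apply/cauchy_predP => e e0; exists 0%N => i j _ _; rewrite subrr seminorm0.
Qed.

Definition embed (v : V) : H := cauchy_class (CauchySequence (const_cauchy v)).

Lemma embed_linear a u v : embed (a *: u + v) = a *: embed u + embed v.
Proof.
rewrite /embed -classZ -classD; congr cauchy_class; exact/val_inj.
Qed.

Lemma rnorm_embed v : rnorm (embed v) = N v.
Proof. rewrite rnorm_class; apply: cvg_lim; first exact: Rhausdorff. exact: (@cvg_cst _ (N v) nat \oo _). Qed.

Lemma embedB u v : embed (u - v) = embed u - embed v.
Proof.
by rewrite addrC -scaleN1r embed_linear scaleN1r addrC.
Qed.

Lemma rnorm_class_embed (x : cauchy_sequence) (v : V) e :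
  (\forall n \near \oo, N (x n - v) <= e) -> rnorm (cauchy_class x - embed v) <= e.
Proof.
move=> h; rewrite /embed -classB rnorm_class.
exact: (limr_le (@cauchy_norm_cvg (x - CauchySequence (const_cauchy v)))).
Qed.

Lemma embed_dense (u : H) e : 0 < e -> exists v, rnorm (u - embed v) < e.
Proof.
move=> e0; have [x ->] := class_repr u.
have [n hn] := cauchy_sequenceP x (divr_gt0 e0 (ltr0n _ 2)).
exists (x n); apply: (@le_lt_trans _ _ (e / 2)); last by lra.
apply: rnorm_class_embed; exists n => // i /= ni.
by rewrite ltW// hn.
Qed.

Lemma class_cvg (x : cauchy_sequence) e : 0 < e ->
  exists n, forall i, (n <= i)%N -> rnorm (cauchy_class x - embed (x i)) < e.
Proof.
move=> e0; have [n hn] := cauchy_sequenceP x (divr_gt0 e0 (ltr0n _ 2)).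
exists n => i ni; apply: (@le_lt_trans _ _ (e / 2)); last by lra.
by apply: rnorm_class_embed; exists n => // j /= nj; rewrite ltW// hn.
Qed.

Lemma ball_rnorm (U : normedModType K) (x y : U) (e : R) :
  ball x (of_real s e) y <-> rnorm (x - y) < e.
Proof.
rewrite -ball_normE /ball_ /= -rnormK.
rewrite !lt_neqAle ler_of_real; split => /andP[h ->]; rewrite andbT.
  by apply: contra h => /eqP ->.
by apply: contra h => /eqP /(can_inj (@of_realK R s)) ->.
Qed.

Lemma of_real_gt0 (e : R) : (0 < of_real s e) = (0 < e).
Proof.
have -> : (0 : K) = of_real s 0 by case: (s).
rewrite !lt_neqAle ler_of_real (inj_eq (can_inj (@of_realK R s)))//.
Qed.

Lemma gt0_of_real (e : K) : 0 < e -> exists2 r : R, 0 < r & e = of_real s r.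
Proof.
move=> e0; exists (rnorm e); last by rewrite rnormK gtr0_norm.
by rewrite -of_real_gt0 rnormK gtr0_norm.
Qed.

(** A Cauchy filter is approximated by vectors [v n] of the dense subspace [V] up to
    [2 / n.+1]; these form a Cauchy sequence, whose class is the limit. *)
Fact completion_complete (F : set_system H) : ProperFilter F -> cauchy F -> cvg F.
Proof.
move=> FF /cauchyP Fc.
have pick n : exists v, F [set y | rnorm (y - embed v) < 2 / n.+1%:R].
  have [x Fx] := Fc (of_real s n.+1%:R^-1) ltac:(by rewrite of_real_gt0 invr_gt0).
  have [v hv] := embed_dense x (e := n.+1%:R^-1) ltac:(by rewrite invr_gt0).
  exists v; apply: filterS Fx => y /= /ball_rnorm xy.
  rewrite mulr2n mulrDl mul1r -(subrK x y) -addrA.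
  by apply: le_lt_trans (ler_rnormD _ _) _; rewrite rnorm_distC ltrD.
pose v n := sval (cid (pick n)).
have vP n : F [set y | rnorm (y - embed (v n)) < 2 / n.+1%:R].
  by rewrite /v; case: cid.
have vc : v \in cauchy_pred.
  apply/cauchy_predP => e e0.
  have [n hn] : exists n, 2 / n.+1%:R < e / 2.
    have [n hn] := exists_natSinv_lt (divr_gt0 e0 (ltr0n R 4)).
    by exists n; move: hn; move: (n.+1%:R^-1) => x; lra.
  exists n => i j ni nj.
  have [y [/= yi yj]] := filter_ex (filterI (vP i) (vP j)).
  rewrite -[pnorm D _]/(N _) -rnorm_embed.
  rewrite embedB -(subrK y (embed (v i))) -addrA.
  apply: le_lt_trans (ler_rnormD _ _) _; rewrite rnorm_distC (splitr e) ltrD//.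
    apply: lt_trans yi _; apply: le_lt_trans hn; rewrite ler_pM2l//.
    by rewrite lef_pV2 ?posrE// ler_nat.
  apply: lt_trans yj _; apply: le_lt_trans hn; rewrite ler_pM2l//.
  by rewrite lef_pV2 ?posrE// ler_nat.
apply/cvg_ex; exists (cauchy_class (CauchySequence vc)).
apply/cvg_ballP => e /gt0_of_real[r r0 ->].
have [n hn] := class_cvg (CauchySequence vc) (divr_gt0 r0 (ltr0n _ 2)).
have [m hm] : exists m, 2 / m.+1%:R < r / 2.
  have [m hm] := exists_natSinv_lt (divr_gt0 r0 (ltr0n R 4)).
  by exists m; move: hm; move: (m.+1%:R^-1) => x; lra.
pose k := maxn n m; have hk := hn k (leq_maxl n m).
near=> y; apply/ball_rnorm.
rewrite -(subrK (embed (v k)) (cauchy_class _)) -addrA.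
apply: le_lt_trans (ler_rnormD _ _) _; rewrite (splitr r).
apply: ltrD; first exact: hk.
rewrite rnorm_distC; apply: (@lt_trans _ _ (2 / k.+1%:R)).
  by near: y; exact: vP.
apply: le_lt_trans hm; rewrite ler_pM2l// lef_pV2 ?posrE// ler_nat.
by rewrite ltnS leq_maxr.
Unshelve. all: by end_near. Qed.

HB.instance Definition _ := Uniform_isComplete.Build H completion_complete.


End completion.

(** * The inner product of the completion *)

Section completion_inner_product.
Context (R : realType) (s : scalar_kind) (V : lmodType (scalars R s)).
Variable D : semi_inner_product V.
Local Notation K := (scalars R s).
Local Notation H := (completion D).
Implicit Types (x y z : cauchy_sequence D).

Lemma sipDr u v w : D u (v + w) = D u v + D u w.
Proof. by apply: scalar_eq; rewrite ?sReD ?sImD ?sip_sReDr ?sip_sImDr. Qed.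

Lemma sipNl u w : D (- u) w = - D u w.
Proof. by rewrite -scaleN1r sipZl mulN1r. Qed.

Lemma sipNr u w : D u (- w) = - D u w.
Proof. by apply: (addrI (D u w)); rewrite -sipDr !subrr sip_conj sip0l; apply: scalar_eq; rewrite ?sRe_conj ?sIm_conj ?sRe0 ?sIm0 ?oppr0. Qed.

(** Real and imaginary parts of the inner product are treated simultaneously:
    only additivity and the Cauchy-Schwarz inequality are used. *)
Section coordinate.
Variable coord : K -> R.
Hypothesis coordD : {morph coord : a b / a + b}.
Hypothesis coord_CS : forall u v, `|coord (D u v)| <= pnorm D u * pnorm D v.

Lemma coord_sip_cvg x y : cvgn (fun n => coord (D (x n) (y n))).
Proof.
have bnd z : exists2 M, 0 < M & forall n, pnorm D (z n) <= M.
  have [M [_ hM]] := cvg_seq_bounded (@cauchy_norm_cvg _ _ _ D z).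
  exists (`|M| + 1); first by rewrite ltr_wpDl.
  move=> n; apply: le_trans (hM (`|M| + 1) _ n I); first exact: ler_norm.
  by rewrite (le_lt_trans (ler_norm M))// ltrDl.
have [M M0 hM] := bnd x; have [L L0 hL] := bnd y.
apply: real_cauchy_cvg => e e0.
have [n hn] := cauchy_sequenceP x (divr_gt0 e0 (mulr_gt0 (ltr0Sn R 1) L0)).
have [m hm] := cauchy_sequenceP y (divr_gt0 e0 (mulr_gt0 (ltr0Sn R 1) M0)).
exists (maxn n m) => i j; rewrite !geq_max => /andP[ni mi] /andP[nj mj].
have -> : coord (D (x i) (y i)) - coord (D (x j) (y j)) =
    coord (D (x i - x j) (y i)) + coord (D (x j) (y i - y j)).
  apply/eqP; rewrite subr_eq -!coordD; apply/eqP; congr coord.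
  by rewrite sipDl sipNl sipDr sipNr; ring.
apply: le_lt_trans (ler_normD _ _) _; rewrite (splitr e).
have hni := hn _ _ ni nj; have hmi := hm _ _ mi mj.
apply: ltrD; apply: le_lt_trans (coord_CS _ _) _.
  apply: le_lt_trans (ler_wpM2l (pnorm_ge0 _ _) (hL i)) _.
  by rewrite -ltr_pdivlMr//; move: hni; rewrite invfM mulrA.
apply: le_lt_trans (ler_wpM2r (pnorm_ge0 _ _) (hM j)) _.
by rewrite mulrC -ltr_pdivlMr//; move: hmi; rewrite invfM mulrA.
Qed.

Lemma coord_sip_lim_le x y :
  `|limn (fun n => coord (D (x n) (y n)))| <= limit_norm x * limit_norm y.
Proof.
have h : (fun n => pnorm D (x n) * pnorm D (y n)) @ \oo --> limit_norm x * limit_norm y.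
  by apply: cvgM; exact: limit_norm_cvg.
have h' : (fun n => `|coord (D (x n) (y n))|) @ \oo -->
    `|limn (fun n => coord (D (x n) (y n)))|.
  by apply: cvg_norm; exact: coord_sip_cvg.
rewrite -(cvg_lim _ h)// -(cvg_lim _ h')//; apply: ler_lim.
- by apply/cvg_ex; eexists; exact: h'.
- by apply/cvg_ex; eexists; exact: h.
by near=> n; exact: coord_CS.
Unshelve. all: by end_near. Qed.

End coordinate.

Definition limit_sip x y : K :=
  mkscalar s (limn (fun n => sRe (D (x n) (y n)))) (limn (fun n => sIm (D (x n) (y n)))).

Lemma sIm_limit_sip x y : sIm (limit_sip x y) = limn (fun n => sIm (D (x n) (y n))).
Proof.
rewrite sIm_mk// => s0.
rewrite (_ : (fun n => _) = cst 0) ?lim_cst//.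
by apply/funext => n; move: (D _ _); rewrite /sIm s0.
Qed.

Lemma cvg_sRe_sip x y : (fun n => sRe (D (x n) (y n))) @ \oo --> sRe (limit_sip x y).
Proof. by rewrite sRe_mk; exact: (coord_sip_cvg (@sReD R s) (sip_CauchySchwarz_sRe D)). Qed.

Lemma cvg_sIm_sip x y : (fun n => sIm (D (x n) (y n))) @ \oo --> sIm (limit_sip x y).
Proof. by rewrite sIm_limit_sip; exact: (coord_sip_cvg (@sImD R s) (sip_CauchySchwarz_sIm D)). Qed.

Lemma limit_sip_linear a x y z :
  limit_sip (a *: x + y) z = a * limit_sip x z + limit_sip y z.
Proof.
apply: scalar_eq; rewrite ?sReD ?sImD ?sReM ?sImM.
  apply: (cvg_unique _ (@cvg_sRe_sip (a *: x + y) z)) => //.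
  rewrite (_ : (fun n => _) = (fun n => sRe a * sRe (D (x n) (z n))
    - sIm a * sIm (D (x n) (z n)) + sRe (D (y n) (z n)))); last first.
    by apply/funext => n; rewrite -sReM -sReD -sip_linear.
  by apply: cvgD; [apply: cvgB; apply: cvgMr|];
    [exact: cvg_sRe_sip|exact: cvg_sIm_sip|exact: cvg_sRe_sip].
apply: (cvg_unique _ (@cvg_sIm_sip (a *: x + y) z)) => //.
rewrite (_ : (fun n => _) = (fun n => sRe a * sIm (D (x n) (z n))
    + sIm a * sRe (D (x n) (z n)) + sIm (D (y n) (z n)))); last first.
  by apply/funext => n; rewrite -sImM -sImD -sip_linear.
by apply: cvgD; [apply: cvgD; apply: cvgMr|];
  [exact: cvg_sIm_sip|exact: cvg_sRe_sip|exact: cvg_sIm_sip].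
Qed.

Lemma limit_sip_conj x y : limit_sip x y = sconj (limit_sip y x).
Proof.
apply: scalar_eq; rewrite ?sRe_conj ?sIm_conj.
  apply: (cvg_unique _ (@cvg_sRe_sip x y)) => //.
  rewrite (_ : (fun n => _) = (fun n => sRe (D (y n) (x n)))); first exact: cvg_sRe_sip.
  by apply/funext => n; rewrite sip_sRe_sym.
apply: (cvg_unique _ (@cvg_sIm_sip x y)) => //.
rewrite (_ : (fun n => _) = (fun n => - sIm (D (y n) (x n)))).
  by apply: cvgN; exact: cvg_sIm_sip.
by apply/funext => n; rewrite sip_conj sIm_conj.
Qed.

Lemma limit_sip_diag x : limit_sip x x = of_real s (limit_norm x ^+ 2).
Proof.
apply: scalar_eq; rewrite ?of_realK ?sIm_of_real.
  apply: (cvg_unique _ (@cvg_sRe_sip x x)) => //.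
  rewrite (_ : (fun n => _) = (fun n => pnorm D (x n) ^+ 2)).
    by rewrite expr2; apply: cvgM; exact: limit_norm_cvg.
  by apply/funext => n; rewrite pnorm_sqr.
apply: (cvg_unique _ (@cvg_sIm_sip x x)) => //.
rewrite (_ : (fun n => _) = (fun n => 0)); first by apply: cvg_cst.
by apply/funext => n; rewrite sip_sIm_diag.
Qed.

Lemma limit_sip_eq0 x y : limit_norm x = 0 -> limit_sip x y = 0.
Proof.
move=> x0; apply: scalar_eq; rewrite ?sRe0 ?sIm0.
  apply/normr0_eq0/eqP; rewrite eq_le normr_ge0 andbT sRe_mk.
  have := coord_sip_lim_le (@sReD R s) (sip_CauchySchwarz_sRe D) x y.
  by rewrite x0 mul0r.
apply/normr0_eq0/eqP; rewrite eq_le normr_ge0 andbT sIm_limit_sip.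
have := coord_sip_lim_le (@sImD R s) (sip_CauchySchwarz_sIm D) x y.
by rewrite x0 mul0r.
Qed.

Lemma limit_sip_classl x x' y : cauchy_class x = cauchy_class x' -> limit_sip x y = limit_sip x' y.
Proof.
move=> /class_eq xx'; have -> : x = 1 *: (x - x') + x' by rewrite scale1r subrK.
by rewrite limit_sip_linear mul1r limit_sip_eq0 ?add0r.
Qed.

Definition completion_dot (u v : H) : K :=
  limit_sip (repr (u : seminorm_quotient (limit_seminorm D)))
            (repr (v : seminorm_quotient (limit_seminorm D))).

Lemma completion_dotE x y : completion_dot (cauchy_class x) (cauchy_class y) = limit_sip x y.
Proof.
rewrite /completion_dot (@limit_sip_classl _ x); last by rewrite /cauchy_class reprK.
rewrite limit_sip_conj (@limit_sip_classl _ y) -?limit_sip_conj//.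
by rewrite /cauchy_class reprK.
Qed.

Fact completion_dot_linear a u v w :
  completion_dot (a *: u + v) w = a * completion_dot u w + completion_dot v w.
Proof.
have [x ->] := class_repr u; have [y ->] := class_repr v; have [z ->] := class_repr w.
by rewrite -classZ -classD !completion_dotE limit_sip_linear.
Qed.

Fact completion_dot_conj u v : completion_dot u v = sconj (completion_dot v u).
Proof. exact: limit_sip_conj. Qed.

Fact completion_dot_diag u : completion_dot u u = `|u| ^+ 2.
Proof.
have [x ->] := class_repr u.
by rewrite completion_dotE limit_sip_diag -rnorm_class expr2 of_realM rnormK -expr2.
Qed.

Fact sconjM : {morph @sconj R s : a b / a * b}.
Proof.
move=> a b; apply: scalar_eq; rewrite ?sRe_conj ?sIm_conj ?sReM ?sImM ?sRe_conj ?sIm_conj; ring.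
Qed.

Fact sconjD : {morph @sconj R s : a b / a + b}.
Proof.
by move=> a b; apply: scalar_eq; rewrite ?sRe_conj ?sIm_conj ?sReD ?sImD ?sRe_conj ?sIm_conj ?opprD.
Qed.

Fact completion_dotDl u v w :
  completion_dot (u + v) w = completion_dot u w + completion_dot v w.
Proof. by have := completion_dot_linear 1 u v w; rewrite scale1r mul1r. Qed.

Fact completion_dot0l w : completion_dot 0 w = 0.
Proof. by apply: (addrI (completion_dot 0 w)); rewrite -completion_dotDl !addr0. Qed.

Fact completion_dotZl a u w : completion_dot (a *: u) w = a * completion_dot u w.
Proof. by have := completion_dot_linear a u 0 w; rewrite addr0 completion_dot0l addr0. Qed.

Fact completion_dotBl u v w :
  completion_dot (u - v) w = completion_dot u w - completion_dot v w.
Proof. by rewrite completion_dotDl -scaleN1r completion_dotZl mulN1r. Qed.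

Fact completion_dotBr w u v :
  completion_dot w (u - v) = completion_dot w u - completion_dot w v.
Proof.
rewrite !(completion_dot_conj w) completion_dotBl sconjD; congr (_ + _).
by apply: scalar_eq; rewrite ?(sRe_conj, sReN, sIm_conj, sImN).
Qed.

Fact completion_dotZr a u w : completion_dot w (a *: u) = sconj a * completion_dot w u.
Proof. by rewrite !(completion_dot_conj w) completion_dotZl sconjM. Qed.

HB.instance Definition _ := @isBilinear.Build K H H K *%R (@sconj R s \; *%R)
  completion_dot (fun w u v => completion_dotBl u v w) completion_dotBr
  (fun w a u => completion_dotZl a u w) (fun w a u => completion_dotZr a u w).

Fact completion_dot_herm u v :
  completion_dot u v = (-1) ^+ false * sconj (completion_dot v u).
Proof. by rewrite expr0 mul1r -completion_dot_conj. Qed.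

HB.instance Definition _ :=
  @isHermitianSesquilinear.Build K H false (@sconj R s) completion_dot completion_dot_herm.

Fact completion_dot_gt0 u : u != 0 -> 0 < completion_dot u u.
Proof. by move=> u0; rewrite completion_dot_diag exprn_gt0// normr_gt0. Qed.

HB.instance Definition _ := @isDotProduct.Build K H completion_dot completion_dot_gt0.

Definition completion_inner_product : {dot H for @sconj R s} := completion_dot.

End completion_inner_product.

(** * Property (T) as a displacement estimate *)

(** Only preservation of the seminorm and continuity in seminorm are asked: these
    data extend to the completion by density. *)
Record isometric_representation (R : realType) (s : scalar_kind)
    (G : topologicalGroupType) (V : lmodType (scalars R s))
    (D : semi_inner_product V) := IsometricRepresentation {
  rep :> G -> V -> V;
  rep_linear : forall g a u v, rep g (a *: u + v) = a *: rep g u + rep g v;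
  rep1 : forall v, rep 1%g v = v;
  repM : forall g h v, rep (g * h)%g v = rep g (rep h v);
  rep_pnorm : forall g v, pnorm D (rep g v) = pnorm D v;
  rep_continuous : forall v g e, 0 < e ->
    \forall h \near g, pnorm D (rep h v - rep g v) < e
}.

Section completed_action.
Context (R : realType) (s : scalar_kind) (G : topologicalGroupType).
Context (V : lmodType (scalars R s)) (D : semi_inner_product V).
Variable T : isometric_representation G D.
Local Notation K := (scalars R s).
Local Notation H := (completion D).

Lemma repB g u v : T g (u - v) = T g u - T g v.
Proof. by rewrite addrC -scaleN1r rep_linear scaleN1r addrC. Qed.

Fact rep_cauchy g (x : cauchy_sequence D) : (fun n => T g (x n)) \in cauchy_pred D.
Proof.
apply/cauchy_predP => e /(cauchy_sequenceP x)[n hn]; exists n => i j ni nj.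
by rewrite -repB /= rep_pnorm; exact: hn.
Qed.

Definition cauchy_rep g x := CauchySequence (rep_cauchy g x).

Lemma cauchy_rep_linear g a x y :
  cauchy_rep g (a *: x + y) = a *: cauchy_rep g x + cauchy_rep g y.
Proof. by apply/val_inj/funext => n; exact: rep_linear. Qed.

Lemma limit_norm_cauchy_rep g x : limit_norm (cauchy_rep g x) = limit_norm x.
Proof.
rewrite /limit_norm (_ : (fun n => pnorm_seminorm D (cauchy_rep g x n)) =
  (fun n => pnorm_seminorm D (x n)))//.
by apply/funext => n; exact: rep_pnorm.
Qed.

Definition completed_action g (u : H) : H :=
  cauchy_class (cauchy_rep g (repr (u : seminorm_quotient (limit_seminorm D)))).

Lemma completed_action_class g x :
  completed_action g (cauchy_class x) = cauchy_class (cauchy_rep g x).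
Proof.
have /class_eq h : cauchy_class (repr (cauchy_class x : seminorm_quotient (limit_seminorm D))) = cauchy_class x.
  by rewrite /cauchy_class reprK.
apply/class_eq; rewrite -[X in _ - X]scale1r addrC -scaleN1r scalerA mulr1.
by rewrite -cauchy_rep_linear scaleN1r addrC limit_norm_cauchy_rep.
Qed.

Lemma completed_action_embed g v : completed_action g (embed D v) = embed D (T g v).
Proof. by rewrite completed_action_class; congr cauchy_class; exact/val_inj. Qed.

Fact completed_action_linear g a u v :
  completed_action g (a *: u + v) = a *: completed_action g u + completed_action g v.
Proof.
have [x ->] := class_repr u; have [y ->] := class_repr v.
by rewrite -classZ -classD !completed_action_class cauchy_rep_linear classD classZ.
Qed.

HB.instance Definition _ g := @GRing.isLinear.Build K H H *:%R (completed_action g)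
  (completed_action_linear g).

Definition completed_linear g : {linear H -> H} := completed_action g.

Fact completed_linear1 u : completed_linear 1%g u = u.
Proof.
have [x ->] := class_repr u; rewrite /= completed_action_class; congr cauchy_class.
by apply/val_inj/funext => n; exact: rep1.
Qed.

Fact completed_linearM g h u :
  completed_linear (g * h)%g u = completed_linear g (completed_linear h u).
Proof.
have [x ->] := class_repr u; rewrite /= !completed_action_class; congr cauchy_class.
by apply/val_inj/funext => n; exact: repM.
Qed.

Lemma rnorm_completed g u : rnorm (completed_linear g u) = rnorm u.
Proof.
have [x ->] := class_repr u.
by rewrite /= completed_action_class !rnorm_class limit_norm_cauchy_rep.
Qed.

Fact completed_isometry g u : `|completed_linear g u| = `|u|.
Proof. by rewrite -!rnormK rnorm_completed. Qed.

Fact completed_continuous u : continuous (fun g => completed_linear g u).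
Proof.
move=> g; apply/cvg_ballP => e /gt0_of_real[r r0 ->].
have [v uv] := embed_dense u (divr_gt0 r0 (ltr0Sn R 2)).
have := rep_continuous T v g (divr_gt0 r0 (ltr0Sn R 2)).
apply: filterS => h hv; apply/ball_rnorm.
have -> : completed_linear g u - completed_linear h u =
    completed_linear g (u - embed D v) - embed D (T h v - T g v)
    - completed_linear h (u - embed D v).
  have E k : completed_linear k (u - embed D v) =
      completed_linear k u - embed D (T k v).
    by rewrite raddfB /= completed_action_embed.
  rewrite !E embedB; move: (completed_linear _ _) (completed_linear _ _) => a b.
  by move: (embed D _) (embed D _) => a' b'; rewrite !opprB !addrA !subrK.
apply: le_lt_trans (ler_rnormD _ _) _.
rewrite (_ : r = r / 3 + r / 3 + r / 3); last by lra.
rewrite ltrD//; last by rewrite rnormN rnorm_completed.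
apply: le_lt_trans (ler_rnormD _ _) _.
by rewrite ltrD// ?rnormN ?rnorm_completed// rnorm_embed.
Qed.

Definition completed_isometric_action : linear_isometric_action G H :=
  LinearIsometricAction completed_linear1 completed_linearM completed_isometry
    completed_continuous.

End completed_action.

Section almost_invariant.
Context (R : realType) (s : scalar_kind) (G : topologicalGroupType).
Context (X : normedModType (scalars R s)) (rho : linear_isometric_action G X).
Local Notation Q := (seminorm_quotient (invariant_seminorm rho)).

Lemma rnorm_action g x : rnorm (rho g x) = rnorm x.
Proof. by rewrite /rnorm action_isometry. Qed.

Lemma dist_invariant_action g x :
  dist_invariant_vectors rho (rho g x) <= dist_invariant_vectors rho x.
Proof.
apply: lb_le_inf; first exact: (dist_invariant_vectors_has_inf rho x).1.
move=> _ [v hv <-]; rewrite -(rnorm_action g) raddfB /= hv.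
exact: dist_invariant_vectors_le.
Qed.

Lemma quotient_action_pi g x : quotient_action rho g (\pi_Q x) = \pi_Q (rho g x).
Proof.
have h : \pi_Q (repr (\pi_Q x)) = \pi_Q x by rewrite reprK.
apply/eq_seminorm_quotient; apply/eqP; rewrite eq_le seminorm_ge0 andbT -raddfB.
move/eq_seminorm_quotient : h => <-; exact: dist_invariant_action.
Qed.

Lemma exists_near_invariant x e : dist_invariant_vectors rho x < e ->
  exists2 v, invariant_vectors rho v & rnorm (x - v) < e.
Proof.
move=> xe; have [_ [v hv <-] vlt] := inf_lt (dist_invariant_vectors_has_inf rho x).1 xe.
by exists v.
Qed.

(** Subtracting an invariant vector [v] does not change the displacement of [x],
    which is at most [2 |x - v|]. *)
Lemma displacement_le_dist x g :
  rnorm (rho g x - x) <= 2 * dist_invariant_vectors rho x.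
Proof.
apply/ler_addgt0Pr => e e0.
have [|v hv xv] := @exists_near_invariant x (dist_invariant_vectors rho x + e / 2).
  by rewrite ltrDl divr_gt0.
have -> : rho g x - x = rho g (x - v) - (x - v).
  by rewrite raddfB /= hv opprB addrA subrK.
apply: le_trans (ler_rnormD _ _) _; rewrite rnormN rnorm_action.
by move: xv; lra.
Qed.

(** Without almost invariant vectors in the quotient, there are a compact set and
    [e > 0] such that the orbit of every unit vector of the quotient under this set
    has diameter at least [e].  After scaling, this bounds the distance of [x] to
    the invariant vectors by its displacement under the compact set.  The constant
    is [4 / e]: a factor 2 for the diameter, another from
    [displacement_le_dist]. *)
Lemma spectral_gap : ~ almost_has_invariant_vectors (quotient_action rho) ->
  exists2 C : set G, compact C & exists2 c : R, 0 <= c & forall x M, 0 <= M ->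
    (forall g, C g -> rnorm (rho g x - x) <= M) ->
    forall g, rnorm (rho g x - x) <= c * M.
Proof.
move=> /existsNP[C /not_implyP[cC /eqP gap]]; exists C => //.
set m := ereal_inf _ in gap.
have [e e0 em] : exists2 e : R, 0 < e & (e%:E <= m)%E.
  have : (0 <= m)%E.
    by apply: le_ereal_inf_tmp => _ [x _ <-]; apply: ereal_sup_ubound; left.
  move: m gap => [r| |//] r0; rewrite ?lee_fin => r1.
    by exists r => //; rewrite lt_neqAle eq_sym r1 andbT; apply: contra r0 => /eqP ->.
  by exists 1 => //; rewrite leey.
exists (4 / e); first by rewrite divr_ge0 ?ltW.
move=> x M M0 hM g; apply: le_trans (displacement_le_dist _ _) _.
suff : dist_invariant_vectors rho x <= 2 * M / e by lra.
set dx := dist_invariant_vectors rho x.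
have : 0 <= dx by exact: (seminorm_ge0 (invariant_seminorm rho) x).
rewrite le_eqVlt => /predU1P[<-|dx0]; first by rewrite divr_ge0 ?mulr_ge0 ?(ltW e0).
pose u : invariant_quotient rho := \pi_Q (of_real s dx^-1 *: x).
have u1 : `|u| = 1.
  rewrite norm_pi seminormZ rnorm_real gtr0_norm ?invr_gt0// mulVf ?gt_eqF//.
  by case: (s).
have : (m <= diameter [set quotient_action rho g u | g in C])%E.
  by apply: ereal_inf_lbound; exists u.
move=> /(le_trans em) /le_trans /(_ (_ : _ <= (2 * M / dx)%:E)%E) h.
have {h} : (e%:E <= (2 * M / dx)%:E)%E.
  apply: h; apply: ge_ereal_sup => _ [->|[_ [a Ca <-] [_ [b Cb <-] <-]]].
    by rewrite lee_fin divr_ge0 ?mulr_ge0 ?(ltW dx0).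
  rewrite !quotient_action_pi lee_fin.
  rewrite !linearZ /=.
  have -> : \pi_Q (of_real s dx^-1 *: rho a x) - \pi_Q (of_real s dx^-1 *: rho b x)
      = \pi_Q (of_real s dx^-1 *: (rho a x - rho b x)).
    apply/eqP; rewrite subr_eq -seminorm_quotient_piD; apply/eqP.
    by rewrite -scalerDr subrK.
  rewrite /rnorm norm_pi of_realK seminormZ rnorm_real gtr0_norm ?invr_gt0//.
  rewrite mulrC ler_pM2r ?invr_gt0//.
  apply: le_trans (dist_invariant_vectors_le _ (invariant_vectors0 rho)) _.
  rewrite subr0 -(subrKA x); apply: le_trans (ler_rnormD _ _) _.
  by rewrite (rnorm_distC x) mulr2n mulrDl mul1r lerD// hM.
by rewrite lee_fin ler_pdivlMr// [_ / e]mulrC ler_pdivlMl.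
Qed.

End almost_invariant.

(** The form in which property (T) is used: the displacement of a vector by the whole
    group is controlled by its displacement by a compact set, with the same
    constant for all vectors. *)
Lemma property_T_displacement (R : realType) (s : scalar_kind) (G : topologicalGroupType)
    (V : lmodType (scalars R s)) (D : semi_inner_product V)
    (T : isometric_representation G D) : property_T R s G ->
  exists2 C : set G, compact C & exists2 c : R, 0 <= c & forall v M, 0 <= M ->
    (forall g, C g -> pnorm D (T g v - v) <= M) ->
    forall g, pnorm D (T g v - v) <= c * M.
Proof.
move=> /(_ (completion D) (completion_inner_product D)).
move=> /(_ (fun u => esym (completion_dot_diag u)) (completed_isometric_action T)).
move=> /spectral_gap[C cC [c c0 h]]; exists C => //; exists c => // v M M0 hM g.
have E k : rnorm (completed_isometric_action T k (embed D v) - embed D v) = pnorm D (T k v - v).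
  by rewrite /= completed_action_embed -embedB rnorm_embed.
by rewrite -E; apply: h => // k Ck; rewrite E; exact: hM.
Qed.

(** * Representations from invariant positive semidefinite kernels *)

Definition positive_semidefinite (R : numDomainType) (S : Type) (k : S -> S -> R) :=
  forall l : seq (R * S), 0 <= \sum_(p <- l) \sum_(q <- l) p.1 * q.1 * k p.2 q.2.

Record group_kernel (R : realType) (G : topologicalGroupType) (S : Type) :=
  GroupKernel {
  kernel :> S -> S -> R;
  kernel_action : G -> S -> S;
  kernel_action1 : forall x, kernel_action 1%g x = x;
  kernel_actionM : forall g h x,
    kernel_action (g * h)%g x = kernel_action g (kernel_action h x);
  kernel_sym : forall x y, kernel x y = kernel y x;
  kernel_psd : positive_semidefinite kernel;
  kernel_invariant : forall g x y,
    kernel (kernel_action g x) (kernel_action g y) = kernel x y;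
  kernel_continuous : forall x g e, 0 < e -> \forall h \near g,
    kernel x x - kernel (kernel_action h x) (kernel_action g x) < e
}.

Section kernel_representation.
Context (R : realType) (s : scalar_kind) (G : topologicalGroupType) (S : Type).
Variable k : group_kernel R G S.
Local Notation K := (scalars R s).
Local Notation ac := (kernel_action k).

(** Formal combinations of points of [S] are encoded as linear functionals
    on functions: the point [x] is the evaluation at [x].  The vector space
    structure, the action of [G] and the sesquilinearity of the kernel form are
    then pointwise identities. *)
Definition combination (l : seq (K * S)) : (S -> K) -> K :=
  fun F => \sum_(p <- l) p.1 * F p.2.

Definition combination_pred : {pred (S -> K) -> K} :=
  [pred L | `[< exists l, L = combination l >]].

Lemma combinationZD a l l' : a *: combination l + combination l' =
  combination ([seq (a * p.1, p.2) | p <- l] ++ l').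
Proof.
apply/funext => F; rewrite /combination big_cat big_map /=.
transitivity (a * \sum_(p <- l) p.1 * F p.2 + \sum_(p <- l') p.1 * F p.2) => //.
by rewrite big_distrr /=; congr (_ + _); apply: eq_bigr => p _; rewrite mulrA.
Qed.

Fact combination_submod_closed : submod_closed combination_pred.
Proof.
split=> [|a L L' /asboolP[l ->] /asboolP[l' ->]]; apply/asboolP.
  by exists [::]; apply/funext => F; rewrite /combination big_nil.
by exists ([seq (a * p.1, p.2) | p <- l] ++ l'); rewrite combinationZD.
Qed.

HB.instance Definition _ := GRing.isSubmodClosed.Build K ((S -> K) -> K)
  combination_pred combination_submod_closed.

Record formal_combination := FormalCombination {
  formal_fun :> (S -> K) -> K;
  _ : formal_fun \in combination_pred
}.

HB.instance Definition _ := [isSub for formal_fun].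
HB.instance Definition _ := [Choice of formal_combination by <:].
HB.instance Definition _ := [SubChoice_isSubLmodule of formal_combination by <:].
Local Notation V := formal_combination.

Fact combination_mem l : combination l \in combination_pred.
Proof. by apply/asboolP; exists l. Qed.

Definition formal l : V := FormalCombination (combination_mem l).

Lemma formalP (L : V) : exists l, L = formal l.
Proof. by case: L => L /[dup] /asboolP[l ->] ?; exists l; exact/val_inj. Qed.


Definition kernel_form (L L' : V) : K :=
  L (fun x => sconj (L' (fun y => of_real s (k y x)))).

Lemma sconj_sum (I : Type) (r : seq I) (F : I -> K) :
  sconj (\sum_(i <- r) F i) = \sum_(i <- r) sconj (F i).
Proof.
apply: (big_morph _ (@sconjD R s)).
by apply: scalar_eq; rewrite ?sRe_conj ?sIm_conj ?sRe0 ?sIm0 ?oppr0.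
Qed.

Lemma sconj_real (x : R) : sconj (of_real s x) = of_real s x.
Proof. by apply: scalar_eq; rewrite ?sRe_conj ?sIm_conj ?sIm_of_real ?oppr0. Qed.

Lemma sconjK : involutive (@sconj R s).
Proof. by move=> a; apply: scalar_eq; rewrite ?sRe_conj ?sIm_conj ?opprK. Qed.

Lemma kernel_formE l l' : kernel_form (formal l) (formal l') =
  \sum_(p <- l) \sum_(q <- l') p.1 * sconj q.1 * of_real s (k q.2 p.2).
Proof.
rewrite /kernel_form /= /combination; apply: eq_bigr => p _.
rewrite sconj_sum big_distrr /=; apply: eq_bigr => q _.
by rewrite sconjM sconj_real mulrA.
Qed.

Fact kernel_form_linear a u v w :
  kernel_form (a *: u + v) w = a * kernel_form u w + kernel_form v w.
Proof. by []. Qed.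

Fact kernel_form_conj u v : kernel_form u v = sconj (kernel_form v u).
Proof.
have [l ->] := formalP u; have [l' ->] := formalP v.
rewrite !kernel_formE sconj_sum exchange_big; apply: eq_bigr => p _ /=.
rewrite sconj_sum; apply: eq_bigr => q _.
by rewrite !sconjM sconj_real sconjK kernel_sym [q.1 * _]mulrC.
Qed.

Lemma sRe_sum (I : Type) (r : seq I) (F : I -> K) :
  sRe (\sum_(i <- r) F i) = \sum_(i <- r) sRe (F i).
Proof. exact: (big_morph _ (@sReD R s) (@sRe0 R s)). Qed.

Fact kernel_form_ge0 u : 0 <= sRe (kernel_form u u).
Proof.
have [l ->] := formalP u; rewrite kernel_formE sRe_sum.
have /= hR := kernel_psd k [seq (sRe p.1, p.2) | p <- l].
have /= hI := kernel_psd k [seq (sIm p.1, p.2) | p <- l].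
have := addr_ge0 hR hI; rewrite !big_map -big_split /=; congr (_ <= _).
apply: eq_bigr => p _; rewrite !big_map sRe_sum -big_split /=.
apply: eq_bigr => q _.
rewrite sReM sReM of_realK sIm_of_real sRe_conj sIm_conj [k q.2 _]kernel_sym; ring.
Qed.

Definition kernel_sip : semi_inner_product V :=
  SemiInnerProduct kernel_form_linear kernel_form_conj kernel_form_ge0.

Fact translate_mem g (L : V) : (fun F => L (fun x => F (ac g x))) \in combination_pred.
Proof.
have [l ->] := formalP L; apply/asboolP; exists [seq (p.1, ac g p.2) | p <- l].
by apply/funext => F; rewrite /combination big_map.
Qed.

Definition translate g (L : V) : V := FormalCombination (translate_mem g L).

Lemma translate_formal g l :
  translate g (formal l) = formal [seq (p.1, ac g p.2) | p <- l].
Proof. by apply/val_inj/funext => F /=; rewrite /combination big_map. Qed.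

Fact translate_linear g a u v : translate g (a *: u + v) = a *: translate g u + translate g v.
Proof. exact/val_inj. Qed.

Fact translate1 v : translate 1%g v = v.
Proof. by apply/val_inj/funext => F /=; congr (v _); apply/funext => x; rewrite kernel_action1. Qed.

Fact translateM g h v : translate (g * h)%g v = translate g (translate h v).
Proof. by apply/val_inj/funext => F /=; congr (v _); apply/funext => x; rewrite kernel_actionM. Qed.

Fact translate_form g u v : kernel_sip (translate g u) (translate g v) = kernel_sip u v.
Proof.
rewrite /= /kernel_form /=; congr (u _); apply/funext => x; congr (sconj (v _)).
by apply/funext => y; rewrite kernel_invariant.
Qed.

Fact translate_pnorm g v : pnorm kernel_sip (translate g v) = pnorm kernel_sip v.
Proof. by rewrite /pnorm translate_form. Qed.

Lemma formal_cons c x l : formal ((c, x) :: l) = c *: formal [:: (1, x)] + formal l.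
Proof.
apply/val_inj; rewrite -[RHS]/(c *: combination _ + combination _).
by rewrite combinationZD /= mulr1.
Qed.

Lemma pnorm_formalB x y : pnorm kernel_sip (formal [:: (1, x)] - formal [:: (1, y)]) ^+ 2 =
  k x x - 2 * k x y + k y y.
Proof.
rewrite pnorm_sqr -scaleN1r addrC -formal_cons [X in sRe X]kernel_formE !big_cons !big_nil /= !addr0.
have c1 : sconj (1 : K) = 1.
  by apply: scalar_eq; rewrite ?sRe_conj ?sIm_conj ?sRe1 ?sIm1 ?oppr0.
have cN1 : sconj (-1 : K) = -1.
  by apply: scalar_eq; rewrite ?sRe_conj ?sIm_conj ?sReN ?sImN ?sRe1 ?sIm1 ?oppr0.
rewrite c1 cN1 mulrNN !mulr1 !mul1r mulN1r !sReD ?sReN !of_realK.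
by rewrite (kernel_sym k y x) mulN1r sReN of_realK; ring.
Qed.

Fact translate_continuous v g e : 0 < e ->
  \forall h \near g, pnorm kernel_sip (translate h v - translate g v) < e.
Proof.
have [l ->] := formalP v; elim: l e => [|[c x] l IH] e e0.
  by near=> h; rewrite !translate_formal /= subrr -[pnorm _ 0]/(pnorm_seminorm kernel_sip 0) seminorm0.
have c1 : 0 < rnorm c + 1 by rewrite ltr_wpDl// rnorm_ge0.
have e1 : 0 < e / 2 / (rnorm c + 1) by rewrite !divr_gt0.
have e2 : 0 < (e / 2 / (rnorm c + 1)) ^+ 2 / 2 by rewrite divr_gt0// exprn_gt0.
have near1 := kernel_continuous k x g e2.
have near2 := IH (e / 2) ltac:(by rewrite divr_gt0).
near=> h.
have -> : translate h (formal ((c, x) :: l)) - translate g (formal ((c, x) :: l)) =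
    c *: (formal [:: (1, ac h x)] - formal [:: (1, ac g x)])
    + (translate h (formal l) - translate g (formal l)).
  rewrite !translate_formal /= formal_cons [in X in _ - X = _]formal_cons.
  by rewrite scalerBr opprD addrACA.
apply: le_lt_trans (seminormD (pnorm_seminorm kernel_sip) _ _) _.
rewrite [ltRHS]splitr; apply: ler_ltD; last by near: h.
rewrite (seminormZ (pnorm_seminorm kernel_sip)) /=.
suff : pnorm kernel_sip (formal [:: (1, ac h x)] - formal [:: (1, ac g x)])
    < e / 2 / (rnorm c + 1).
  rewrite ltr_pdivlMr// => /ltW; apply: le_trans.
  by rewrite mulrC ler_wpM2l ?pnorm_ge0// lerDl.
rewrite -(@ltr_pXn2r _ 2)// ?nnegrE ?pnorm_ge0 ?(ltW e1)// pnorm_formalB.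
rewrite !kernel_invariant.
have : k x x - k (ac h x) (ac g x) < (e / 2 / (rnorm c + 1)) ^+ 2 / 2 by near: h.
by move: (_ ^+ 2) => z; lra.
Unshelve. all: by end_near. Qed.

Definition kernel_rep : isometric_representation G kernel_sip :=
  IsometricRepresentation translate_linear translate1 translateM translate_pnorm
    translate_continuous.

(** The form being invariant, [|g v - v|^2 = 2 (|v|^2 - Re <g v, v>)]. *)
Lemma kernel_rep_displacement g l :
  pnorm kernel_sip (kernel_rep g (formal l) - formal l) ^+ 2 =
  2 * (sRe (kernel_form (formal l) (formal l))
       - sRe (kernel_form (formal [seq (p.1, ac g p.2) | p <- l]) (formal l))).
Proof.
rewrite -translate_formal; set v := formal l.
have -> : kernel_rep g v - v = translate g v + (-1) *: v by rewrite scaleN1r.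
rewrite pnorm_sqr sip_sReD sip_sReZ translate_form.
rewrite (sip_sRe_sym kernel_sip) sipZl mulN1r sReN.
rewrite (sip_sRe_sym kernel_sip v) rnormN.
rewrite (_ : rnorm (1 : K) = 1); last by rewrite /rnorm normr1 sRe1.
by rewrite -[kernel_form v v]/(kernel_sip v v)
  -[kernel_form _ v]/(kernel_sip (translate g v) v); ring.
Qed.

End kernel_representation.

(** * Gaussian kernels and dyadic sums *)

Section gaussian_kernel.
Context (R : realType) (s : scalar_kind).
Local Notation K := (scalars R s).

Definition scalar_product (z w : K) : R := sRe z * sRe w + sIm z * sIm w.

Lemma rnormB_sqr (z w : K) :
  rnorm (z - w) ^+ 2 = rnorm z ^+ 2 - 2 * scalar_product z w + rnorm w ^+ 2.
Proof. by rewrite !rnorm_sqr sReB sImB /scalar_product; ring. Qed.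

(** The binomial formula writes the power of the planar scalar product as a
    nonnegative combination of kernels [F z * F w]. *)
Lemma psd_scalar_product_pow (l : seq (R * K)) n :
  0 <= \sum_(p <- l) \sum_(q <- l) p.1 * q.1 * scalar_product p.2 q.2 ^+ n.
Proof.
rewrite (_ : \sum_(p <- l) _ = \sum_(i < n.+1)
    (\sum_(p <- l) p.1 * sRe p.2 ^+ (n - i) * sIm p.2 ^+ i) ^+ 2 *+ 'C(n, i)); last first.
  transitivity (\sum_(p <- l) \sum_(q <- l) \sum_(i < n.+1)
      (p.1 * sRe p.2 ^+ (n - i) * sIm p.2 ^+ i) *
      (q.1 * sRe q.2 ^+ (n - i) * sIm q.2 ^+ i) *+ 'C(n, i)).
    apply: eq_bigr => p _; apply: eq_bigr => q _.
    rewrite /scalar_product exprDn big_distrr /=; apply: eq_bigr => i _.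
    by rewrite mulrnAr; congr (_ *+ _); rewrite !exprMn; ring.
  under eq_bigr do rewrite exchange_big /=.
  rewrite exchange_big /=; apply: eq_bigr => i _.
  rewrite expr2 big_distrl /= -sumrMnl; apply: eq_bigr => p _.
  by rewrite big_distrr /= -sumrMnl.
by apply: sumr_ge0 => i _; rewrite mulrn_wge0// sqr_ge0.
Qed.

Lemma cvg_sum_seq (I : Type) (r : seq I) (F : I -> nat -> R) (L : I -> R) :
  (forall i, F i @ \oo --> L i) ->
  (fun n => \sum_(i <- r) F i n) @ \oo --> \sum_(i <- r) L i.
Proof.
move=> FL; elim: r => [|i r IH].
  by rewrite big_nil; under eq_fun do rewrite big_nil; apply: cvg_cst.
by rewrite big_cons; under eq_fun do rewrite big_cons; apply: cvgD.
Qed.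

Lemma psd_exp_scalar_product (t : R) (l : seq (R * K)) : 0 <= t ->
  0 <= \sum_(p <- l) \sum_(q <- l) p.1 * q.1 * expR (t * scalar_product p.2 q.2).
Proof.
move=> t0.
pose u p q n := p.1 * q.1 * series (exp_coeff (t * scalar_product p.2 q.2)) n.
have cu : (fun n => \sum_(p <- l) \sum_(q <- l) u p q n) @ \oo -->
    \sum_(p <- l) \sum_(q <- l) p.1 * q.1 * expR (t * scalar_product p.2 q.2).
  apply: cvg_sum_seq => p; apply: cvg_sum_seq => q.
  by apply: cvgMr; exact: is_cvg_series_exp_coeff.
rewrite -(cvg_lim _ cu)//; apply: limr_ge; first by apply/cvg_ex; eexists; exact: cu.
near=> n; rewrite /u /series /=.
rewrite (_ : \sum_(p <- l) _ = \sum_(0 <= i < n) t ^+ i / i`!%:R *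
    \sum_(p <- l) \sum_(q <- l) p.1 * q.1 * scalar_product p.2 q.2 ^+ i).
  by apply: sumr_ge0 => i _; rewrite mulr_ge0 ?psd_scalar_product_pow// divr_ge0 ?exprn_ge0.
under [RHS]eq_bigr do rewrite big_distrr /=.
rewrite [RHS]exchange_big /=; apply: eq_bigr => p _.
under [RHS]eq_bigr do rewrite big_distrr /=.
rewrite [RHS]exchange_big /=; apply: eq_bigr => q _.
rewrite big_distrr /=; apply: eq_bigr => i _.
by rewrite /exp_coeff /= exprMn; ring.
Unshelve. all: by end_near. Qed.

Definition gaussian (t : R) (z w : K) : R := expR (- (t * rnorm (z - w) ^+ 2)).

(** [exp(- t |z - w|^2) = exp(- t |z|^2) exp(- t |w|^2) exp(2 t <z, w>)]: the first two
    factors rescale the coefficients. *)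
Lemma psd_gaussian t : 0 <= t -> positive_semidefinite (gaussian t).
Proof.
move=> t0 l.
have := @psd_exp_scalar_product (2 * t)
  [seq (p.1 * expR (- (t * rnorm p.2 ^+ 2)), p.2) | p <- l] ltac:(by rewrite mulr_ge0).
rewrite big_map; congr (_ <= _); apply: eq_bigr => p _.
rewrite big_map; apply: eq_bigr => q _ /=.
rewrite /gaussian rnormB_sqr.
rewrite [in RHS](_ : - (t * _) = - (t * rnorm p.2 ^+ 2) + - (t * rnorm q.2 ^+ 2)
  + 2 * t * scalar_product p.2 q.2); last by ring.
by rewrite !expRD; ring.
Qed.

End gaussian_kernel.

(** Orthogonal direct sum of the kernels [k j]: the quadratic form splits into the
    contributions of the indices [j] which occur in the combination. *)
Lemma psd_block (R : realFieldType) (J S : eqType) (k : J -> S -> S -> R) :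
  (forall j, positive_semidefinite (k j)) ->
  positive_semidefinite
    (fun x y : J * S => if x.1 == y.1 then k x.1 x.2 y.2 else 0).
Proof.
move=> kpsd l; pose U := undup [seq p.2.1 | p <- l].
rewrite (_ : \sum_(p <- l) _ = \sum_(j <- U) \sum_(p <- l | p.2.1 == j)
   \sum_(q <- l | q.2.1 == j) p.1 * q.1 * k j p.2.2 q.2.2).
  apply: sumr_ge0 => j _.
  have := kpsd j [seq (p.1, p.2.2) | p <- l & p.2.1 == j].
  rewrite big_map big_filter; congr (_ <= _); apply: eq_bigr => p _.
  by rewrite big_map big_filter.
under [RHS]eq_bigr do rewrite big_mkcond /=.
rewrite [RHS]exchange_big /= [LHS]big_seq [RHS]big_seq; apply: eq_bigr => p pl.
have pU : p.2.1 \in U by rewrite mem_undup; apply: (map_f (fun p : R * (J * S) => p.2.1)).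
rewrite [RHS](bigD1_seq _ pU) ?undup_uniq//= eqxx [X in _ + X]big1 ?addr0; last first.
  by move=> j; rewrite eq_sym => /negbTE ->.

rewrite [RHS]big_mkcond /=; apply: eq_bigr => q _.
by rewrite eq_sym; case: eqP => // _; rewrite mulr0.
Qed.

Section dyadic_sums.
Context (R : realType).
Implicit Types (x y : R).

(** A bounded combination of Gaussian defects at all scales [2^n], which behaves like
    [x] for [1 <= x <= 2^N]. *)
Definition dyadic_sum (N : nat) x : R :=
  \sum_(n < N) 2 ^+ n * (1 - expR (- (x / 2 ^+ n) ^+ 2)).

Lemma dyadic_sumS N x : dyadic_sum N.+1 x =
  dyadic_sum N x + 2 ^+ N * (1 - expR (- (x / 2 ^+ N) ^+ 2)).
Proof. by rewrite /dyadic_sum big_ord_recr. Qed.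

Lemma gaussian_defect_ge0 y : 0 <= 1 - expR (- y ^+ 2).
Proof. by rewrite subr_ge0 -expR0 ler_expR oppr_le0 sqr_ge0. Qed.

Lemma gaussian_defect_le1 y : 1 - expR (- y ^+ 2) <= 1.
Proof. by rewrite lerBlDr lerDl expR_ge0. Qed.

Lemma gaussian_defect_le_sqr y : 1 - expR (- y ^+ 2) <= y ^+ 2.
Proof. by have := expR_ge1Dx (- y ^+ 2); lra. Qed.

Lemma gaussian_defect_le y : 0 <= y -> 1 - expR (- y ^+ 2) <= y.
Proof.
move=> y0; have [y1|/ltW y1] := leP y 1.
  apply: le_trans (gaussian_defect_le_sqr y) _; nra.
exact: le_trans (gaussian_defect_le1 y) y1.
Qed.

Lemma gaussian_defect_ge_half y : 1 <= y -> 1 / 2 <= 1 - expR (- y ^+ 2).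
Proof.
move=> y1; have h : expR (- y ^+ 2) <= expR (- 1) by rewrite ler_expR; nra.
suff : expR (- 1) <= 1 / 2 :> R by lra.
by rewrite expRN -div1r ler_pdivrMr ?expR_gt0//; have := @expR_ge1Dx R 1; lra.
Qed.

Lemma dyadic_sum_ge0 N x : 0 <= dyadic_sum N x.
Proof. by apply: sumr_ge0 => n _; rewrite mulr_ge0 ?exprn_ge0// gaussian_defect_ge0. Qed.

(** The terms with [2^n <= x] are at most [2^n], the other ones at most [x^2 / 2^n];
    both parts are geometric sums. *)
Lemma dyadic_sum_le N x : 0 <= x -> dyadic_sum N x <= 4 * x.
Proof.
move=> x0.
suff [h1 h2] : (2 ^+ N <= 2 * x -> dyadic_sum N x <= 2 ^+ N) /\
    (2 * x <= 2 ^+ N -> dyadic_sum N x <= 4 * x - 2 * x ^+ 2 / 2 ^+ N).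
  have [hx|/ltW hx] := leP (2 ^+ N) (2 * x).
    by apply: le_trans (h1 hx) _; lra.
  apply: le_trans (h2 hx) _; rewrite gerBl.
  by rewrite divr_ge0 ?mulr_ge0 ?sqr_ge0 ?exprn_ge0.
elim: N => [|N [IH1 IH2]].
  rewrite /dyadic_sum big_ord0 expr0 divr1; split => // h.
  have : 0 <= x * (1 - 2 * x) by rewrite mulr_ge0// subr_ge0.
  by rewrite expr2; lra.
have p0 : 0 < 2 ^+ N :> R by rewrite exprn_gt0.
rewrite dyadic_sumS exprS; move: p0 IH1 IH2.
have := gaussian_defect_le1 (x / 2 ^+ N).
have := gaussian_defect_le_sqr (x / 2 ^+ N).
move: (1 - expR _) (dyadic_sum N x) => e S; rewrite expr_div_n.
move: (2 ^+ N) => p he1 he2 p0 IH1 IH2.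
have pe1 : p * e <= p by rewrite ler_piMr ?(ltW p0).
have pe2 : p * e <= x ^+ 2 / p.
  apply: le_trans (ler_wpM2l (ltW p0) he1) _.
  by rewrite le_eqVlt; apply/orP; left; apply/eqP; field; rewrite gt_eqF.
split => hx.
  have := IH1 ltac:(lra); lra.
rewrite (_ : 2 * x ^+ 2 / (2 * p) = x ^+ 2 / p); last by field; rewrite gt_eqF.
have [h|/ltW h] := leP p (2 * x).
  have := IH1 h; suff : x ^+ 2 / p * 2 <= 4 * x - p by lra.
  rewrite mulrAC ler_pdivrMr//; nra.
have := IH2 h; rewrite -mulrA; lra.
Qed.

(** The terms with [2^n <= x] contribute at least half of [2^n]. *)
Lemma min_le_dyadic_sum N x : 0 <= x -> Num.min x (2 ^+ N) <= 1 + 2 * dyadic_sum N x.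
Proof.
move=> x0; elim: N => [|N IH].
  by rewrite /dyadic_sum big_ord0 mulr0 addr0 expr0 ge_min lexx orbT.
rewrite dyadic_sumS exprS.
have p0 : 0 < 2 ^+ N :> R by rewrite exprn_gt0.
have := gaussian_defect_ge0 (x / 2 ^+ N).
have [hx|hx] := leP (2 ^+ N) x; last first.
  move=> e0; apply: (@le_trans _ _ (Num.min x (2 ^+ N))).
    by rewrite (min_l (ltW hx)) ge_min lexx.
  apply: le_trans IH _; rewrite lerD2l ler_pM2l// lerDl.
  by rewrite mulr_ge0 ?(ltW p0).
have := @gaussian_defect_ge_half (x / 2 ^+ N); rewrite ler_pdivlMr// !mul1r => /(_ hx).
move: (1 - expR _) => e e1 _.
rewrite min_r// in IH; apply: (@le_trans _ _ (2 * 2 ^+ N)); first by rewrite ge_min lexx orbT.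
nra.
Qed.

End dyadic_sums.

(** * Integrals and integrable cocycles *)

Section mean.
Context (R : realType) d (Omega : measurableType d).
Context (mu : {finite_measure set Omega -> \bar R}).
Implicit Types (f g : Omega -> R).
Local Notation meas := (measurable_fun setT).

Definition mean f : \bar R := (\int[mu]_w (f w)%:E)%E.

Lemma mean_ge0 f : (forall w, 0 <= f w) -> (0 <= mean f)%E.
Proof. by move=> f0; apply: integral_ge0 => w _; rewrite lee_fin. Qed.

Lemma mean_ae_le f g : meas f -> meas g -> (forall w, 0 <= f w) ->
  (forall w, 0 <= g w) -> (\forall w \ae mu, f w <= g w) -> (mean f <= mean g)%E.
Proof.
move=> mf mg f0 g0 fg; apply: ae_ge0_le_integral => //.
- by move=> w _; rewrite lee_fin.
- exact/measurable_EFinP.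
- by move=> w _; rewrite lee_fin.
- exact/measurable_EFinP.
by apply: filterS fg => w fgw _; rewrite lee_fin.
Qed.

Lemma mean_le f g : meas f -> meas g -> (forall w, 0 <= f w) ->
  (forall w, f w <= g w) -> (mean f <= mean g)%E.
Proof.
move=> mf mg f0 fg; apply: mean_ae_le => //; last exact: aeW.
by move=> w; apply: le_trans (fg w).
Qed.

Lemma mean_ae_eq f g : meas f -> meas g -> (forall w, 0 <= f w) ->
  (forall w, 0 <= g w) -> (\forall w \ae mu, f w = g w) -> mean f = mean g.
Proof.
move=> mf mg f0 g0 fg; apply/eqP; rewrite eq_le !mean_ae_le//.
  by apply: filterS fg => w ->.
by apply: filterS fg => w ->.
Qed.

Lemma meanD f g : meas f -> meas g -> (forall w, 0 <= f w) ->
  (forall w, 0 <= g w) -> mean (fun w => f w + g w) = (mean f + mean g)%E.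
Proof.
move=> mf mg f0 g0; rewrite /mean -ge0_integralD//.
- by move=> w _; rewrite lee_fin.
- exact/measurable_EFinP.
- by move=> w _; rewrite lee_fin.
- exact/measurable_EFinP.
Qed.

Lemma meanZ (c : R) f : meas f -> (forall w, 0 <= f w) -> 0 <= c ->
  mean (fun w => c * f w) = (c%:E * mean f)%E.
Proof.
move=> mf f0 c0; rewrite /mean -ge0_integralZl//.
- exact/measurable_EFinP.
- by move=> w _; rewrite lee_fin.
Qed.

Lemma mean_cst (c : R) : mean (fun=> c) = (c%:E * mu setT)%E.
Proof. by rewrite /mean integral_cst. Qed.

Lemma mean_sum n (F : nat -> Omega -> R) : (forall i, meas (F i)) ->
  (forall i w, 0 <= F i w) ->
  mean (fun w => \sum_(i < n) F i w) = (\sum_(i < n) mean (F i))%E.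
Proof.
move=> mF F0; elim: n => [|n IH].
  by rewrite big_ord0 (_ : (fun _ => _) = (fun=> 0)) ?mean_cst ?mul0e//;
    apply/funext => w; rewrite big_ord0.
rewrite big_ord_recr /= -IH -meanD//.
- by congr mean; apply/funext => w; rewrite big_ord_recr.
- exact: measurable_sum.
- by move=> w; apply: sumr_ge0.
Qed.

Lemma mean_fin_num f (M : R) : (forall w, 0 <= f w) -> (mean f <= M%:E)%E ->
  mean f \is a fin_num.
Proof. by move=> f0 fM; rewrite ge0_fin_numE ?mean_ge0// (le_lt_trans fM) ?ltry. Qed.

Lemma mean_bounded f (M : R) : meas f -> (forall w, 0 <= f w) ->
  (forall w, f w <= M) -> mean f \is a fin_num.
Proof.
move=> mf f0 fM; apply: (@mean_fin_num _ (M * fine (mu setT))) => //.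
rewrite EFinM fineK ?fin_num_measure// -mean_cst; exact: mean_le.
Qed.

Lemma mean_eq0 f : meas f -> (forall w, 0 <= f w) -> mean f = 0%E ->
  \forall w \ae mu, f w = 0.
Proof.
move=> mf f0 mf0.
have [+ _] := ae_eq_integral_abs mu measurableT (proj2 (measurable_EFinP _ _) mf).
rewrite (_ : \int[mu]_(x in setT) _ = mean f)%E.
  by move=> /(_ mf0); apply: filterS => w /(_ I) [].
by apply: eq_integral => w _; rewrite gee0_abs// lee_fin.
Qed.

Context (G : topologicalGroupType) (T : G -> {mfun Omega >-> Omega}).
Hypothesis preserving : measure_preserving mu T.

Lemma mean_comp (g : G) f : meas f -> (forall w, 0 <= f w) ->
  mean (fun w => f (T g w)) = mean f.
Proof.
move=> mf f0; rewrite /mean.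
have := @ge0_integral_pushforward _ _ Omega Omega R (T g) _ mu setT (EFin \o f).
move=> /(_ _ measurableT) h.
rewrite -[LHS]/(\int[mu]_(x in T g @^-1` setT) ((EFin \o f) \o T g) x)%E -h.
- by apply: eq_measure_integral => A mA _; exact: preserving.
- by [].
- exact/measurable_EFinP.
- by move=> w _; rewrite lee_fin.
Qed.

Lemma ae_comp (g : G) (P : Omega -> Prop) :
  (\forall w \ae mu, P w) -> \forall w \ae mu, P (T g w).
Proof.
move=> [N [mN N0 PN]]; exists (T g @^-1` N); split.
- exact: mfun_preimage_measurable.
- by rewrite preserving.
- by move=> w /= nP; exact: PN.
Qed.

End mean.

Section cocycles.
Context (R : realType) (s : scalar_kind) (G : topologicalGroupType).
Context d (Omega : measurableType d) (mu : {finite_measure set Omega -> \bar R}).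
Local Notation K := (scalars R s).
Variable T : G -> {mfun Omega >-> Omega}.
Hypothesis preserving : measure_preserving mu T.

Lemma scalar_measurableN (f : Omega -> K) :
  scalar_measurable f -> scalar_measurable (fun w => - f w).
Proof.
move=> [mr mi]; split.
  by under eq_fun do rewrite sReN; exact: measurableT_comp.
by under eq_fun do rewrite sImN; exact: measurableT_comp.
Qed.

Lemma scalar_measurableB (f g : Omega -> K) :
  scalar_measurable f -> scalar_measurable g -> scalar_measurable (fun w => f w - g w).
Proof. by move=> mf /scalar_measurableN; exact: scalar_measurableD. Qed.

Lemma scalar_measurable_comp (f : Omega -> K) (g : G) :
  scalar_measurable f -> scalar_measurable (fun w => f (T g w)).
Proof. by move=> [mr mi]; split; apply: (measurableT_comp (f := _ \o f)). Qed.

(** Cocycles with values in L1, as families of functions satisfying the cocycle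
    relation almost everywhere.  This covers both the given cocycle and
    coboundaries of truncated functions for the untwisted action. *)
Record l1_cocycle (chi : G -> Omega -> K) (b : G -> Omega -> K) : Prop := L1Cocycle {
  cocycle_meas : forall g, scalar_measurable (b g);
  multiplier_meas : forall g, scalar_measurable (chi g);
  multiplier_unimodular : forall g, \forall w \ae mu, rnorm (chi g w) = 1;
  cocycle_eq : forall g h, \forall w \ae mu,
    b (g * h)%g w = b g w + twisted_translate T chi g (b h) w;
  cocycle_fin : forall g, (mean mu (fun w => rnorm (b g w)) < +oo)%E;
  cocycle_cont : forall g (e : R), 0 < e ->
    \forall h \near g, (mean mu (fun w => rnorm (b h w - b g w)%R) < e%:E)%E
}.

Section one_cocycle.
Variables (chi b : G -> Omega -> K).
Hypothesis cb : l1_cocycle chi b.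

Lemma measurable_rnormB g h : measurable_fun setT (fun w => rnorm (b g w - b h w)).
Proof. by apply: measurable_rnorm; apply: scalar_measurableB; exact: cocycle_meas cb _. Qed.

Lemma cocycle_translate g a a' : \forall w \ae mu,
  rnorm (b (g * a)%g w - b (g * a')%g w) = rnorm (b a (T g^-1%g w) - b a' (T g^-1%g w)).
Proof.
have := cocycle_eq cb g a; have := cocycle_eq cb g a'.
have := multiplier_unimodular cb g.
apply: filterS3 => w h1 -> ->.
by rewrite opprD addrACA subrr add0r -mulrBr rnormM h1 mul1r.
Qed.

(** The cocycle relation at [1, 1] says that a translate of [b 1] vanishes. *)
Lemma cocycle1_eq0 : \forall w \ae mu, b 1%g w = 0.
Proof.
have E : mean mu (fun w => rnorm (b 1%g w)) = mean mu (fun w => rnorm (b 1%g (T (1^-1)%g w))).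
  rewrite (mean_comp preserving _ (f := fun w => rnorm (b 1%g w)))//.
    exact/measurable_rnorm/(cocycle_meas cb).
  by move=> w; exact: rnorm_ge0.
have m1 := measurable_rnorm (cocycle_meas cb 1%g).
have E0 : mean mu (fun w => rnorm (b 1%g (T (1^-1)%g w))) = 0%E.
  rewrite (_ : 0%E = mean mu (fun=> 0)); last by rewrite mean_cst mul0e.
  apply: mean_ae_eq => //.
  - by apply: measurable_rnorm; apply: scalar_measurable_comp; exact: cocycle_meas cb _.
  - by move=> w; exact: rnorm_ge0.
  - have := cocycle_eq cb 1%g 1%g; have := multiplier_unimodular cb 1%g.
    apply: filterS2 => w h1; rewrite mulg1 -[LHS]addr0 => /addrI h.
    by rewrite -[LHS]mul1r -h1 -rnormM -[X in rnorm X]/(twisted_translate T chi 1%g (b 1%g) w) -h rnorm0.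
have := mean_eq0 m1 (fun w => rnorm_ge0 _) (etrans E E0).
by apply: filterS => w /rnorm_eq0.
Qed.

End one_cocycle.
End cocycles.

Section mean_fatou.
Context (R : realType) d (Omega : measurableType d).
Context (mu : {finite_measure set Omega -> \bar R}).
Local Notation meas := (measurable_fun setT).

(** Multiplying by the indicator of a conull set on which the sequence converges
    reduces to Fatou's lemma for pointwise limits. *)
Lemma mean_fatou (F : nat -> Omega -> R) (f : Omega -> R) (C : \bar R) :
  (forall n, meas (F n)) -> meas f -> (forall n w, 0 <= F n w) ->
  (forall w, 0 <= f w) -> (\forall w \ae mu, F n w @[n --> \oo] --> f w) ->
  (forall n, (mean mu (F n) <= C)%E) -> (mean mu f <= C)%E.
Proof.
move=> mF mf F0 f0 [N [mN N0 Ff]] FC.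
pose u w : R := \1_(~` N) w.
have mu_ : meas u by exact: measurable_indic (measurableC mN).
have u1 w : ~ N w -> u w = 1 by move=> nN; rewrite /u indicE mem_set.
have u0 w : 0 <= u w <= 1 by rewrite /u indicE; case: (_ \in _); rewrite /= ?lexx ?ler01.
have ae_u (g : Omega -> R) : \forall w \ae mu, g w = g w * u w.
  by exists N; split => // w /=; apply: contra_notP => /u1 ->; rewrite mulr1.
have mu_le (g : Omega -> R) w : 0 <= g w -> 0 <= g w * u w <= g w.
  by move=> g0; have /andP[? ?] := u0 w; rewrite mulr_ge0//= ler_piMr.
rewrite (@mean_ae_eq _ _ _ mu f (fun w => f w * u w))//; first last.
- by move=> w; have /andP[] := mu_le f w (f0 w).
- exact: measurable_funM.
have cvgu w : (fun n => (F n w * u w)%:E) @ \oo --> (f w * u w)%:E.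
  apply: cvg_EFin; first by near=> n.
  have [Nw|nNw] := pselect (N w).
    have -> : u w = 0 by rewrite /u indicE (_ : w \in ~` N = false)//; apply/negP; rewrite inE; exact.
    by under eq_fun do rewrite mulr0; rewrite mulr0; apply: cvg_cst.
  apply: cvgMl; apply: contrapT => nc; apply: nNw; exact: Ff.
rewrite /mean (_ : \int[mu]_w _ = \int[mu]_w limn_einf (fun n => (F n w * u w)%:E))%E; last first.
  apply: eq_integral => w _; rewrite is_cvg_limn_einfE ?(cvg_lim _ (cvgu w))//.
apply: le_trans (@fatou _ _ _ mu setT measurableT (fun n w => (F n w * u w)%:E) _ _) _.
- by move=> n; apply/measurable_EFinP; exact: measurable_funM.
- by move=> n w _; rewrite lee_fin; have /andP[] := mu_le (F n) w (F0 n w).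
rewrite limn_einf_lim; apply: lime_le; first exact: is_cvg_einfs.
near=> n; apply: le_trans (FC n); apply: (@le_trans _ _ (mean mu (fun w => F n w * u w))).
  by apply: ereal_inf_lbound; exists n => /=.
apply: mean_le => //.
- exact: measurable_funM.
- by move=> w; have /andP[] := mu_le (F n) w (F0 n w).
- by move=> w; have /andP[] := mu_le (F n) w (F0 n w).
Unshelve. all: by end_near. Qed.

End mean_fatou.

(** * A uniform L1 bound for cocycles *)

Section uniform_bound.
Context (R : realType) (s : scalar_kind) (G : topologicalGroupType).
Context d (Omega : measurableType d) (mu : {finite_measure set Omega -> \bar R}).
Local Notation K := (scalars R s).
Variable T : G -> {mfun Omega >-> Omega}.
Hypothesis preserving : measure_preserving mu T.
Variable I : eqType.
Variables (chi b : I -> G -> Omega -> K).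
Hypothesis cb : forall i, l1_cocycle mu T (chi i) (b i).

(** An index is a cocycle together with a scale: using all of them at once is what
    makes the constants of [cocycle_uniform_bound] uniform. *)
Let J : eqType := (I * nat)%type.
Let scale (j : J) : R := 2 ^+ j.2.

Lemma scale_gt0 j : 0 < scale j. Proof. by rewrite exprn_gt0. Qed.

Definition ratio (j : J) (g h : G) (w : Omega) : R :=
  rnorm (b j.1 g w - b j.1 h w) / scale j.

Lemma ratio_ge0 j g h w : 0 <= ratio j g h w.
Proof. by rewrite divr_ge0 ?rnorm_ge0// ltW// scale_gt0. Qed.

Lemma measurable_ratio j g h : measurable_fun setT (ratio j g h).
Proof.
by apply: measurable_funM => //; exact: (measurable_rnormB (cb j.1)).
Qed.

Lemma gaussian_ratio j g h w :
  gaussian ((scale j) ^- 2) (b j.1 g w) (b j.1 h w) = expR (- ratio j g h w ^+ 2).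
Proof. by rewrite /gaussian /ratio expr_div_n mulrC. Qed.

Definition affinity j g h : R := fine (mean mu (fun w => expR (- ratio j g h w ^+ 2))).

Definition separation j g h : \bar R := mean mu (fun w => 1 - expR (- ratio j g h w ^+ 2)).

Lemma measurable_exp_ratio j g h : measurable_fun setT (fun w => expR (- ratio j g h w ^+ 2)).
Proof.
apply: measurableT_comp => //; apply: measurableT_comp => //.
by apply: measurable_funX; exact: measurable_ratio.
Qed.

Lemma measurable_1B_exp_ratio j g h :
  measurable_fun setT (fun w => 1 - expR (- ratio j g h w ^+ 2)).
Proof. by apply: measurable_funB => //; exact: measurable_exp_ratio. Qed.

Lemma affinity_fin_num j g h : mean mu (fun w => expR (- ratio j g h w ^+ 2)) \is a fin_num.
Proof.
apply: (@mean_bounded _ _ _ _ _ 1); first exact: measurable_exp_ratio.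
  by move=> w; exact: expR_ge0.
by move=> w; have := gaussian_defect_ge0 (ratio j g h w); rewrite subr_ge0.
Qed.

Lemma separation_fin_num j g h : separation j g h \is a fin_num.
Proof.
apply: (@mean_bounded _ _ _ _ _ 1); first exact: measurable_1B_exp_ratio.
  by move=> w; exact: gaussian_defect_ge0.
by move=> w; exact: gaussian_defect_le1.
Qed.

Lemma affinityE j g h : affinity j g h = fine (mu setT) - fine (separation j g h).
Proof.
apply/eqP; rewrite eq_sym subr_eq; apply/eqP/EFin_inj.
rewrite EFinD !fineK ?fin_num_measure ?separation_fin_num ?affinity_fin_num//.
rewrite -meanD//; first last.
- by move=> w; exact: gaussian_defect_ge0.
- exact: measurable_1B_exp_ratio.
- exact: measurable_exp_ratio.
rewrite -[LHS]mul1e -mean_cst; congr mean; apply/funext => w.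
by rewrite addrCA subrr addr0.
Qed.

Lemma affinity_sym j g h : affinity j g h = affinity j h g.
Proof.
rewrite /affinity; congr (fine (mean _ _)); apply/funext => w.
by rewrite /ratio rnorm_distC.
Qed.

Lemma affinity_diag j g : affinity j g g = fine (mu setT).
Proof.
rewrite affinityE (_ : separation j g g = 0%E) ?subr0//.
rewrite /separation (_ : (fun _ => _) = fun=> 0) ?mean_cst ?mul0e//.
by apply/funext => w; rewrite /ratio subrr rnorm0 mul0r expr0n oppr0 expR0 subrr.
Qed.

(** [b (a g) - b (a h)] is, up to a unimodular factor, the translate by [a] of
    [b g - b h]. *)
Lemma affinity_translate j a g h : affinity j (a * g)%g (a * h)%g = affinity j g h.
Proof.
rewrite /affinity; congr fine.
rewrite -(mean_comp preserving a^-1%g (f := fun w => expR (- ratio j g h w ^+ 2))).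
- apply: mean_ae_eq.
  + exact: measurable_exp_ratio.
  + apply: (measurableT_comp (f := fun w => expR (- ratio j g h w ^+ 2))) => //.
    exact: measurable_exp_ratio.
  + by move=> w; exact: expR_ge0.
  + by move=> w; exact: expR_ge0.
  + have := cocycle_translate (cb j.1) a g h.
    by apply: filterS => w; rewrite /ratio => ->.
- exact: measurable_exp_ratio.
- by move=> w; exact: expR_ge0.
Qed.

Lemma affinity_psd j : positive_semidefinite (affinity j).
Proof.
move=> l; pose L := [seq (p, q) | p <- l, q <- l].
have intg g h : mu.-integrable setT (EFin \o (fun w => expR (- ratio j g h w ^+ 2))).
  apply/integrableP; split; first by apply/measurable_EFinP; exact: measurable_exp_ratio.
  rewrite (_ : integral _ _ _ = mean mu (fun w => expR (- ratio j g h w ^+ 2))).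
    by rewrite ltey_eq affinity_fin_num.
  by apply: eq_integral => w _; rewrite gee0_abs// lee_fin expR_ge0.
pose F (pq : (R * G) * (R * G)) w := pq.1.1 * pq.2.1 * expR (- ratio j pq.1.2 pq.2.2 w ^+ 2).
have key (L' : seq ((R * G) * (R * G))) :
    mu.-integrable setT (EFin \o (fun w => \sum_(pq <- L') F pq w)) /\
    \sum_(pq <- L') pq.1.1 * pq.2.1 * affinity j pq.1.2 pq.2.2 =
    Rintegral mu setT (fun w => \sum_(pq <- L') F pq w).
  elim: L' => [|pq L' [IH1 IH2]].
    rewrite (_ : (fun _ => _) = fun=> 0); last by apply/funext => w; rewrite big_nil.
    by rewrite big_nil Rintegral_cst// mul0r; split => //; exact: integrable0.
  have iF : mu.-integrable setT (EFin \o F pq).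
    have := integrableZl measurableT (pq.1.1 * pq.2.1) (intg pq.1.2 pq.2.2).
    by apply: eq_integrable.
  have E : (fun w => \sum_(pq <- pq :: L') F pq w) =
      (fun w => F pq w + \sum_(pq <- L') F pq w).
    by apply/funext => w; rewrite big_cons.
  rewrite E; split; first exact: (integrableD measurableT iF IH1).
  by rewrite RintegralD// big_cons IH2 /F RintegralZl//.
have [_] := key L; rewrite big_allpairs_dep /= => ->.
apply: Rintegral_ge0 => w _; rewrite /L big_allpairs_dep /=.
have t0 : 0 <= (scale j) ^- 2 by rewrite invr_ge0 exprn_ge0// ltW// scale_gt0.
have := @psd_gaussian R s _ t0 [seq (p.1, b j.1 p.2 w) | p <- l].
rewrite big_map; congr (_ <= _); apply: eq_bigr => p _.
by rewrite big_map; apply: eq_bigr => q _; rewrite gaussian_ratio.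
Qed.

Definition block_kernel (x y : J * G) : R :=
  if x.1 == y.1 then affinity x.1 x.2 y.2 else 0.

Definition block_action (g : G) (x : J * G) : J * G := (x.1, (g * x.2)%g).

Fact block_action1 x : block_action 1%g x = x.
Proof. by case: x => j a; rewrite /block_action mul1g. Qed.

Fact block_actionM g h x : block_action (g * h)%g x = block_action g (block_action h x).
Proof. by rewrite /block_action mulgA. Qed.

Fact block_sym x y : block_kernel x y = block_kernel y x.
Proof. by rewrite /block_kernel eq_sym; case: eqP => // ->; rewrite affinity_sym. Qed.

Fact block_psd : positive_semidefinite block_kernel.
Proof. exact: psd_block affinity_psd. Qed.

Fact block_invariant g x y :
  block_kernel (block_action g x) (block_action g y) = block_kernel x y.
Proof. by rewrite /block_kernel /= affinity_translate. Qed.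

Fact block_continuous x g e : 0 < e -> \forall h \near g,
  block_kernel x x - block_kernel (block_action h x) (block_action g x) < e.
Proof.
case: x => j a e0; rewrite /block_kernel /= !eqxx.
have cc : \forall h \near g,
    (mean mu (fun w => rnorm (b j.1 (h * a)%g w - b j.1 (g * a)%g w)%R) < e%:E)%E.
  have ca : (fun h : G => (h * a)%g) @ g --> (g * a)%g.
    apply: (@cvg_comp _ _ _ (fun h => (h, a)) (fun x : G * G => (x.1 * x.2)%g)).
      by apply: (@cvg_pair _ _ _ _ (nbhs g) (nbhs a)); [exact: cvg_id|apply: cvg_cst].
    exact: (@mulg_continuous G (g, a)).
  exact: (ca _ (cocycle_cont (cb j.1) (g * a)%g e0)).
apply: filterS cc => h hh.
rewrite affinity_diag affinityE subKr -lte_fin fineK ?separation_fin_num//.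
apply: le_lt_trans hh; apply: mean_le.
- exact: measurable_1B_exp_ratio.
- exact: (measurable_rnormB (cb j.1)).
- by move=> w; exact: gaussian_defect_ge0.
move=> w; apply: le_trans (gaussian_defect_le (ratio_ge0 _ _ _ _)) _.
by rewrite /ratio ler_piMr ?rnorm_ge0// invf_le1 ?scale_gt0// exprn_ege1// ler1n.
Qed.

Definition affinity_kernel : group_kernel R G (J * G)%type :=
  GroupKernel block_action1 block_actionM block_sym block_psd block_invariant
    block_continuous.

(** The coefficient [sqrt (2^n)] at scale [2^n] gives, by orthogonality of
    the scales, a squared displacement equal to twice the mean of
    [dyadic_sum N |b i g|]. *)
Definition dyadic_vector (i : I) (N : nat) : seq (K * (J * G)) :=
  [seq (of_real s (Num.sqrt (2 ^+ n)), ((i, n), 1%g)) | n <- index_iota 0 N].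

Lemma dyadic_vector_form i N g :
  sRe (kernel_form affinity_kernel
    (formal [seq (p.1, kernel_action affinity_kernel g p.2) | p <- dyadic_vector i N])
    (formal (dyadic_vector i N))) =
  \sum_(n < N) 2 ^+ n * affinity (i, val n) g 1%g.
Proof.
rewrite kernel_formE sRe_sum !big_map big_mkord; apply: eq_bigr => n _.
rewrite sRe_sum big_map big_mkord (bigD1 n)//= [X in _ + X]big1 ?addr0.
  rewrite /block_kernel /= eqxx sconj_real -!of_realM of_realK mulg1.
  by rewrite -expr2 sqr_sqrtr ?exprn_ge0// affinity_sym.
move=> m mn; rewrite /block_kernel /= xpair_eqE eqxx /= (inj_eq val_inj) (negbTE mn).
by rewrite sconj_real -!of_realM of_realK mulr0.
Qed.

Lemma dyadic_vector_displacement i N g :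
  (pnorm (kernel_sip s affinity_kernel)
    (kernel_rep s affinity_kernel g (formal (dyadic_vector i N))
     - formal (dyadic_vector i N)) ^+ 2)%:E =
  (2%:E * mean mu (fun w => dyadic_sum N (rnorm (b i g w - b i 1%g w))))%E.
Proof.
set v := dyadic_vector i N.
have v1 : [seq (p.1, kernel_action affinity_kernel 1%g p.2) | p <- v] = v.
  by rewrite -[RHS]map_id; apply: eq_map => -[c x] /=; rewrite block_action1.
rewrite kernel_rep_displacement dyadic_vector_form.
have := dyadic_vector_form i N 1%g; rewrite -/v v1 => ->.
rewrite EFinM -sumrB -sumEFin; congr (_ * _)%E.
pose F n w := 2 ^+ n * (1 - expR (- ratio (i, n) g 1%g w ^+ 2)).
rewrite (_ : mean mu _ = mean mu (fun w => \sum_(n < N) F n w)) // mean_sum.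
- apply: eq_bigr => n _; rewrite meanZ ?exprn_ge0//; first last.
  + by move=> w; exact: gaussian_defect_ge0.
  + exact: measurable_1B_exp_ratio.
  rewrite -mulrBr EFinM affinity_diag affinityE opprB addrCA subrr addr0.
  by rewrite fineK// separation_fin_num.
- by move=> n; apply: measurable_funM => //; exact: measurable_1B_exp_ratio.
- by move=> n w; rewrite mulr_ge0 ?exprn_ge0// gaussian_defect_ge0.
Qed.

Lemma measurable_dyadic_sum N (f : Omega -> R) : measurable_fun setT f ->
  measurable_fun setT (fun w => dyadic_sum N (f w)).
Proof.
move=> mf; apply: measurable_sum => n; apply: measurable_funM => //.
apply: measurable_funB => //; apply: measurableT_comp => //.
apply: measurableT_comp => //; apply: measurable_funX.
exact: measurable_funM.
Qed.

(** [C] and [c] come from [property_T_displacement] for the direct sum of all the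
    kernels.  The additive constant [fine (mu setT)] accounts for the values of
    [|b i g|] below 1, which the dyadic sums do not see. *)
Theorem cocycle_uniform_bound : property_T R s G ->
  exists2 C : set G, compact C & exists2 c : R, 0 <= c & forall i M, 0 <= M ->
    (forall g, C g -> (mean mu (fun w => rnorm (b i g w)) <= M%:E)%E) ->
    forall g, (mean mu (fun w => rnorm (b i g w)) <= (fine (mu setT) + c * M)%:E)%E.
Proof.
move=> /(property_T_displacement (kernel_rep s affinity_kernel)).
move=> [C cC [c c0 hC]]; exists C => //; exists (8 * c ^+ 2).
  by rewrite mulr_ge0 ?sqr_ge0.
move=> i M M0 hM g.
have mB h : measurable_fun setT (fun w => rnorm (b i h w - b i 1%g w)).
  exact: (measurable_rnormB (cb i)).
have mb h : measurable_fun setT (fun w => rnorm (b i h w)).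
  exact/measurable_rnorm/(cocycle_meas (cb i)).
have sub1 h : mean mu (fun w => rnorm (b i h w - b i 1%g w)) = mean mu (fun w => rnorm (b i h w)).
  apply: mean_ae_eq => //; [by move=> w; exact: rnorm_ge0|by move=> w; exact: rnorm_ge0|].
  by have := cocycle1_eq0 preserving (cb i); apply: filterS => w ->; rewrite subr0.
have mean_dyadic N : (mean mu (fun w => dyadic_sum N (rnorm (b i g w - b i 1%g w)))
    <= (4 * c ^+ 2 * M)%:E)%E.
  have h2 : (pnorm (kernel_sip s affinity_kernel)
      (kernel_rep s affinity_kernel g (formal (dyadic_vector i N))
      - formal (dyadic_vector i N)) <= c * Num.sqrt (8 * M)).
    apply: hC; first exact: sqrtr_ge0.
    move=> h Ch; rewrite -(@ler_pXn2r _ 2)// ?nnegrE ?pnorm_ge0 ?sqrtr_ge0//.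
    rewrite [leRHS]sqr_sqrtr ?mulr_ge0// -lee_fin.
    apply: (@le_trans _ _ (2%:E *
        mean mu (fun w => dyadic_sum N (rnorm (b i h w - b i 1%g w))))%E).
      by rewrite -dyadic_vector_displacement; exact: lexx.
    rewrite (_ : 8 * M = 2 * (4 * M)); last by ring.
    rewrite [leRHS]EFinM lee_pmul2l// EFinM.
    apply: le_trans (_ : (4%:E * mean mu (fun w => rnorm (b i h w - b i 1%g w)))%E <= _)%E.
      rewrite -meanZ//; last by move=> w; exact: rnorm_ge0.
      apply: mean_le; first exact: measurable_dyadic_sum.
      - exact: measurable_funM.
      - by move=> w; exact: dyadic_sum_ge0.
      - by move=> w; apply: dyadic_sum_le; exact: rnorm_ge0.
    by rewrite sub1 lee_pmul2l// hM.
  have : (2%:E * mean mu (fun w => dyadic_sum N (rnorm (b i g w - b i 1%g w)))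
      <= (2 * (4 * c ^+ 2 * M))%:E)%E.
    rewrite -dyadic_vector_displacement lee_fin.
    rewrite (_ : 2 * _ = (c * Num.sqrt (8 * M)) ^+ 2).
      by rewrite ler_pXn2r// ?nnegrE ?pnorm_ge0// mulr_ge0// sqrtr_ge0.
    by rewrite exprMn sqr_sqrtr ?mulr_ge0//; ring.
  by rewrite EFinM lee_pmul2l.
rewrite -sub1; apply: (@mean_fatou _ _ _ mu
  (fun N w => Num.min (rnorm (b i g w - b i 1%g w)) (2 ^+ N))) => //.
- by move=> N; exact: measurable_minr.
- by move=> N w; rewrite le_min rnorm_ge0 exprn_ge0.
- by move=> w; exact: rnorm_ge0.
- apply: aeW => w; set x := rnorm _; apply: cvg_near_cst.
  exists (Num.truncn x).+1 => // n /= hn; apply/min_idPl.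
  apply: (@le_trans _ _ n%:R); last by rewrite -natrX ler_nat ltnW// ltn_expl.
  apply: le_trans (_ : (Num.truncn x).+1%:R <= _); last by rewrite ler_nat.
  by rewrite ltW// truncnS_gt.
- move=> N; apply: (@le_trans _ _ (mean mu
      (fun w => 1 + 2 * dyadic_sum N (rnorm (b i g w - b i 1%g w))))).
    apply: mean_le.
    + exact: measurable_minr.
    + by apply: measurable_funD => //; apply: measurable_funM => //; exact: measurable_dyadic_sum.
    + by move=> w; rewrite le_min rnorm_ge0 exprn_ge0.
    + by move=> w; apply: min_le_dyadic_sum; exact: rnorm_ge0.
  have mD : measurable_fun setT (fun w => dyadic_sum N (rnorm (b i g w - b i 1%g w))).
    exact: measurable_dyadic_sum.
  have D0 w : 0 <= dyadic_sum N (rnorm (b i g w - b i 1%g w)) by exact: dyadic_sum_ge0.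
  rewrite meanD//; [|exact: measurable_funM|by move=> w; rewrite mulr_ge0].
  rewrite mean_cst mul1e meanZ// [leRHS]EFinD fineK ?fin_num_measure// leeD2l//.
  rewrite (_ : 8 * c ^+ 2 * M = 2 * (4 * c ^+ 2 * M)); last by ring.
  by rewrite [leRHS]EFinM lee_pmul2l.
Qed.

End uniform_bound.

(** * A strictly convex gauge on the scalars *)

Section bracket.
Context (R : realType) (s : scalar_kind).
Local Notation K := (scalars R s).
Implicit Types (z w : K).

(** Strictly convex, unlike [|z|], but of the same growth at infinity: its mean is finite
    on L1. *)
Definition bracket z : R := Num.sqrt (1 + rnorm z ^+ 2).

Lemma bracket_sqr z : bracket z ^+ 2 = 1 + rnorm z ^+ 2.
Proof. by rewrite sqr_sqrtr// addr_ge0// sqr_ge0. Qed.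

Lemma bracket_ge0 z : 0 <= bracket z. Proof. exact: sqrtr_ge0. Qed.

Lemma bracket_ge1 z : 1 <= bracket z.
Proof. by rewrite -(@ler_pXn2r _ 2)// ?nnegrE ?bracket_ge0// bracket_sqr expr1n lerDl sqr_ge0. Qed.

Lemma rnorm_le_bracket z : rnorm z <= bracket z.
Proof.
by rewrite -(@ler_pXn2r _ 2)// ?nnegrE ?bracket_ge0 ?rnorm_ge0// bracket_sqr lerDr.
Qed.

Lemma bracket_le z : bracket z <= 1 + rnorm z.
Proof.
rewrite -(@ler_pXn2r _ 2)// ?nnegrE ?bracket_ge0 ?addr_ge0 ?rnorm_ge0//.
by rewrite bracket_sqr; have := rnorm_ge0 z; nra.
Qed.

Lemma measurable_bracket d (Omega : measurableType d) (f : Omega -> K) :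
  scalar_measurable f -> measurable_fun setT (fun x => bracket (f x)).
Proof.
move=> mf; apply: (@measurableT_comp _ _ _ _ _ _ (@Num.sqrt R)).
  by apply: continuous_measurable_fun; exact: sqrt_continuous.
by apply: measurable_funD => //; apply: measurable_funX; exact: measurable_rnorm.
Qed.

Definition midpoint z w : K := of_real s 2^-1 * (z + w).

(** [bracket z] is the Euclidean norm of [(1, z)].  With [A], [B] the brackets of [z], [w] and
    [2 C] the norm of the sum, [(A + B)^2 - (2 C)^2] is twice the defect in the
    Cauchy-Schwarz inequality for [(1, z)] and [(1, w)], and the Lagrange
    identity bounds this defect from below by [|z - w|^2 / (2 A B)]. *)
Lemma bracket_midpoint z w :
  rnorm (z - w) ^+ 2 / (bracket z + bracket w) ^+ 3 + bracket (midpoint z w) <=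
  2^-1 * (bracket z + bracket w).
Proof.
have := bracket_sqr z; have := bracket_sqr w; have := bracket_sqr (midpoint z w).
rewrite !rnorm_sqr /midpoint sReB sImB sRe_real sIm_real sReD sImD.
have := bracket_ge1 z; have := bracket_ge1 w; have := bracket_ge0 (of_real s 2^-1 * (z + w)).
move: (bracket z) (bracket w) (bracket _) => A B C.
move: (sRe z) (sIm z) (sRe w) (sIm w) => a b c e C0 B1 A1 hC hB hA.
have A0 : 0 <= A by lra.
have B0 : 0 <= B by lra.
pose P := 1 + a * c + b * e; pose D := (a - c) ^+ 2 + (b - e) ^+ 2.
have AB0 : 0 <= A * B by rewrite mulr_ge0.
have hAB : D + P ^+ 2 <= (A * B) ^+ 2.
  rewrite exprMn hA hB /D /P; have := sqr_ge0 (a * e - b * c); lra.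
have D0 : 0 <= D by rewrite addr_ge0// sqr_ge0.
have PAB : `|P| <= A * B.
  rewrite -(@ler_pXn2r _ 2)// ?nnegrE// real_normK ?num_real//.
  by apply: le_trans hAB; rewrite lerDr.
have [P1 P2] : P <= A * B /\ - P <= A * B.
  by split; apply: le_trans PAB; rewrite ?ler_norm// -normrN ler_norm.
have h1 : D <= (A * B - P) * (2 * (A * B)).
  have : 0 <= (A * B - P) * (A * B - P) by rewrite mulr_ge0 ?subr_ge0.
  lra.
have hS : (A + B) ^+ 2 - (2 * C) ^+ 2 = 2 * (A * B - P).
  by rewrite exprMn hC /P sqrrD hA hB; field.
have CS : 2 * C <= A + B.
  rewrite -(@ler_pXn2r _ 2)// ?nnegrE ?mulr_ge0 ?addr_ge0//.
  by rewrite -subr_ge0 hS mulr_ge0 ?subr_ge0.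
set S := A + B in hS CS *; have S0 : 0 < S by rewrite /S; lra.
have ABS : 4 * (A * B) <= S ^+ 2 by rewrite /S; have := sqr_ge0 (A - B); lra.
have h2 : A * B - P <= (S - 2 * C) * S.
  have : (S - 2 * C) * (S + 2 * C) = 2 * (A * B - P) by rewrite -hS; ring.
  have : 0 <= (S - 2 * C) * (S - 2 * C) by rewrite mulr_ge0 ?subr_ge0.
  lra.
have h3 : 2 * D <= (S - 2 * C) * S ^+ 3.
  have s1 : (A * B - P) * (4 * (A * B)) <= (A * B - P) * S ^+ 2.
    by rewrite ler_wpM2l ?subr_ge0.
  have s2 : (A * B - P) * S ^+ 2 <= (S - 2 * C) * S * S ^+ 2.
    by rewrite ler_wpM2r ?sqr_ge0.
  have -> : S ^+ 3 = S * S ^+ 2 by rewrite exprS.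
  lra.
have : D / S ^+ 3 <= (S - 2 * C) / 2.
  by rewrite ler_pdivrMr ?exprn_gt0//; lra.
by rewrite -/D; lra.
Qed.

(** Young's inequality [y <= l^-3 y^4 / S^3 + l S] at [y = sqrt x]: if [y > l S] then the
    first term alone is at least [y].  It trades the convexity defect
    [x^2 / S^3] for the integrable weight [S]. *)
Lemma sqrt_le_interpolation (x S l : R) : 0 <= x -> 0 < S -> 0 < l ->
  Num.sqrt x <= l ^- 3 * (x ^+ 2 / S ^+ 3) + l * S.
Proof.
move=> x0 S0 l0; set y := Num.sqrt x.
have y0 : 0 <= y by exact: sqrtr_ge0.
have -> : x = y ^+ 2 by rewrite sqr_sqrtr.
have lS : 0 < l * S by rewrite mulr_gt0.
have q0 : 0 <= (y ^+ 2) ^+ 2 / S ^+ 3 by rewrite divr_ge0 ?sqr_ge0 ?exprn_ge0// ltW.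
have [h|/ltW h] := leP y (l * S).
  by apply: le_trans h _; rewrite lerDr mulr_ge0// invr_ge0 exprn_ge0// ltW.
suff : y <= l ^- 3 * ((y ^+ 2) ^+ 2 / S ^+ 3) by move: (l ^- 3 * _) => q; lra.
rewrite mulrC -mulrA -invfM [S ^+ 3 * _]mulrC -exprMn ler_pdivlMr ?exprn_gt0//.
rewrite -exprM /= [leRHS]exprS ler_wpM2l//.
by rewrite lerXn2r// ?nnegrE// ltW.
Qed.

End bracket.

(** * Near-minimizers of the energy *)

Section center.
Context (R : realType) (s : scalar_kind) (G : topologicalGroupType).
Context d (Omega : measurableType d) (mu : {finite_measure set Omega -> \bar R}).
Local Notation K := (scalars R s).
Variable T : G -> {mfun Omega >-> Omega}.
Hypothesis preserving : measure_preserving mu T.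
Variables (chi b : G -> Omega -> K).
Hypothesis cb : l1_cocycle mu T chi b.
Variable M : R.
Hypothesis bM : forall g, (mean mu (fun w => rnorm (b g w)) <= M%:E)%E.
Implicit Types phi psi : Omega -> K.

Definition mean_bracket phi g : \bar R := mean mu (fun w => bracket (phi w - b g w)).

(** The orbit of [0] under the affine action [phi |-> pi_g phi + b_g] is the set of
    the [b_g]; the energy of [phi] measures how far this orbit is from [phi]. *)
Definition energy phi : \bar R := ereal_sup (range (mean_bracket phi)).

Definition minimal_energy : \bar R := ereal_inf (energy @` [set phi | scalar_measurable phi]).

Lemma measurable_bracketB phi g : scalar_measurable phi ->
  measurable_fun setT (fun w => bracket (phi w - b g w)).
Proof.
by move=> mphi; apply: measurable_bracket; apply: scalar_measurableB => //; exact: cocycle_meas cb g.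
Qed.

Lemma mean_bracket_le_energy phi g : (mean_bracket phi g <= energy phi)%E.
Proof. by apply: ereal_sup_ubound; exists g. Qed.

Lemma scalar_measurable_cst (a : K) : scalar_measurable (fun _ : Omega => a).
Proof. by split; exact: measurable_cst. Qed.

Lemma energy0 : (energy (fun=> 0%R) <= (fine (mu setT) + M)%:E)%E.
Proof.
apply: ge_ereal_sup => _ [g _ <-].
have mr := measurable_rnorm (cocycle_meas cb g).
apply: (@le_trans _ _ (mean mu (fun w => 1 + rnorm (b g w)))).
  apply: mean_le; [exact/measurable_bracketB/scalar_measurable_cst|exact: measurable_funD| |].
    by move=> w; exact: bracket_ge0.
  by move=> w; rewrite sub0r; apply: le_trans (bracket_le _) _; rewrite rnormN.
rewrite meanD//; last by move=> w; exact: rnorm_ge0.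
by rewrite mean_cst mul1e EFinD fineK ?fin_num_measure// leeD2l.
Qed.

Lemma minimal_energy_le phi : scalar_measurable phi -> (minimal_energy <= energy phi)%E.
Proof. by move=> mphi; apply: ereal_inf_lbound; exists phi. Qed.

Lemma minimal_energy_fin_num : minimal_energy \is a fin_num.
Proof.
rewrite ge0_fin_numE.
  apply: le_lt_trans (minimal_energy_le (scalar_measurable_cst 0)) _.
  by apply: le_lt_trans energy0 _; rewrite ltry.
apply: le_ereal_inf_tmp => _ [phi mphi <-].
apply: le_trans (mean_bracket_le_energy phi 1%g).
by apply: mean_ge0 => w; exact: bracket_ge0.
Qed.

Local Notation e := (fine minimal_energy).

Lemma minimal_energy_ge0 : 0 <= e.
Proof.
rewrite fine_ge0//; apply: le_ereal_inf_tmp => _ [phi mphi <-].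
apply: le_trans (mean_bracket_le_energy phi 1%g).
by apply: mean_ge0 => w; exact: bracket_ge0.
Qed.

Lemma exists_near_minimal (r : R) : 0 < r ->
  exists2 phi, scalar_measurable phi & (energy phi <= (e + r)%:E)%E.
Proof.
move=> r0; have [|_ [phi mphi <-] h] := @lb_ereal_inf_adherent _
  (energy @` [set phi | scalar_measurable phi]) r r0.
  exact: minimal_energy_fin_num.
by exists phi => //; apply: ltW; rewrite EFinD fineK ?minimal_energy_fin_num.
Qed.

Lemma scalar_measurable_midpoint phi psi : scalar_measurable phi -> scalar_measurable psi ->
  scalar_measurable (fun w => midpoint (phi w) (psi w)).
Proof.
move=> mphi mpsi.
exact: (scalar_measurableZ (of_real s 2^-1) (scalar_measurableD mphi mpsi)).
Qed.

Lemma midpointB (z w a : K) : midpoint (z - a) (w - a) = midpoint z w - a.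
Proof.
rewrite /midpoint; have -> : z - a + (w - a) = (z + w) - of_real s 2 * a.
  rewrite addrACA -opprD; congr (_ - _).
  by apply: scalar_eq; rewrite ?sRe_real ?sIm_real ?sReD ?sImD mulr_natl mulr2n.
apply: scalar_eq; rewrite ?(sRe_real, sIm_real, sReB, sImB); lra.
Qed.

(** The midpoint of two near-minimizers has energy at least the infimum, so for some
    [g] the convexity defect at [phi - b_g] and [psi - b_g] has small mean; by
    [sqrt_le_interpolation] so has the square root of [|phi - psi|]. *)
Lemma near_minimal_close phi psi (r l : R) : 0 < r <= 1 -> 0 < l ->
  scalar_measurable phi -> scalar_measurable psi ->
  (energy phi <= (e + r)%:E)%E -> (energy psi <= (e + r)%:E)%E ->
  (mean mu (fun w => Num.sqrt (rnorm (phi w - psi w))) <=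
     (2 * r * l ^- 3 + 2 * l * (e + 1))%:E)%E.
Proof.
move=> /andP[r0 r1] l0 mphi mpsi Ephi Epsi.
pose rho w := midpoint (phi w) (psi w).
have mrho : scalar_measurable rho by exact: scalar_measurable_midpoint.
(* [g] nearly attains the energy of the midpoint [rho]. *)
have [g hg] : exists g, ((e - r)%:E < mean_bracket rho g)%E.
  have : ((e - r)%:E < energy rho)%E.
    apply: lt_le_trans (minimal_energy_le mrho).
    by rewrite -[X in (_ < X)%E]fineK ?minimal_energy_fin_num// lte_fin gtrBl.
  by move=> /ereal_sup_gt[_ [g _ <-] h]; exists g.
pose S w := bracket (phi w - b g w) + bracket (psi w - b g w).
pose Q w := rnorm (phi w - psi w) ^+ 2 / S w ^+ 3.
have S2 w : 2 <= S w.
  by rewrite /S; have := bracket_ge1 (phi w - b g w); have := bracket_ge1 (psi w - b g w); lra.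
have S0 w : 0 < S w by apply: lt_le_trans (S2 w); lra.
have mphig := measurable_bracketB g mphi.
have mpsig := measurable_bracketB g mpsi.
have mrhog := measurable_bracketB g mrho.
have mS : measurable_fun setT S by exact: measurable_funD.
have md : measurable_fun setT (fun w => rnorm (phi w - psi w)).
  by apply: measurable_rnorm; exact: scalar_measurableB.
have mQ : measurable_fun setT Q.
  apply: measurable_funM; first exact: measurable_funX.
  rewrite (_ : (fun _ => _) = (fun w => S w `^ (- 3%:R))).
    by apply: (measurableT_comp (measurable_powR _)).
  by apply/funext => w; rewrite powR_invn// ltW.
have Q0 w : 0 <= Q w by rewrite divr_ge0 ?sqr_ge0 ?exprn_ge0// ltW.
have hS : (mean mu S <= (2 * (e + r))%:E)%E.
  rewrite /S meanD//; [|by move=> w; exact: bracket_ge0|by move=> w; exact: bracket_ge0].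
  rewrite mulr2n mulrDl mul1r EFinD leeD//.
    exact: le_trans (mean_bracket_le_energy _ g) Ephi.
  exact: le_trans (mean_bracket_le_energy _ g) Epsi.
have hQ : (mean mu Q <= (2 * r)%:E)%E.
  have : (mean mu Q + mean_bracket rho g <= (e + r)%:E)%E.
    rewrite /mean_bracket -meanD//; last by move=> w; exact: bracket_ge0.
    apply: (@le_trans _ _ (mean mu (fun w => 2^-1 * S w))).
      apply: mean_le.
      - exact: measurable_funD.
      - exact: measurable_funM.
      - by move=> w; rewrite addr_ge0// bracket_ge0.
      - move=> w; rewrite /Q /S /rho -midpointB.
        rewrite (_ : phi w - psi w = (phi w - b g w) - (psi w - b g w)).
          exact: bracket_midpoint.
        by rewrite opprB addrA subrK.
    rewrite meanZ//; last by move=> w; exact: ltW.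
    rewrite (_ : (e + r)%:E = 2^-1%:E * (2 * (e + r))%:E)%E.
      by rewrite lee_pmul2l// lte_fin invr_gt0.
    by rewrite -EFinM mulKf.
  move=> h; rewrite -(leeD2rE _ _ (_ : (e - r)%:E \is a fin_num))//.
  rewrite -EFinD (_ : 2 * r + (e - r) = e + r); last by ring.
  by apply: le_trans h; rewrite leeD2l// ltW.
apply: (@le_trans _ _ (mean mu (fun w => l ^- 3 * Q w + l * S w))).
  apply: mean_le.
  - apply: (@measurableT_comp _ _ _ _ _ _ (@Num.sqrt R)) => //.
    by apply: continuous_measurable_fun; exact: sqrt_continuous.
  - by apply: measurable_funD; exact: measurable_funM.
  - by move=> w; exact: sqrtr_ge0.
  - by move=> w; apply: sqrt_le_interpolation => //; exact: rnorm_ge0.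
have l3 : 0 < l ^- 3 by rewrite invr_gt0 exprn_gt0.
rewrite meanD//; first last.
- by move=> w; rewrite mulr_ge0// ltW.
- by move=> w; rewrite mulr_ge0// ltW.
- exact: measurable_funM.
- exact: measurable_funM.
rewrite !meanZ ?(ltW l0) ?(ltW l3)//; last by move=> w; exact: ltW.
rewrite EFinD leeD//.
  by rewrite mulrC EFinM lee_pmul2l.
rewrite (_ : 2 * l * (e + 1) = l * (2 * (e + 1))); last by ring.
rewrite [leRHS]EFinM lee_pmul2l//; apply: le_trans hS _.
by rewrite lee_fin ler_pM2l// lerD2l.
Qed.

Lemma near_minimal_eq phi psi : scalar_measurable phi -> scalar_measurable psi ->
  (forall r, 0 < r -> (energy phi <= (e + r)%:E)%E) ->
  (forall r, 0 < r -> (energy psi <= (e + r)%:E)%E) ->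
  \forall w \ae mu, phi w = psi w.
Proof.
move=> mphi mpsi Ephi Epsi.
have md : measurable_fun setT (fun w => Num.sqrt (rnorm (phi w - psi w))).
  apply: (@measurableT_comp _ _ _ _ _ _ (@Num.sqrt R)) => //.
    by apply: continuous_measurable_fun; exact: sqrt_continuous.
  by apply: measurable_rnorm; exact: scalar_measurableB.
have e0 := minimal_energy_ge0.
have : mean mu (fun w => Num.sqrt (rnorm (phi w - psi w))) = 0%E.
  apply/eqP; rewrite eq_le mean_ge0 ?andbT; last by move=> w; exact: sqrtr_ge0.
  apply/lee_addgt0Pr => x x0; rewrite add0e.
  (* [l] and [r] make both terms of [near_minimal_close] at most [x / 2]. *)
  pose l := x / (4 * (e + 1)).
  have l0 : 0 < l by rewrite divr_gt0// mulr_gt0// ltr_wpDl.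
  pose r := Num.min 1 (x / 4 * l ^+ 3).
  have r0 : 0 < r by rewrite lt_min ltr01 mulr_gt0 ?exprn_gt0// divr_gt0.
  have r1 : r <= 1 by rewrite ge_min lexx.
  have rr : 0 < r <= 1 by rewrite r0.
  apply: le_trans (near_minimal_close rr l0 mphi mpsi (Ephi r r0) (Epsi r r0)) _.
  rewrite lee_fin.
  have h1 : r * l ^- 3 <= x / 4.
    by rewrite ler_pdivrMr ?exprn_gt0// ge_min lexx orbT.
  have h2 : l * (e + 1) = x / 4.
    by rewrite /l; field; rewrite gt_eqF// ltr_wpDl.
  rewrite (_ : _ + _ = 2 * (r * l ^- 3) + 2 * (l * (e + 1))); last by ring.
  by rewrite h2; move: (r * _) h1 => q; lra.
move=> /(mean_eq0 md (fun w => sqrtr_ge0 _)); apply: filterS => w h.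
have : rnorm (phi w - psi w) = 0 by rewrite -[LHS]sqr_sqrtr ?rnorm_ge0// h expr0n.
by move=> /rnorm_eq0/eqP; rewrite subr_eq0 => /eqP.
Qed.

End center.

(** * Almost everywhere limits *)

Section almost_everywhere_limits.
Context (R : realType) (s : scalar_kind).
Context d (Omega : measurableType d) (mu : {finite_measure set Omega -> \bar R}).
Local Notation K := (scalars R s).

(** The sum of the series has finite mean, by monotone convergence. *)
Lemma ae_cvg_series (a : nat -> Omega -> R) (C : R) :
  (forall n, measurable_fun setT (a n)) -> (forall n w, 0 <= a n w) ->
  (forall n, (mean mu (a n) <= (C / 2 ^+ n)%:E)%E) ->
  \forall w \ae mu, cvgn (series (fun n => a n w)).
Proof.
move=> ma a0 aC.
have C0 : 0 <= C.
  by have := le_trans (mean_ge0 mu (a0 0)) (aC 0); rewrite expr0 divr1 lee_fin.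
have sum_half N : \sum_(0 <= n < N) C / 2 ^+ n = 2 * C - 2 * C / 2 ^+ N.
  elim: N => [|N IH]; first by rewrite big_geq// expr0 divr1 subrr.
  rewrite big_nat_recr//= IH exprS; field.
  by rewrite expf_neq0.
pose g w := (\sum_(0 <= n <oo) (a n w)%:E)%E.
have g0 w : (0 <= g w)%E by apply: nneseries_ge0 => n _ _; rewrite lee_fin.
have mg : measurable_fun setT g.
  apply: ge0_emeasurable_sum => [n w _ _|n _]; first by rewrite lee_fin.
  exact/measurable_EFinP.
have intg : (\int[mu]_w g w < +oo)%E.
  rewrite integral_nneseries//; last by move=> n w _; rewrite lee_fin.
    2: by move=> n; exact/measurable_EFinP.
  apply: (@le_lt_trans _ _ (2 * C)%:E); last by rewrite ltry.
  apply: lime_le; first by apply: is_cvg_nneseries => n _ _; exact: mean_ge0.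
  near=> N; apply: (@le_trans _ _ (\sum_(0 <= n < N) (C / 2 ^+ n)%:E)%E).
    by apply: lee_sum => n _; exact: aC.
  rewrite sumEFin lee_fin sum_half gerBl.
  by rewrite divr_ge0 ?exprn_ge0// mulr_ge0.
have /integrable_ae : mu.-integrable setT g.
  by apply/integrableP; split => //; under eq_integral do rewrite gee0_abs//.
move=> /(_ measurableT); apply: filterS => w /(_ I) gw.
apply: nondecreasing_is_cvgn.
  by apply/nondecreasing_seqP => n; rewrite seriesEnat /= big_nat_recr//= lerDl.
exists (fine (g w)) => _ [n _ <-].
rewrite -lee_fin fineK// seriesEnat /= -sumEFin.
by apply: nneseries_lim_ge => k _ _; rewrite lee_fin.
Unshelve. all: by end_near. Qed.

(** The terms [a n] are bounded by the sum of their series, so the increments are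
    dominated by a multiple of [a n]. *)
Lemma cvg_of_sqrt_increments (u : nat -> R) (a : nat -> R) :
  (forall n, 0 <= a n) -> (forall n, `|u n - u n.+1| <= a n ^+ 2) ->
  cvgn (series a) -> cvgn u.
Proof.
move=> a0 ua ca.
have a_le n : a n <= limn (series a).
  have nd : nondecreasing_seq (series a).
    by apply/nondecreasing_seqP => k; rewrite seriesEnat /= big_nat_recr//= lerDl.
  apply: le_trans (nondecreasing_cvgn_le nd ca n.+1).
  by rewrite seriesEnat /= big_nat_recr//= lerDr sumr_ge0.
have cd : cvgn (series (fun n => limn (series a) * a n)).
  rewrite (_ : series _ = (fun n => limn (series a) * series a n)).
    by apply: is_cvgMr.
  by apply/funext => n; rewrite /series /= big_distrr.
have ct : cvgn (series (telescope u)).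
  apply: normed_cvg; apply: series_le_cvg cd => n //=.
  - by rewrite mulr_ge0// (le_trans (a0 n)).
  - rewrite /telescope /= distrC; apply: le_trans (ua n) _.
    by rewrite expr2 ler_wpM2r.
rewrite (_ : u = (fun n => u 0%N + series (telescope u) n)).
  by apply: is_cvgD => //; exact: is_cvg_cst.
by apply/funext => n; rewrite -eq_sum_telescope.
Qed.

Lemma real_cvg_measurable (phi : nat -> Omega -> R) :
  (forall n, measurable_fun setT (phi n)) ->
  (\forall w \ae mu, cvgn (fun n => phi n w)) ->
  exists2 f : Omega -> R, measurable_fun setT f &
    \forall w \ae mu, phi n w @[n --> \oo] --> f w.
Proof.
move=> mphi [N [mN N0 hN]].
pose u w : R := \1_(~` N) w.
have mu_ : measurable_fun setT u by exact: measurable_indic (measurableC mN).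
have u1 w : ~ N w -> u w = 1 by move=> nN; rewrite /u indicE mem_set.
have uN w : N w -> u w = 0.
  by move=> Nw; rewrite /u indicE (_ : w \in ~` N = false)//; apply/negP; rewrite inE; exact.
have hN' w : ~ N w -> cvgn (fun n => phi n w).
  by move=> nN; apply: contrapT => h; apply: nN; exact: hN.
pose f w := limn (fun n => phi n w * u w).
have cf w : (fun n => phi n w * u w) @ \oo --> f w.
  have [/uN u0|nN] := pselect (N w).
    suff h : (fun n => phi n w * u w) @ \oo --> (0 : R) by rewrite /f (cvg_lim _ h).
    by rewrite u0; under eq_fun do rewrite mulr0; apply: cvg_cst.
  rewrite /f (u1 w nN) (_ : (fun n => _) = (fun n => phi n w)); first exact: hN'.
  by apply/funext => n; rewrite mulr1.
exists f.
  apply: (@measurable_fun_cvg _ _ _ _ (fun n w => phi n w * u w)) => //.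
  by move=> n; exact: measurable_funM.
exists N; split => // w /=; apply: contra_notP => nN.
have := cf w; rewrite (u1 w nN) (_ : (fun n => _) = (fun n => phi n w))//.
by apply/funext => n; rewrite mulr1.
Qed.

Lemma scalar_cvg_measurable (phi : nat -> Omega -> K) :
  (forall n, scalar_measurable (phi n)) ->
  (\forall w \ae mu, cvgn (fun n => sRe (phi n w))) ->
  (\forall w \ae mu, cvgn (fun n => sIm (phi n w))) ->
  exists2 f : Omega -> K, scalar_measurable f &
    \forall w \ae mu, (sRe (phi n w) @[n --> \oo] --> sRe (f w)) /\
      (sIm (phi n w) @[n --> \oo] --> sIm (f w)).
Proof.
move=> mphi cRe cIm.
have [fRe mRe hRe] := real_cvg_measurable (fun n => (mphi n).1) cRe.
have [fIm mIm hIm] : exists2 f : Omega -> R, measurable_fun setT f /\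
    (s = RealScalars -> forall w, f w = 0) &
    \forall w \ae mu, sIm (phi n w) @[n --> \oo] --> f w.
  have [s0|sC] := pselect (s = RealScalars).
    exists (fun=> 0) => //; apply: aeW => w.
    rewrite (_ : (fun n => _) = (fun=> 0)); first by apply: cvg_cst.
    by apply/funext => n; move: (phi n w); rewrite /sIm s0.
  have [f mf hf] := real_cvg_measurable (fun n => (mphi n).2) cIm.
  by exists f.
exists (fun w => mkscalar s (fRe w) (fIm w)).
  have [mI I0] := mIm; split; first by under eq_fun do rewrite sRe_mk.
  rewrite (_ : (fun _ => _) = fIm)//; apply/funext => w.
  by rewrite sIm_mk// => /I0.
apply: filterS2 hRe hIm => w h1 h2; rewrite sRe_mk sIm_mk//.
by move=> /mIm.2.
Qed.

Lemma cvg_rnormB (z : nat -> K) (l a : K) :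
  sRe (z n) @[n --> \oo] --> sRe l -> sIm (z n) @[n --> \oo] --> sIm l ->
  rnorm (z n - a) ^+ 2 @[n --> \oo] --> rnorm (l - a) ^+ 2.
Proof.
move=> hRe hIm; rewrite rnorm_sqr.
rewrite (_ : (fun n => _) = (fun n => (sRe (z n) - sRe a) ^+ 2 + (sIm (z n) - sIm a) ^+ 2)).
  rewrite sReB sImB !expr2; apply: cvgD; apply: cvgM; apply: cvgB => //; apply: cvg_cst.
by apply/funext => n; rewrite rnorm_sqr sReB sImB.
Qed.

Lemma cvg_bracketB (z : nat -> K) (l a : K) :
  sRe (z n) @[n --> \oo] --> sRe l -> sIm (z n) @[n --> \oo] --> sIm l ->
  bracket (z n - a) @[n --> \oo] --> bracket (l - a).
Proof.
move=> hRe hIm; rewrite /bracket.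
apply: (@cvg_comp _ _ _ (fun n => 1 + rnorm (z n - a) ^+ 2) (@Num.sqrt R)); last first.
  exact: sqrt_continuous.
by apply: cvgD; [apply: cvg_cst|exact: cvg_rnormB].
Qed.

End almost_everywhere_limits.

(** * L1-bounded cocycles are coboundaries *)

Section fixed_point.
Context (R : realType) (s : scalar_kind) (G : topologicalGroupType).
Context d (Omega : measurableType d) (mu : {finite_measure set Omega -> \bar R}).
Local Notation K := (scalars R s).
Variable T : G -> {mfun Omega >-> Omega}.
Hypothesis preserving : measure_preserving mu T.
Variables (chi b : G -> Omega -> K).
Hypothesis cb : l1_cocycle mu T chi b.
Variable M : R.
Hypothesis bM : forall g, (mean mu (fun w => rnorm (b g w)) <= M%:E)%E.
Local Notation e := (fine (minimal_energy mu b)).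

(** Near-minimizers up to [16^-n] form a sequence whose consecutive differences have
    square roots of mean [O(2^-n)], so it converges almost everywhere; by Fatou's
    lemma the limit is a minimizer. *)
Lemma minimizer_exists : exists2 f : Omega -> K, scalar_measurable f &
  (energy mu b f <= e%:E)%E.
Proof.
(* [near_minimal_close] with [l = 2^-n] needs [r n * l^-3 = 2^-n]. *)
pose r n : R := 16^-1 ^+ n.
have r0 n : 0 < r n by rewrite exprn_gt0// invr_gt0.
have r1 n : r n <= 1 by rewrite exprn_ile1// ?invr_ge0// invf_le1// ler1n.
have ex n := exists_near_minimal cb bM (r0 n).
pose phi n : Omega -> K := s2val (cid2 (ex n)).
have mphi n : scalar_measurable (phi n) by rewrite /phi; case: cid2.
have Ephi n : (energy mu b (phi n) <= (e + r n)%:E)%E by rewrite /phi; case: cid2.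
have rS m n : (m <= n)%N -> r n <= r m.
  by move=> mn; rewrite /r ler_wiXn2l// ?invr_ge0// invf_le1// ler1n.
pose a n w := Num.sqrt (rnorm (phi n w - phi n.+1 w)).
have ma n : measurable_fun setT (a n).
  apply: (@measurableT_comp _ _ _ _ _ _ (@Num.sqrt R)) => //.
    by apply: continuous_measurable_fun; exact: sqrt_continuous.
  by apply: measurable_rnorm; exact: scalar_measurableB.
have a0 n w : 0 <= a n w by exact: sqrtr_ge0.
have a_sqr n w : rnorm (phi n w - phi n.+1 w) = a n w ^+ 2.
  by rewrite sqr_sqrtr// rnorm_ge0.
have aC n : (mean mu (a n) <= ((2 + 2 * (e + 1)) / 2 ^+ n)%:E)%E.
  have l0 : 0 < (2 ^+ n)^-1 :> R by rewrite invr_gt0 exprn_gt0.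
  have rr : 0 < r n <= 1 by rewrite r0 r1.
  apply: le_trans (near_minimal_close cb bM rr l0 (mphi n) (mphi n.+1) (Ephi n) _) _.
    by apply: le_trans (Ephi n.+1) _; rewrite lee_fin lerD2l rS.
  rewrite lee_fin le_eqVlt; apply/orP; left; apply/eqP.
  have -> : r n = ((2 ^+ n)^-1) ^+ 4.
    by rewrite /r !exprVn -exprM mulnC exprM; congr (_ ^- _); ring.
  have : 2 ^+ n != 0 :> R by rewrite expf_neq0.
  by move: (2 ^+ n) => x x0; field.
have cvga := ae_cvg_series ma a0 aC.
have cRe : \forall w \ae mu, cvgn (fun n => sRe (phi n w)).
  apply: filterS cvga => w; apply: cvg_of_sqrt_increments => // n.
  by rewrite -a_sqr -sReB; exact: ler_norm_sRe.
have cIm : \forall w \ae mu, cvgn (fun n => sIm (phi n w)).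
  apply: filterS cvga => w; apply: cvg_of_sqrt_increments => // n.
  by rewrite -a_sqr -sImB; exact: ler_norm_sIm.
have [f mf hf] := scalar_cvg_measurable mphi cRe cIm.
exists f => //; apply: ge_ereal_sup => _ [g _ <-].
apply/lee_addgt0Pr => x x0; rewrite -EFinD.
have [k hk] : exists k, r k < x.
  have : r n @[n --> \oo] --> (0 : R).
    by apply: cvg_expr; rewrite ger0_norm ?invr_ge0// invf_lt1// ltr1n.
  move=> /cvgrPdist_lt /(_ x x0)[k _ hk]; exists k; have := hk k (leqnn k).
  by rewrite /= sub0r normrN gtr0_norm.
apply: (@mean_fatou _ _ _ mu (fun n w => bracket (phi (n + k)%N w - b g w))).
- by move=> n; exact: (measurable_bracketB cb g (mphi (n + k)%N)).
- exact: (measurable_bracketB cb g mf).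
- by move=> n w; exact: bracket_ge0.
- by move=> w; exact: bracket_ge0.
- apply: filterS hf => w [h1 h2].
  apply: (@cvg_bracketB _ _ (fun n => phi (n + k)%N w)).
    by apply: (cvg_comp (fun n => (n + k)%N) (fun n => sRe (phi n w)) (cvg_addnr k) h1).
  by apply: (cvg_comp (fun n => (n + k)%N) (fun n => sIm (phi n w)) (cvg_addnr k) h2).
- move=> n; apply: le_trans (mean_bracket_le_energy mu b _ g) _.
  apply: le_trans (Ephi _) _; rewrite lee_fin lerD2l (le_trans _ (ltW hk))//.
  by rewrite rS// leq_addl.
Qed.

Definition affine_translate g (f : Omega -> K) : Omega -> K :=
  fun w => twisted_translate T chi g f w + b g w.

Lemma scalar_measurableM (f g : Omega -> K) : scalar_measurable f -> scalar_measurable g ->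
  scalar_measurable (fun w => f w * g w).
Proof.
move=> [mf1 mf2] [mg1 mg2]; split.
  by under eq_fun do rewrite sReM; apply: measurable_funB; exact: measurable_funM.
by under eq_fun do rewrite sImM; apply: measurable_funD; exact: measurable_funM.
Qed.

Lemma scalar_measurable_affine g f : scalar_measurable f ->
  scalar_measurable (affine_translate g f).
Proof.
move=> mf; apply: scalar_measurableD; last exact: cocycle_meas cb g.
apply: scalar_measurableM; first exact: multiplier_meas cb g.
exact: (scalar_measurable_comp T).
Qed.

Lemma energy_affine g f : scalar_measurable f ->
  (energy mu b (affine_translate g f) <= energy mu b f)%E.
Proof.
move=> mf; apply: ge_ereal_sup => _ [a _ <-].
apply: le_trans (mean_bracket_le_energy mu b f (g^-1 * a)%g).
have mfb := measurable_bracketB cb (g^-1 * a)%g mf.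
rewrite /mean_bracket -(mean_comp preserving g^-1%g mfb); last first.
  by move=> w; exact: bracket_ge0.
apply: mean_ae_le.
- exact: (measurable_bracketB cb a (scalar_measurable_affine g mf)).
- by apply: (measurableT_comp mfb).
- by move=> w; exact: bracket_ge0.
- by move=> w; exact: bracket_ge0.
have := multiplier_unimodular cb g; have := cocycle_eq cb g (g^-1 * a)%g.
rewrite mulgA mulgV mul1g; apply: filterS2 => w hb h1.
rewrite (_ : _ - b a w = chi g w * (f (T g^-1%g w) - b (g^-1 * a)%g (T g^-1%g w))).
  by rewrite /bracket rnormM h1 mul1r.
by rewrite hb /affine_translate /twisted_translate; ring.
Qed.

(** The affine action does not increase the energy, so it sends a minimizer to a
    minimizer, and these agree almost everywhere.  The energy of [0] bounds the
    L1 norm of the minimizer. *)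
Theorem coboundary_of_bounded : exists2 f : Omega -> K,
  scalar_measurable f /\ (mean mu (fun w => rnorm (f w)) <= (fine (mu setT) + M)%:E)%E &
  forall g, \forall w \ae mu, b g w = f w - twisted_translate T chi g f w.
Proof.
have [f mf Ef] := minimizer_exists; exists f; first split => //.
  have ef0 : (energy mu b f <= (fine (mu setT) + M)%:E)%E.
    apply: le_trans Ef _; rewrite fineK ?(minimal_energy_fin_num cb bM)//.
    apply: le_trans (energy0 cb bM).
    by apply: minimal_energy_le; exact: scalar_measurable_cst.
  apply: le_trans ef0; apply: le_trans (mean_bracket_le_energy mu b f 1%g).
  apply: mean_ae_le.
  - exact: measurable_rnorm.
  - exact: (measurable_bracketB cb _ mf).
  - by move=> w; exact: rnorm_ge0.
  - by move=> w; exact: bracket_ge0.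
  by have := cocycle1_eq0 preserving cb; apply: filterS => w ->; rewrite subr0 rnorm_le_bracket.
move=> g; have := near_minimal_eq cb bM mf (scalar_measurable_affine g mf).
have le_e h x : (energy mu b h <= e%:E)%E -> 0 < x -> (energy mu b h <= (e + x)%:E)%E.
  by move=> he x0; apply: le_trans he _; rewrite lee_fin lerDl ltW.
move=> /(_ (fun x => le_e _ x Ef) (fun x => le_e _ x (le_trans (energy_affine g mf) Ef))).
by apply: filterS => w {1}->; rewrite /affine_translate addrAC subrr add0r.
Qed.

End fixed_point.

(** * Ergodicity and Lp representatives *)

Section ergodicity.
Context (R : realType) (G : topologicalGroupType).
Context d (Omega : measurableType d) (mu : {finite_measure set Omega -> \bar R}).
Variable T : G -> {mfun Omega >-> Omega}.
Hypothesis ergodicT : ergodic mu T.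

(** The sets [h > q] are invariant, hence null or conull; the constant is the supremum of
    the [q] for which they are conull. *)
Lemma ergodic_constant (h : Omega -> R) : measurable_fun setT h ->
  (forall g, \forall w \ae mu, h (T g^-1%g w) = h w) ->
  exists a, \forall w \ae mu, h w = a.
Proof.
move=> mh inv.
have mA q : measurable [set w | q < h w].
  have := mh measurableT `]q, +oo[%classic (measurable_itv _).
  by rewrite setTI; congr measurable; apply/seteqP; split => w /=; rewrite in_itv/= andbT.
have dich q : mu [set w | q < h w] = 0%E \/ mu (~` [set w | q < h w]) = 0%E.
  apply: ergodicT => // g.
  have [N [mN N0 hN]] := inv g.
  apply: (subset_measure0 _ mN _ N0).
    apply: measurableU; apply: measurableD => //; exact: mfun_preimage_measurable.
  move=> w /= hw; apply: hN => /= E; move: hw; rewrite /= E.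
  by move=> [[]|[]].
have [m0|m0] := eqVneq (mu setT) 0%E.
  by exists 0; exists setT; split.
pose S := [set q : R | mu (~` [set w | q < h w]) = 0%E].
have nS q : ~ S q -> mu [set w | q < h w] = 0%E by move=> nSq; case: (dich q).
have negl q : mu [set w | q < h w] = 0%E -> \forall w \ae mu, h w <= q.
  move=> q0; exists [set w | q < h w]; split => // w /= /negP; by rewrite -ltNge.
have neglS q : S q -> \forall w \ae mu, q < h w.
  by move=> q0; exists (~` [set w | q < h w]); split => //; exact: measurableC.
have absurd (P : Omega -> Prop) : (\forall w \ae mu, P w) -> (forall w, ~ P w) -> False.
  move=> [N [mN N0 hN]] nP; move/eqP: m0; apply.
  by apply: (subset_measure0 measurableT mN _ N0) => w _; apply: hN; exact: nP.
have S0 : S !=set0.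
  apply: contrapT => nS0.
  have : \forall w \ae mu, forall n : nat, h w <= - n%:R.
    by apply/ae_foralln => n; apply/negl/nS => Sn; apply: nS0; exists (- n%:R).
  move=> /absurd; apply => w hw.
  have := hw (Num.truncn `|h w|).+1; rewrite lerNr leNgt => /negP; apply.
  by apply: le_lt_trans (truncnS_gt _); rewrite -normrN ler_norm.
have Sub : has_ubound S.
  apply: contrapT => nub.
  have : \forall w \ae mu, forall n : nat, n%:R < h w.
    apply/ae_foralln => n; have [q [Sq nq]] : exists q, S q /\ n%:R < q.
      apply: contrapT => nex; apply: nub; exists n%:R => q Sq.
      by rewrite leNgt; apply/negP => nq; apply: nex; exists q.
    by apply: filterS (neglS q Sq) => w; exact: lt_trans.
  move=> /absurd; apply => w hw.
  have := hw (Num.truncn `|h w|).+1; apply/negP; rewrite -leNgt.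
  by apply: le_trans (ltW (truncnS_gt _)); exact: ler_norm.
exists (sup S).
have up : \forall w \ae mu, forall n : nat, h w <= sup S + n.+1%:R^-1.
  apply/ae_foralln => n; apply/negl/nS => Sn.
  have := ub_le_sup Sub Sn; apply/negP; rewrite -ltNge ltrDl.
  by rewrite invr_gt0.
have low : \forall w \ae mu, forall n : nat, sup S - n.+1%:R^-1 < h w.
  apply/ae_foralln => n.
  have n0 : 0 < n.+1%:R^-1 :> R by rewrite invr_gt0.
  have [q Sq hq] := sup_adherent n0 (conj S0 Sub).
  by apply: filterS (neglS q Sq) => w; exact: lt_trans.
apply: filterS2 up low => w h1 h2; apply/eqP; rewrite eq_le; apply/andP; split.
  apply/ler_addgt0Pr => x x0; have [n hn] := exists_natSinv_lt x0.
  by apply: le_trans (h1 n) _; rewrite lerD2l ltW.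
apply/ler_addgt0Pr => x x0; have [n hn] := exists_natSinv_lt x0.
by move: (h2 n) hn; move: (n.+1%:R^-1) => y; lra.
Qed.

End ergodicity.

Section Lp_conversions.
Context (R : realType) (s : scalar_kind).
Context d (Omega : measurableType d) (mu : {finite_measure set Omega -> \bar R}).
Context (p : R) (p1 : 1 <= p).
Local Notation K := (scalars R s).
Local Notation LP := (Lp s mu p1).
Implicit Types (u v : LP).

Let p0 : 0 < p. Proof. exact: lt_le_trans p1. Qed.

Lemma Lp_repr_measurable u : scalar_measurable (Lp_repr u).
Proof. exact: Lp_function_measurable. Qed.

Lemma Lp_reprK u : \pi_(seminorm_quotient (Lp_seminorm s mu p1))
  (repr (u : seminorm_quotient (Lp_seminorm s mu p1))) = u.
Proof. exact: reprK. Qed.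

Lemma Lp_repr_pi (f : Lp_function s mu p1) : \forall w \ae mu,
  Lp_repr (\pi_(seminorm_quotient (Lp_seminorm s mu p1)) f : LP) w = f w.
Proof.
have := Lp_reprK (\pi_(seminorm_quotient (Lp_seminorm s mu p1)) f : LP).
by move=> /Lp_eqP; apply: filterS => w /(_ I).
Qed.

Lemma Lp_reprD u v : \forall w \ae mu, Lp_repr (u + v) w = Lp_repr u w + Lp_repr v w.
Proof.
have := Lp_repr_pi (repr (u : seminorm_quotient (Lp_seminorm s mu p1))
  + repr (v : seminorm_quotient (Lp_seminorm s mu p1))).
by rewrite seminorm_quotient_piD !Lp_reprK.
Qed.

Lemma Lp_reprB u v : \forall w \ae mu, Lp_repr (u - v) w = Lp_repr u w - Lp_repr v w.
Proof.
have := Lp_reprD (u - v) v; rewrite subrK.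
by apply: filterS => w ->; rewrite addrK.
Qed.

Lemma measurable_powR_comp (f : Omega -> R) (q : R) : measurable_fun setT f ->
  measurable_fun setT (fun w => f w `^ q).
Proof. by move=> mf; apply: (measurableT_comp (measurable_powR q)). Qed.

Lemma norm_p_powR (f : Omega -> K) :
  (norm_p mu p f `^ p = mean mu (fun w => (rnorm (f w) `^ p)%R))%E.
Proof.
rewrite /norm_p poweR_Lnorm; last by rewrite gt_eqF.
apply: eq_integral => w _.
by rewrite abse_EFin ger0_norm ?rnorm_ge0.
Qed.

Lemma mean_powR_Lp u :
  mean mu (fun w => rnorm (Lp_repr u w) `^ p) = ((rnorm u) `^ p)%:E.
Proof.
rewrite -norm_p_powR -[in RHS](Lp_reprK u) /rnorm norm_pi of_realK.
rewrite -poweR_EFin; congr (_ `^ _)%E.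
by rewrite /= fineK// norm_p_fin_num.
Qed.

Lemma bounded_in_Lp (f : Omega -> K) (B : R) : scalar_measurable f ->
  (forall w, rnorm (f w) <= B) ->
  exists u : LP, \forall w \ae mu, Lp_repr u w = f w.
Proof.
move=> mf fB.
have fin : (norm_p mu p f < +oo)%E.
  have h : mean mu (fun w => rnorm (f w) `^ p) \is a fin_num.
    apply: (@mean_bounded _ _ _ _ _ (B `^ p)).
    - exact/measurable_powR_comp/measurable_rnorm.
    - by move=> w; exact: powR_ge0.
    - move=> w; apply: ge0_ler_powR; rewrite ?nnegrE ?rnorm_ge0 ?(ltW p0)//.
      exact: le_trans (rnorm_ge0 _) (fB w).
  move: h; rewrite -norm_p_powR; case: (norm_p mu p f) (Lnorm_ge0 mu p%:E (fun w => (rnorm (f w))%:E)) => [r|//|//] _.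
    by rewrite ltry.
  by rewrite poweRyr ?gt_eqF.
have fp : f \in @p_integrable R s d Omega mu p p1 by apply/p_integrableP.
by exists (\pi_(seminorm_quotient (Lp_seminorm s mu p1)) (LpFunction fp)); exact: Lp_repr_pi.
Qed.

(** If [x > eta] then [x = x^p x^(1-p) <= x^p eta^(1-p)].  On a finite measure space, this
    makes convergence in [L_p] imply convergence in L1. *)
Lemma le_add_powR (x eta : R) : 0 <= x -> 0 < eta ->
  x <= eta + eta `^ (1 - p) * x `^ p.
Proof.
move=> x0 e0; have [h|h] := leP x eta.
  by apply: le_trans h _; rewrite lerDl mulr_ge0// powR_ge0.
have {}x0 : 0 < x by apply: lt_trans h.
apply: ler_wpDl; first exact: ltW.
have -> : x `^ p = x * x `^ (p - 1).
  by rewrite -{2}(powRr1 (ltW x0)) -powRD ?gt_eqF ?implybT// addrC subrK.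
rewrite mulrCA ler_peMr ?(ltW x0)//.
rewrite -opprB powRN mulrC ler_pdivlMr ?powR_gt0// mul1r.
by apply: ge0_ler_powR; rewrite ?nnegrE ?subr_ge0// ltW.
Qed.

Lemma mean_rnorm_Lp_le u (eta : R) : 0 < eta ->
  (mean mu (fun w => rnorm (Lp_repr u w)) <=
    (eta * fine (mu setT) + eta `^ (1 - p) * rnorm u `^ p)%:E)%E.
Proof.
move=> e0; have mr := measurable_rnorm (Lp_repr_measurable u).
have mrp := measurable_powR_comp p mr.
apply: (@le_trans _ _ (mean mu (fun w => eta + eta `^ (1 - p) * rnorm (Lp_repr u w) `^ p))).
  apply: mean_le => //.
  - by apply: measurable_funD => //; exact: measurable_funM.
  - by move=> w; exact: rnorm_ge0.
  - by move=> w; apply: le_add_powR => //; exact: rnorm_ge0.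
rewrite meanD//; last 3 first.
- exact: measurable_funM.
- by move=> w; exact: ltW.
- by move=> w; rewrite mulr_ge0 ?powR_ge0.
rewrite mean_cst meanZ ?powR_ge0//; last by move=> w; exact: powR_ge0.
by rewrite mean_powR_Lp EFinD !EFinM fineK ?fin_num_measure.
Qed.

Lemma Lp_cvg_mean (G : topologicalType) (F : G -> LP) (g : G) (e : R) :
  {for g, continuous F} -> 0 < e ->
  \forall h \near g, (mean mu (fun w => rnorm (Lp_repr (F h - F g)%R w)) < e%:E)%E.
Proof.
move=> cF e0; set m := fine (mu setT).
have m0 : 0 <= m by rewrite fine_ge0.
pose eta := e / 2 / (m + 1).
have m1 : 0 < m + 1 by rewrite ltr_wpDl.
have eta0 : 0 < eta by rewrite !divr_gt0.
have q0 : 0 < eta `^ (1 - p) by exact: powR_gt0.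
pose t := (e / 3 / eta `^ (1 - p)) `^ p^-1.
have t0 : 0 < t by rewrite powR_gt0// !divr_gt0.
have : \forall h \near g, rnorm (F h - F g) < t.
  move/cvg_ballP : cF => /(_ (of_real s t)); rewrite of_real_gt0 => /(_ t0).
  by apply: filterS => h /ball_rnorm; rewrite rnorm_distC.
apply: filterS => h ht; apply: le_lt_trans (mean_rnorm_Lp_le _ eta0) _.
rewrite lte_fin -/m.
have h1 : eta * m <= e / 2.
  rewrite /eta -mulrA ler_piMr ?divr_ge0 ?(ltW e0)//.
  by rewrite mulrC ler_pdivrMr// mul1r lerDl.
have h2 : eta `^ (1 - p) * rnorm (F h - F g) `^ p <= e / 3.
  rewrite mulrC -ler_pdivlMr//; apply: (@le_trans _ _ (t `^ p)).
    by apply: ge0_ler_powR; rewrite ?nnegrE ?rnorm_ge0 ?(ltW p0) ?(ltW t0) ?(ltW ht).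
  by rewrite -powRrM mulVf ?gt_eqF// powRr1// ltW// !divr_gt0.
lra.
Qed.

End Lp_conversions.

(** * Measure preserving Banach-Lamperti actions *)

Lemma ler_rnorm_dist (R : realType) (s : scalar_kind)
  (U : normedZmodType (scalars R s)) (u v : U) : `|rnorm u - rnorm v| <= rnorm (u - v).
Proof.
have le x y : rnorm x - rnorm y <= rnorm (x - y : U).
  by rewrite lerBlDr -{1}(subrK y x) ler_rnormD.
rewrite ler_norml le andbT lerNl opprB rnorm_distC; exact: le.
Qed.

Section preserving_actions.
Context (R : realType) (s : scalar_kind) (G : topologicalGroupType).
Context d (Omega : measurableType d) (mu : {finite_measure set Omega -> \bar R}).
Context (p : R) (p1 : 1 <= p).
Local Notation K := (scalars R s).
Local Notation LP := (Lp s mu p1).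
Variables (pi : linear_isometric_action G LP).
Variables (T : G -> {mfun Omega >-> Omega}) (chi : G -> Omega -> K).
Hypothesis BL : is_BL_action pi T chi.
Hypothesis preserving : measure_preserving mu T.

Let p0 : 0 < p. Proof. exact: lt_le_trans p1. Qed.

Lemma Radon_Nikodym_preserving g :
  \forall w \ae mu, Radon_Nikodym (image_charge mu (T g)) mu w = 1%E.
Proof.
have dom : image_charge mu (T g) `<< mu.
  move=> A A0 E mE EA; rewrite -[LHS]/(mu (T g @^-1` E)) preserving//.
  exact: A0.
have : ae_eq mu setT (Radon_Nikodym (image_charge mu (T g)) mu) (cst 1%E).
  apply: integral_ae_eq => //; first exact: Radon_Nikodym_integrable.
  move=> E _ mE; rewrite -Radon_Nikodym_integral// integral_cst// mul1e.
  exact: preserving.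
by apply: filterS => w /(_ I).
Qed.

Lemma BL_translate g (u : LP) :
  \forall w \ae mu, Lp_repr (pi g u) w = twisted_translate T chi g (Lp_repr u) w.
Proof.
have := BL_formula BL g u; have := Radon_Nikodym_preserving g.
apply: filterS2 => w h1 /(_ I) ->; rewrite h1 /= powR1.
by rewrite (_ : of_real s 1 = 1) ?mulr1//; case: (s).
Qed.

Lemma BL_rnorm1 g : \forall w \ae mu, rnorm (chi g w) = 1.
Proof. by have := BL_unimodular BL g; apply: filterS => w h; rewrite /rnorm h sRe1. Qed.

Lemma point_map_translateM g h : \forall w \ae mu, T (g * h)^-1%g w = T h^-1%g (T g^-1%g w).
Proof.
by rewrite invgM; have := BL_actionM BL h^-1%g g^-1%g; apply: filterS => w /(_ I).
Qed.

Lemma Lp_l1_cocycle (b : G -> LP) : cocycle pi b ->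
  l1_cocycle mu T chi (fun g => Lp_repr (b g)).
Proof.
move=> [cb bM]; split.
- by move=> g; exact: Lp_repr_measurable.
- exact: BL_measurable BL.
- exact: BL_rnorm1.
- move=> g h; rewrite bM.
  have := Lp_reprD (b g) (pi g (b h)); have := BL_translate g (b h).
  by apply: filterS2 => w -> ->.
- move=> g; apply: le_lt_trans (mean_rnorm_Lp_le (b g) ltr01) _.
  by rewrite ltry.
- move=> g e e0; have := Lp_cvg_mean (cb g) e0.
  apply: filterS => h; apply: le_lt_trans; apply: mean_ae_le.
  + by apply: measurable_rnorm; apply: scalar_measurableB; exact: Lp_repr_measurable.
  + exact/measurable_rnorm/Lp_repr_measurable.
  + by move=> w; exact: rnorm_ge0.
  + by move=> w; exact: rnorm_ge0.
  + by have := Lp_reprB (b h) (b g); apply: filterS => w ->.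
Qed.

Section coboundary.
Variables (h : Omega -> R) (B : R).
Hypothesis mh : measurable_fun setT h.
Hypothesis h0 : forall w, 0 <= h w.
Hypothesis hB : forall w, h w <= B.

(** The coboundary of [h] for the action without multiplier. *)
Definition translate_defect (g : G) (w : Omega) : K := of_real s (h (T g^-1%g w) - h w).

Let mhT g : measurable_fun setT (fun w => h (T g w)).
Proof. exact: (measurableT_comp mh). Qed.

Let h_in_Lp : exists u : LP, \forall w \ae mu, Lp_repr u w = of_real s (h w).
Proof.
apply: (@bounded_in_Lp _ _ _ _ mu p p1 _ B).
  split; first by under eq_fun do rewrite of_realK.
  by under eq_fun do rewrite sIm_of_real; exact: measurable_cst.
by move=> w; rewrite rnorm_real ger0_norm.
Qed.

Let scalar_measurable_real (f : Omega -> R) : measurable_fun setT f ->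
  scalar_measurable (fun w => of_real s (f w)).
Proof.
split; first by under eq_fun do rewrite of_realK.
by under eq_fun do rewrite sIm_of_real; exact: measurable_cst.
Qed.

(** Strong continuity of translations is only known for the action twisted by [chi].  As
    [h] is nonnegative, its translate by [g] is the modulus of [pi g h], and taking
    moduli is 1-Lipschitz. *)
Lemma translate_defect_l1_cocycle : l1_cocycle mu T (fun _ _ => 1) translate_defect.
Proof.
split.
- by move=> g; apply: scalar_measurable_real; exact: measurable_funB.
- by move=> g; exact: scalar_measurable_cst.
- by move=> g; apply: aeW => w; rewrite /rnorm normr1 sRe1.
- move=> g k; have := point_map_translateM g k; apply: filterS => w hw.
  rewrite /translate_defect /twisted_translate mul1r -of_realD hw; congr of_real.
  by ring.
- move=> g; rewrite ltey_eq (@mean_bounded _ _ _ _ _ (B + B))//.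
  + apply: measurable_rnorm; apply: scalar_measurable_real; exact: measurable_funB.
  + by move=> w; exact: rnorm_ge0.
  + move=> w; rewrite rnorm_real; apply: le_trans (ler_normB _ _) _.
    by rewrite !ger0_norm// lerD.
move=> g e e0; have [u hu] := h_in_Lp.
have := Lp_cvg_mean (@action_continuous _ _ _ _ pi u g) e0.
apply: filterS => k; apply: le_lt_trans; apply: mean_ae_le.
- apply: measurable_rnorm; apply: scalar_measurableB;
  by apply: scalar_measurable_real; exact: measurable_funB.
- exact/measurable_rnorm/Lp_repr_measurable.
- by move=> w; exact: rnorm_ge0.
- by move=> w; exact: rnorm_ge0.
have E a : \forall w \ae mu, rnorm (Lp_repr (pi a u) w) = h (T a^-1%g w).
  have := BL_translate a u; have := BL_rnorm1 a; have := ae_comp preserving a^-1%g hu.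
  apply: filterS3 => w hw h1 ->; rewrite rnormM h1 mul1r hw rnorm_real.
  by rewrite ger0_norm.
have := Lp_reprB (pi k u) (pi g u); have := E k; have := E g.
apply: filterS3 => w h1 h2 ->.
rewrite /translate_defect (_ : _ - _ = of_real s (h (T k^-1%g w) - h (T g^-1%g w))).
  rewrite rnorm_real -h1 -h2; set a := Lp_repr _ w; set c := Lp_repr _ w.
  exact: ler_rnorm_dist.
apply: scalar_eq; rewrite ?(sReB, sImB, of_realK, sIm_of_real); ring.
Qed.

End coboundary.

End preserving_actions.

(** With [(1 - eta)^p = 1 - delta]: if [u <= v] and [v - u <= eta v] then
    [u^p >= (1 - delta) v^p]; otherwise [v^p <= eta^-p (v - u)^p]. *)
Lemma powR_sub_le (R : realType) (p delta : R) : 0 < p -> 0 < delta < 1 ->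
  exists2 C : R, 0 <= C & forall u v : R, 0 <= u -> 0 <= v ->
    `|u `^ p - v `^ p| <= delta * (u `^ p + v `^ p) + C * `|u - v| `^ p.
Proof.
move=> p0 /andP[d0 d1].
pose eta := 1 - (1 - delta) `^ p^-1.
have r1 : (1 - delta) `^ p^-1 < 1.
  apply: (@lt_le_trans _ _ (1 `^ p^-1)); last by rewrite powR1.
  apply: gt0_ltr_powR; rewrite ?invr_gt0// ?nnegrE; lra.
have eta0 : 0 < eta by rewrite subr_gt0.
exists (eta `^ (- p)); first exact: powR_ge0.
have key u v : 0 <= u -> u <= v ->
    v `^ p - u `^ p <= delta * v `^ p + eta `^ (- p) * (v - u) `^ p.
  move=> u0 uv; have v0 : 0 <= v by exact: le_trans uv.
  have [h|/ltW h] := leP (v - u) (eta * v).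
    have : (1 - delta) * v `^ p <= u `^ p.
      have : ((1 - eta) * v) `^ p <= u `^ p.
        apply: ge0_ler_powR; rewrite ?nnegrE ?(ltW p0)//.
          by rewrite mulr_ge0// /eta subKr powR_ge0.
        by lra.
      rewrite powRM//; last by rewrite /eta subKr powR_ge0.
      by rewrite /eta subKr -powRrM mulVf ?gt_eqF// powRr1//; lra.
    have : 0 <= eta `^ (- p) * (v - u) `^ p by rewrite mulr_ge0 ?powR_ge0.
    by lra.
  have : v `^ p <= eta `^ (- p) * (v - u) `^ p.
    rewrite powRN mulrC ler_pdivlMr ?powR_gt0// -powRM ?(ltW eta0)//.
    by rewrite [v * eta]mulrC; apply: ge0_ler_powR;
      rewrite ?nnegrE ?(ltW p0) ?mulr_ge0 ?subr_ge0 ?(ltW eta0) ?(ltW r1)//.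
  have := powR_ge0 u p; have : 0 <= delta * v `^ p by rewrite mulr_ge0 ?powR_ge0// ltW.
  by lra.
move=> u v u0 v0; wlog uv : u v u0 v0 / u <= v.
  move=> H; have [/H|/ltW vu] := leP u v; first exact.
  by rewrite distrC [u `^ p + _]addrC (distrC u); exact: H.
have uvp : u `^ p <= v `^ p by apply: ge0_ler_powR; rewrite ?nnegrE ?(ltW p0).
rewrite distrC (distrC u) !ger0_norm ?subr_ge0//.
apply: le_trans (key u v u0 uv) _; rewrite lerD2r ler_pM2l// lerDr.
exact: powR_ge0.
Qed.

(** * Integrability of the primitive *)

Lemma compact_rnorm_bounded (R : realType) (s : scalar_kind) (G : topologicalType)
    (X : normedModType (scalars R s)) (b : G -> X) (C : set G) :
  continuous b -> compact C -> exists2 B : R, 0 <= B & forall g, C g -> rnorm (b g) <= B.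
Proof.
move=> cb cC.
have cr : continuous (fun g => rnorm (b g)).
  move=> g; apply/cvgrPdist_lt => e e0.
  have /cvg_ballP/(_ (of_real s e)) := cb g; rewrite of_real_gt0 => /(_ e0).
  by apply: filterS => h /ball_rnorm; apply: le_lt_trans; exact: ler_rnorm_dist.
have := compact_bounded (continuous_compact (continuous_subspaceT cr) cC).
move=> [B [_ hB]]; exists (`|B| + 1); first by rewrite addr_ge0.
have B1 : B < `|B| + 1 by rewrite (le_lt_trans (ler_norm B))// ltrDl.
move=> g Cg; apply: le_trans (ler_norm _) _.
by apply: (hB _ B1); exists g.
Qed.

Section primitive.
Context (R : realType) (s : scalar_kind) (G : topologicalGroupType).
Context d (Omega : measurableType d) (mu : {finite_measure set Omega -> \bar R}).
Context (p : R) (p1 : 1 <= p).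
Local Notation K := (scalars R s).
Local Notation LP := (Lp s mu p1).
Variables (pi : linear_isometric_action G LP).
Variables (T : G -> {mfun Omega >-> Omega}) (chi : G -> Omega -> K) (b : G -> LP).
Hypothesis propT : property_T R s G.
Hypothesis BL : is_BL_action pi T chi.
Hypothesis ergodicT : ergodic mu T.
Hypothesis preserving : measure_preserving mu T.
Hypothesis cb : cocycle pi b.

Let p0 : 0 < p. Proof. exact: lt_le_trans p1. Qed.
Local Notation m := (fine (mu setT)).

Let m0 : 0 <= m. Proof. by rewrite fine_ge0. Qed.

(** On a compact set, [b] is bounded in [L_p], hence in L1. *)
Lemma L1_primitive : exists2 f : Omega -> K,
  scalar_measurable f /\ (mean mu (fun w => rnorm (f w)) < +oo)%E &
  forall g, \forall w \ae mu, Lp_repr (b g) w = f w - twisted_translate T chi g f w.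
Proof.
have c1 := Lp_l1_cocycle BL preserving cb.
have [C cC [c c0 hc]] := cocycle_uniform_bound preserving (fun _ : unit => c1) propT.
have [B B0 hB] := compact_rnorm_bounded cb.1 cC.
have bounded g := hc tt (m + B `^ p) _ _ g.
have [|f [mf ff] hf] := @coboundary_of_bounded _ _ _ _ _ mu T preserving chi
  (fun g => Lp_repr (b g)) c1 (m + c * (m + B `^ p)).
- move=> g; apply: bounded; first by rewrite addr_ge0 ?powR_ge0.
  move=> k Ck; apply: le_trans (mean_rnorm_Lp_le (b k) ltr01) _.
  rewrite lee_fin mul1r powR1 mul1r lerD2l.
  by apply: ge0_ler_powR; rewrite ?nnegrE ?rnorm_ge0 ?(ltW p0)// hB.
by exists f => //; split => //; apply: le_lt_trans ff _; rewrite ltry.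
Qed.

Section truncation.
Variable f : Omega -> K.
Hypothesis mf : scalar_measurable f.
Hypothesis intf : (mean mu (fun w => rnorm (f w)) < +oo)%E.
Hypothesis primitive :
  forall g, \forall w \ae mu, Lp_repr (b g) w = f w - twisted_translate T chi g f w.

Definition truncation (N : nat) (w : Omega) : R := Num.min (rnorm (f w)) N%:R.
Definition truncated_power N w : R := truncation N w `^ p.

Lemma truncation_ge0 N w : 0 <= truncation N w.
Proof. by rewrite le_min rnorm_ge0 ler0n. Qed.

Lemma measurable_truncated_power N : measurable_fun setT (truncated_power N).
Proof.
apply: measurable_powR_comp; apply: measurable_minr => //.
exact: measurable_rnorm.
Qed.

Lemma truncated_power_ge0 N w : 0 <= truncated_power N w.
Proof. exact: powR_ge0. Qed.

Lemma truncated_power_le N w : truncated_power N w <= N%:R `^ p.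
Proof.
apply: ge0_ler_powR; rewrite ?nnegrE ?truncation_ge0 ?ler0n ?(ltW p0)//.
by rewrite ge_min lexx orbT.
Qed.

Local Notation h := truncated_power.

Lemma truncation_dist N (x y : R) : `|Num.min x N%:R - Num.min y N%:R| <= `|x - y|.
Proof.
wlog xy : x y / x <= y.
  by move=> H; have [/H//|/ltW /H] := leP x y; rewrite distrC (distrC y).
have mxy : Num.min x N%:R <= Num.min y N%:R :> R by rewrite le_min !ge_min xy lexx orbT.
rewrite distrC (distrC x) !ger0_norm ?subr_ge0//.
have [h1|h1] := leP x N%:R; have [h2|h2] := leP y N%:R; lra.
Qed.

Lemma translate_defect_le N (delta C : R) g :
  0 < delta -> 0 <= C ->
  (forall u v : R, 0 <= u -> 0 <= v ->
    `|u `^ p - v `^ p| <= delta * (u `^ p + v `^ p) + C * `|u - v| `^ p) ->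
  (mean mu (fun w => rnorm (translate_defect s T (h N) g w)) <=
    (2 * delta * fine (mean mu (h N)) + C * rnorm (b g) `^ p)%:E)%E.
Proof.
move=> d0 C0 key.
have mh := measurable_truncated_power N.
have h0 := truncated_power_ge0 N.
have mhT : measurable_fun setT (fun w => h N (T g^-1%g w)) by exact: (measurableT_comp mh).
have fin : mean mu (h N) \is a fin_num by exact: mean_bounded mh h0 (truncated_power_le N).
have mb : measurable_fun setT (fun w => rnorm (Lp_repr (b g) w) `^ p).
  by apply: measurable_powR_comp; exact/measurable_rnorm/Lp_repr_measurable.
apply: (@le_trans _ _ (mean mu (fun w => delta * (h N (T g^-1%g w) + h N w)
    + C * rnorm (Lp_repr (b g) w) `^ p))).
  apply: mean_ae_le.
  - under eq_fun do rewrite rnorm_real.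
    by apply: measurableT_comp => //; exact: measurable_funB.
  - apply: measurable_funD; apply: measurable_funM => //; exact: measurable_funD.
  - by move=> w; exact: rnorm_ge0.
  - by move=> w; rewrite addr_ge0// mulr_ge0 ?addr_ge0 ?powR_ge0// ltW.
  have := primitive g; have := BL_rnorm1 BL g; apply: filterS2 => w h1 hb.
  rewrite rnorm_real; apply: le_trans (key _ _ (truncation_ge0 _ _) (truncation_ge0 _ _)) _.
  rewrite lerD2l ler_wpM2l//; apply: ge0_ler_powR; rewrite ?nnegrE ?rnorm_ge0 ?(ltW p0)//.
  apply: le_trans (truncation_dist _ _ _) _; rewrite hb.
  have -> : rnorm (f (T g^-1%g w)) = rnorm (twisted_translate T chi g f w).
    by rewrite /twisted_translate rnormM h1 mul1r.
  by rewrite rnorm_distC; exact: ler_rnorm_dist.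
rewrite meanD//; last 4 first.
- by apply: measurable_funM => //; exact: measurable_funD.
- exact: measurable_funM.
- by move=> w; rewrite mulr_ge0 ?addr_ge0// ltW.
- by move=> w; rewrite mulr_ge0 ?powR_ge0.
rewrite !meanZ ?(ltW d0)//; first last.
- by move=> w; rewrite addr_ge0.
- exact: measurable_funD.
- by move=> w; exact: powR_ge0.
rewrite mean_powR_Lp meanD// (mean_comp preserving _ mh)// EFinD EFinM leeD2r//.
by rewrite -[in leLHS](fineK fin) -EFinD -EFinM lee_fin; lra.
Qed.

(** The [L_p] bound on the primitive [f], stated for truncations.  The choice of
    [delta] absorbs the term in [\int h_N] produced by the L1 bounds for the
    cocycles [translate_defect s T (h N)]. *)
Lemma truncated_power_mean_bounded :
  exists Bd : R, forall N, (mean mu (h N) <= Bd%:E)%E.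
Proof.
have [mz|mn0] := eqVneq m 0.
  exists 0 => N; apply: (@le_trans _ _ (mean mu (fun=> N%:R `^ p))).
    apply: mean_le => //; [exact: measurable_truncated_power|exact: truncated_power_ge0|].
    exact: truncated_power_le.
  by rewrite mean_cst -[mu setT]fineK ?fin_num_measure// mz mule0.
have mp : 0 < m by rewrite lt_neqAle eq_sym mn0 m0.
have c2 N := translate_defect_l1_cocycle BL preserving (measurable_truncated_power N)
  (truncated_power_ge0 N) (truncated_power_le N).
have [C cC [c c0 hc]] := cocycle_uniform_bound preserving c2 propT.
have [B B0 hB] := compact_rnorm_bounded cb.1 cC.
pose delta : R := (12 * (c + 1))^-1.
have c10 : 0 < c + 1 by rewrite ltr_wpDl.
have delta0 : 0 < delta by rewrite invr_gt0 mulr_gt0.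
have delta01 : 0 < delta < 1 by rewrite delta0 invf_lt1 ?mulr_gt0//; lra.
have [D D0 hD] := powR_sub_le p0 delta01.
have cdelta : c * (2 * delta) <= 6^-1.
  have -> : c * (2 * delta) = c / (c + 1) / 6 by rewrite /delta; field; rewrite gt_eqF.
  have : c / (c + 1) <= 1 by rewrite ler_pdivrMr// mul1r lerDl.
  by move: (c / _) => x; lra.
have F0fin : mean mu (fun w => rnorm (f w)) \is a fin_num.
  by rewrite ge0_fin_numE// mean_ge0// => w; exact: rnorm_ge0.
pose F0 := fine (mean mu (fun w => rnorm (f w))).
have F00 : 0 <= F0 by rewrite fine_ge0// mean_ge0// => w; exact: rnorm_ge0.
(* By Markov's inequality, [|f| > L] on at most half of the space. *)
pose L : R := 2 * F0 / m + 1.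
have L0 : 0 < L by rewrite ltr_wpDl// divr_ge0// mulr_ge0.
have F0L : F0 / L <= m / 2.
  rewrite ler_pdivrMr// /L mulrDr mulr1.
  rewrite (_ : m / 2 * (2 * F0 / m) = F0); last by field.
  by rewrite lerDl divr_ge0.
pose C' := 2 * m + c * (D * B `^ p).
exists (6 * C' + 4 * L `^ p * m) => N.
have mh := measurable_truncated_power N.
have h0 := truncated_power_ge0 N.
have fin : mean mu (h N) \is a fin_num by exact: mean_bounded mh h0 (truncated_power_le N).
pose I := fine (mean mu (h N)).
have IE : mean mu (h N) = I%:E by rewrite fineK.
have I0 : 0 <= I by rewrite fine_ge0// mean_ge0.
pose M := m + c * (2 * delta * I + D * B `^ p).
have hM g : (mean mu (fun w => rnorm (translate_defect s T (h N) g w)) <= M%:E)%E.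
  apply: hc; first by rewrite addr_ge0 ?mulr_ge0 ?powR_ge0// ltW.
  move=> k Ck; apply: le_trans (translate_defect_le N k delta0 D0 hD) _.
  rewrite lee_fin lerD2l ler_wpM2l//.
  by apply: ge0_ler_powR; rewrite ?nnegrE ?rnorm_ge0 ?(ltW p0)// hB.
have [F [mF FM] hF] := coboundary_of_bounded preserving (c2 N) hM.
have mrF := measurable_rnorm mF.
have [a ha] : exists a, \forall w \ae mu, h N w + sRe (F w) = a.
  apply: (ergodic_constant ergodicT); first by apply: measurable_funD => //; exact: mF.1.
  move=> g; have := hF g; apply: filterS => w /(congr1 (@sRe R s)).
  rewrite /translate_defect /twisted_translate mul1r of_realK sReB; lra.
have rF0 w : 0 <= rnorm (F w) by exact: rnorm_ge0.
pose E := fine (mean mu (fun w => rnorm (F w))).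
have Efin : mean mu (fun w => rnorm (F w)) \is a fin_num by exact: mean_fin_num FM.
have EE : mean mu (fun w => rnorm (F w)) = E%:E by rewrite fineK.
have EM : E <= m + M by rewrite -lee_fin -EE.
pose ap := Num.max a 0.
have ap0 : 0 <= ap by rewrite le_max lexx orbT.
have aap : a <= ap by rewrite le_max lexx.
(* [h N] is within [|F|] of the constant [a], and [ap] is the positive part of [a]. *)
have near_a : \forall w \ae mu, h N w <= rnorm (F w) + ap /\ a <= h N w + rnorm (F w).
  apply: filterS ha => w haw; have := ler_norm_sRe (F w); rewrite ler_norml => /andP[].
  by split; lra.
have muE : m%:E = mu setT by rewrite fineK ?fin_num_measure.
have I_le : I <= E + ap * m.
  rewrite -lee_fin -IE; apply: (@le_trans _ _ (mean mu (fun w => rnorm (F w) + ap))).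
    apply: mean_ae_le => //; first exact: measurable_funD.
      by move=> w; rewrite addr_ge0.
    by apply: filterS near_a => w [].
  by rewrite meanD// mean_cst EE EFinD EFinM muE.
(* Pointwise, [ap] is at most [|F| + L^p] where [|f| <= L], and at most
   [ap * |f| / L] elsewhere. *)
have ap_le : ap * m <= E + L `^ p * m + ap / L * F0.
  rewrite -lee_fin; apply: (@le_trans _ _
      (mean mu (fun w => (rnorm (F w) + L `^ p) + ap / L * rnorm (f w)))).
    rewrite EFinM muE -mean_cst; apply: mean_ae_le => //.
    - by apply: measurable_funD; [exact: measurable_funD|
        apply: measurable_funM => //; exact: measurable_rnorm].
    - by move=> w; rewrite !addr_ge0 ?mulr_ge0 ?rnorm_ge0 ?powR_ge0// invr_ge0 ltW.
    apply: filterS near_a => w [_ haw].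
    have t0 : 0 <= ap / L * rnorm (f w).
      by rewrite !mulr_ge0 ?rnorm_ge0// invr_ge0 ltW.
    have L1 := powR_ge0 L p; have := rF0 w.
    have [fL|/ltW fL] := leP (rnorm (f w)) L.
      have hL : h N w <= L `^ p.
        apply: ge0_ler_powR; rewrite ?nnegrE ?truncation_ge0 ?(ltW p0) ?(ltW L0)//.
        by rewrite ge_min fL.
      by rewrite /ap ge_max; move: t0; rewrite -/ap => t0 ?; apply/andP; split; lra.
    have : ap <= ap / L * rnorm (f w).
      by rewrite -mulrA ler_peMr// mulrC ler_pdivlMr// mul1r.
    by lra.
  have mrf := measurable_rnorm mf.
  rewrite !meanD//; last first.
  all: try by move=> w; rewrite ?addr_ge0 ?mulr_ge0 ?rnorm_ge0 ?powR_ge0// ?invr_ge0 ?(ltW L0).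
  all: try by [exact: measurable_funM|exact: measurable_funD].
  rewrite mean_cst meanZ//; last 2 first.
  - by move=> w; exact: rnorm_ge0.
  - by rewrite divr_ge0// ltW.
  by rewrite EE -(fineK F0fin) -/F0 !EFinD !EFinM muE.
rewrite IE lee_fin.
have apL : ap / L * F0 <= ap * m / 2.
  by rewrite mulrAC -!mulrA ler_wpM2l.
have cdI : c * (2 * delta) * I <= 6^-1 * I by rewrite ler_wpM2r.
have MI : m + M <= C' + 6^-1 * I by rewrite /M /C'; lra.
lra.
Qed.

(** Chebyshev's inequality for [h N], with [N] above the level [x]. *)
Lemma weak_Lp_of_truncated_power_mean_bounded (Bd : R) :
  (forall N, (mean mu (h N) <= Bd%:E)%E) -> (weak_norm mu p f < +oo)%E.
Proof.
move=> hBd.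
have Bd0 : 0 <= Bd.
  by rewrite -lee_fin; apply: le_trans (hBd 0); apply: mean_ge0 => w; exact: powR_ge0.
apply: (@le_lt_trans _ _ (Bd `^ p^-1)%:E); last by rewrite ltry.
apply: ge_ereal_sup => _ [x /= x0 <-].
set A := [set w | _].
have mA : measurable A.
  have := measurable_rnorm mf measurableT (measurable_itv `]x, +oo[).
  by rewrite setTI; congr measurable; apply/seteqP; split => w /=; rewrite in_itv/= andbT.
pose N := (Num.truncn x).+1.
have xN : x <= N%:R by rewrite ltW// truncnS_gt.
have hA : ((x `^ p)%:E * mu A <= Bd%:E)%E.
  apply: le_trans (hBd N).
  have -> : mu A = mean mu (fun w => \1_A w) by rewrite /mean integral_indic// setIT.
  rewrite -meanZ ?powR_ge0//; last exact: measurable_indic.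
  apply: mean_le.
  - by apply: measurable_funM => //; exact: measurable_indic.
  - exact: measurable_truncated_power.
  - by move=> w; rewrite mulr_ge0 ?powR_ge0.
  - move=> w; rewrite indicE; have [wA|wA] := boolP (w \in A); last first.
      by rewrite mulr0; exact: powR_ge0.
    rewrite mulr1; apply: ge0_ler_powR; rewrite ?nnegrE ?truncation_ge0 ?(ltW p0) ?(ltW x0)//.
    by rewrite le_min xN andbT ltW//; move: wA; rewrite inE.
have muA : mu A \is a fin_num by rewrite fin_num_measure.
rewrite -(fineK muA) in hA *; set r := fine (mu A) in hA *.
have r0 : 0 <= r by rewrite fine_ge0.
rewrite poweR_EFin -EFinM lee_fin.
have -> : x = (x `^ p) `^ p^-1 by rewrite -powRrM mulfV ?gt_eqF// powRr1// ltW.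
rewrite -powRM ?powR_ge0//; apply: ge0_ler_powR; rewrite ?nnegrE ?invr_ge0 ?mulr_ge0 ?powR_ge0 ?(ltW p0)//.
Qed.

End truncation.

End primitive.

Local Close Scope quotient_scope.

Theorem theorem3 (R : realType) (s : scalar_kind) (G : topologicalGroupType)
    (d : measure_display) (Omega : measurableType d)
    (mu : {finite_measure set Omega -> \bar R})
    (p : R) (p1 : 1 <= p)
    (pi : linear_isometric_action G (Lp s mu p1))
    (T : G -> {mfun Omega >-> Omega}) (chi : G -> Omega -> scalars R s)
    (b : G -> Lp s mu p1) :
  property_T R s G ->
  standard_borel R d Omega ->
  p != 2 ->
  is_BL_action pi T chi ->
  ergodic mu T ->
  measure_preserving mu T ->
  cocycle pi b ->
  exists f : Omega -> scalars R s,
    weak_Lp mu p f /\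
    forall g : G,
      Lp_repr (b g) = (fun w => twisted_translate T chi g f w - f w) %[ae mu].
Proof.
move=> propT _ _ BL ergodicT preserving cb.
have [f [mf intf] hf] := L1_primitive propT BL preserving cb.
have [Bd hBd] := truncated_power_mean_bounded propT BL ergodicT preserving cb mf intf hf.
exists (fun w => - f w); split.
  split; first exact: scalar_measurableN.
  have := weak_Lp_of_truncated_power_mean_bounded p1 mf hBd; congr (_ < _)%E.
  rewrite /weak_norm; congr ereal_sup; apply/seteqP; split => _ [x x0 <-]; exists x => //;
    by congr (_ * mu _ `^ _)%E; apply/funext => w /=; rewrite rnormN.
move=> g; have := hf g; apply: filterS => w hw _.
by rewrite hw /twisted_translate mulrN opprK addrC.
Qed.
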